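(* Let $k\ge 2$. Then for every $s$, \[\liminf_{A\rightarrow \infty}\frac{\#\{|\mathbf a|\le A: a_1x_1^k+\dots+a_sx_s^k=0 \text{ has a solution with all } x_j \text{ prime}\}}{(2A)^{s}}=1-O\left(s^{\lambda(k)}2^{-s}\right)\] for some $\lambda(k)$, where the implied constant depends only on $k$ (not on $s$). In particular the lower density of tuples $\mathbf a$ for which the equation has a solution in primes tends to $1$ as $s\to\infty$.
   Context: $\mathbf a=(a_1,\dots,a_s)$ ranges over tuples of nonzero integers with $|\mathbf a|=\max_j|a_j|\le A$. *)

(* Defs.v *)
From HB Require Import structures.
From mathcomp Require Import all_boot all_order all_algebra.
From mathcomp Require Import all_classical all_reals all_analysis.
Set Implicit Arguments. Unset Strict Implicit. Unset Printing Implicit Defensive.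
Import Order.TTheory GRing.Theory Num.Theory.
Local Open Scope ring_scope.

Definition coef (A : nat) (i : 'I_(2 * A + 1)) : int := (i : nat)%:Z - A%:Z.

Definition solvable_in_primes (k s : nat) (a : 'I_s -> int) : Prop :=
  exists x : 'I_s -> nat,
    (forall j, prime (x j)) /\ \sum_(j < s) a j * ((x j ^ k)%N)%:Z = 0.

Definition count_solvable (k s A : nat) : nat :=
  #|[set a : {ffun 'I_s -> 'I_(2 * A + 1)} |
      [forall j, coef (a j) != 0] &&
      `[< solvable_in_primes k (fun j => coef (a j)) >] ]|.

Definition density (R : realType) (k s : nat) (A : nat) : R :=
  (count_solvable k s A)%:R / ((2 * A)%:R ^+ s).

(* Main.v *)
Require Import Defs.
From HB Require Import structures.
From mathcomp Require Import all_classical all_reals all_analysis.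
From mathcomp Require Import all_boot all_order all_algebra.
From mathcomp Require Import zify ring lra.
Set Implicit Arguments.
Unset Strict Implicit.
Unset Printing Implicit Defensive.

(** Let [m = 64 k], let [v] range over the vectors of [2m] coefficients in
    [[-A, A]] and [x] over the [2m]-tuples of primes up to about [A^(1/(4k))].
    For all but a small proportion of the [v], some value [v . x^k] hits a net
    having one point in each residue class modulo [w!] of each cell of length
    [H]. This is a second moment argument: the [v] for which [v . x^k] and
    [v . y^k] both hit the net are counted by shifting [v] by short integer
    vectors with prescribed products with [x^k] and [y^k]. Such vectors exist
    up to the gcd of the two by two minors of [(x^k, y^k)], and their size is
    governed by the largest minor; both quantities are controlled on average by
    counting primes in arithmetic progressions and in short intervals. On the
    other hand a bounded number of coefficients of both signs, not all divisible
    by any small prime, suffices to complete a net point to a solution.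

    Now single out a bounded number of such outer coefficients and cut the
    others into [r] superblocks, each made of a vector [v] and one spare
    coefficient. Putting the variables of all superblocks but one equal to 2
    (and the spare variable of the remaining one equal to 3) gives [r] attempts
    at solving the equation, each with target of size [O(sA)]. The coefficients
    can be recovered from the vectors [v] and the [r] targets, and these targets
    share a window of length [O(A)]; so the failures are independent up to a
    factor [O(s)], and at most [O(s^c (2A)^s 2^-s)] tuples fail them all. If no
    outer coefficients are available, then all but [O(1)] coefficients are
    nonpositive, or nonnegative, or divisible by the same prime: each of these
    lies in a set containing about half of [[-A, A]] or less. *)

(** * Primes in arithmetic progressions and Chebyshev's lower bound *)

(** A superblock has [2m + 1] coefficients and its failure must gain the full factor [2 ^ (2m + 1)].
    So the proportion of bad vectors [v] must be arbitrarily small, with constants fixed before the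
    number [r] of superblocks; this is why the second moment is needed to leading order and not only
    up to a constant. The [2m] coordinates are grouped in [m] fixed pairs, and only the minor inside
    each pair is used: minors of different pairs involve disjoint variables, so their bounds
    multiply. One pair gains [q ^ (-1/(8k))], hence [m = 64k] pairs gain [q ^ -8], enough for sixth
    moments of the gcd and of the deficit of the largest minor. The net is spaced modulo the
    factorial of [w] because a gcd at most [w] divides it and then costs nothing, while larger gcds
    are rare. With [U] the bound for the [x ^ k], the size of the primes is tied to [A] by
    [U ^ 4 <= A], so that shifts of size [U ^ 2] are negligible. The factor [2 ^ -s] is natural:
    coefficients of one sign admit no solution at all. *)

Lemma sum_div_expn_le p n K : prime p -> \sum_(1 <= i < K) n %/ p ^ i <= n.
Proof.
move=> p_pr; elim: K n => [|[|K] IHK] n; [by rewrite big_geq|by rewrite big_geq|].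
rewrite big_nat_recl //= expn1.
under eq_bigr => i _ do rewrite expnS divnMA.
have n2 : n %/ p <= n %/ 2 by rewrite leq_div2l ?prime_gt1.
have /leq_trans -> // : n %/ p + \sum_(1 <= i < K.+1) n %/ p %/ p ^ i <= n %/ p + n %/ p.
  by rewrite leq_add2l IHK.
by rewrite (leq_trans (leq_add n2 n2)) //; lia.
Qed.

Lemma logn_fact_leq p n : prime p -> logn p n`! <= n.
Proof. by move=> p_pr; rewrite logn_fact // sum_div_expn_le. Qed.

Lemma fact_dvd_rising x L : L`! %| \prod_(i < L) (x + i).
Proof.
case: L => [|L]; first by rewrite big_ord0.
have -> : \prod_(i < L.+1) (x + i) = (x + L) ^_ L.+1.
  rewrite ffact_prod (reindex_inj rev_ord_inj) /=.
  by apply: eq_bigr => i _; have := ltn_ord i; lia.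
by rewrite -bin_ffact dvdn_mull.
Qed.

Lemma prodn_modl (I : Type) (r : seq I) (F G : I -> nat) d :
  (forall i, F i = G i %[mod d]) -> \prod_(i <- r) F i = \prod_(i <- r) G i %[mod d].
Proof.
move=> FG; elim/big_rec2: _ => // i x y _ xy.
by rewrite -modnMm FG xy modnMm.
Qed.

(* A prime dividing [q] occurs in [L`!] at most [L] times, hence is absorbed by
   [q ^ L]; modulo a prime power coprime to [q], the progression becomes, up to
   a unit, a run of consecutive integers. *)
Lemma fact_dvd_progression q c L :
  L`! %| q ^ L * \prod_(i < L) (c + q * i).
Proof.
apply/dvdn_partP => [|p]; first exact: fact_gt0.
rewrite mem_primes => /and3P[p_pr _ _]; rewrite p_part.
have [pq|pNq] := boolP (p %| q).
  apply: dvdn_mulr; apply: dvdn_trans (dvdn_exp2r _ pq).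
  by apply: dvdn_exp2l; apply: logn_fact_leq.
set u := p ^ _; have u_gt0 : 0 < u by rewrite expn_gt0 prime_gt0.
have cuq : coprime u q by rewrite coprimeXl // prime_coprime.
have [[r s] /= rs] := coprimeP q u_gt0 cuq; apply: dvdn_mull.

have [t rq] : exists t, t * q = 1 %[mod u].
  (* Bezout reads [r u - s q = 1], so [- s] inverts [q] modulo [u]; [(u - 1) s] represents it in
     [nat]. *)
  exists ((u - 1) * s).
  have e : (u - 1) * s * q + u * r = u * (s * q) + 1.
    by rewrite mulnBl mul1n mulnBl; move: rs; set a := r * u; nia.
  by rewrite -(modnMDl r) addnC [r * u]mulnC e mulnC modnMDl.
have : u %| \prod_(i < L) (t * (c + q * i)).
  rewrite /dvdn (@prodn_modl _ _ _ (fun i : 'I_L => t * c + i)).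
    by apply: dvdn_trans (fact_dvd_rising _ _); rewrite pfactor_dvdnn.
  by move=> i; rewrite mulnDr mulnA -modnDmr -modnMml rq modnMml mul1n modnDmr.
rewrite big_split /= prod_nat_const card_ord Gauss_dvdr //.
rewrite coprimeXr // /coprime; apply/eqP.
have ctq : coprime u (t * q) by rewrite -coprime_modr rq coprime_modr coprimen1.
by move: ctq; rewrite coprimeMr => /andP[/eqP].
Qed.

Lemma prod_primes_dvd (S : seq nat) n :
  uniq S -> all prime S -> {in S, forall x, x %| n} -> \prod_(x <- S) x %| n.
Proof.
elim: S => [|x S IHS] /=; first by rewrite big_nil.
move=> /andP[xS uS] /andP[px pS] Sn; rewrite big_cons Gauss_dvd.
  by rewrite Sn ?mem_head // IHS // => y yS; rewrite Sn // inE yS orbT.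
rewrite big_seq; apply: (big_ind (fun z => coprime x z)) => [|a b|y yS].
- exact: coprimen1.
- by rewrite coprimeMr => -> ->.
- rewrite prime_coprime // dvdn_prime2 //; last exact: (allP pS).
  by apply: contraNneq xS => ->.
Qed.

Lemma prime_dvd_fact p n : prime p -> (p %| n`!) = (p <= n).
Proof.
move=> p_pr; apply/idP/idP => [|pn]; last by rewrite dvdn_fact ?prime_gt0.
elim: n => [|n IHn]; first by rewrite fact0 dvdn1 => /eqP p1; rewrite p1 in p_pr.
rewrite factS Euclid_dvdM // => /orP[/dvdn_leq -> //|/IHn]; exact: leqW.
Qed.

(** Distinct primes above [L] are coprime to the factorial of [L], so their product and this
    factorial can be divided out together. After taking logarithms this serves as a Brun-Titchmarsh
    inequality, up to a logarithm. *)
Lemma prod_primes_progression (S : seq nat) q c L :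
    0 < c -> uniq S -> all prime S ->
    {in S, forall x, L < x /\ exists2 i, i < L & x = c + q * i} -> 0 < q ->
  \prod_(x <- S) x * L`! <= q ^ L * \prod_(i < L) (c + q * i).
Proof.
move=> c_gt0 uS pS Sqc q_gt0; apply: dvdn_leq.
  rewrite muln_gt0 expn_gt0 q_gt0 /= prodn_gt0 // => i.
  by rewrite addn_gt0 c_gt0.
rewrite Gauss_dvd; last first.
  rewrite big_seq; apply: (big_ind (fun z => coprime z L`!)) => [|a b|x xS].
  - exact: coprime1n.
  - by rewrite coprimeMl => -> ->.
  have px : prime x by exact: (allP pS).
  by rewrite prime_coprime // prime_dvd_fact // -ltnNge; case: (Sqc x xS).
rewrite fact_dvd_progression andbT; apply: prod_primes_dvd => // x xS.
have [_ [i iL ->]] := Sqc x xS; apply: dvdn_mull.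
by rewrite (bigD1 (Ordinal iL)) //= dvdn_mulr.
Qed.

Lemma bin_central_le n : 'C(2 * n, n) <= 4 ^ n.
Proof.
have -> : 4 ^ n = (1 + 1) ^ (2 * n) by rewrite -[4]/(2 ^ 2) -expnM.
have nlt : n < (2 * n).+1 by lia.
rewrite Pascal (bigD1 (Ordinal nlt)) //= !exp1n !muln1; exact: leq_addr.
Qed.

Lemma expnn_le_fact n : n ^ n <= 4 ^ n * n`!.
Proof.
apply: leq_trans (leq_mul (bin_central_le n) (leqnn _)).
rewrite bin_ffact ffact_prod -{2}[n]card_ord -prod_nat_const.
by apply: leq_prod => i _; have := ltn_ord i; lia.
Qed.

Lemma exp2_le_bin_central n : 2 ^ n <= 'C(2 * n, n).
Proof.
rewrite -(leq_pmul2r (fact_gt0 n)) bin_ffact -ffactnn !ffact_prod.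
have -> : 2 ^ n = \prod_(i < n) 2 by rewrite prod_nat_const card_ord.
rewrite -big_split /=.
by apply: leq_prod => i _; have := ltn_ord i; lia.
Qed.

(** In Legendre's formula a power [p ^ i <= 2n] contributes [2n %/ p ^ i] minus twice [n %/ p ^ i],
    which is at most 1; larger powers contribute nothing. *)
Lemma logn_bin_central p n : prime p -> logn p 'C(2 * n, n) <= trunc_log p (2 * n).
Proof.
move=> p_pr; have p_gt1 := prime_gt1 p_pr.
have e : logn p 'C(2 * n, n) + (logn p n`! + logn p n`!) = logn p (2 * n)`!.
  have nle : n <= 2 * n by lia.
  have := bin_fact nle; rewrite (_ : 2 * n - n = n); last by lia.
  by move=> <-; rewrite !lognM ?muln_gt0 ?fact_gt0 ?bin_gt0.
have le1 : logn p (2 * n)`! <=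
    \sum_(1 <= i < (2 * n).+1) (i <= trunc_log p (2 * n)) + (logn p n`! + logn p n`!).
  have e2 : logn p n`! = \sum_(1 <= i < (2 * n).+1) n %/ p ^ i.
    rewrite logn_fact // [RHS](@big_cat_nat _ _ _ n.+1) //=; last by lia.
    rewrite [X in _ + X]big_nat [X in _ + X]big1 ?addn0 // => i /andP[ni _].
    by rewrite divn_small // (ltn_trans _ (ltn_expl _ p_gt1)).
  rewrite logn_fact // !e2 -!big_split /=; apply: leq_sum => i _.
  have pi0 : 0 < p ^ i by rewrite expn_gt0 ltnW.
  case: (leqP i (trunc_log _ _)) => [_|ti].
    rewrite -ltnS ltn_divLR //.
    have := divn_eq n (p ^ i); have := ltn_pmod n pi0; nia.
  rewrite divn_small //; apply: leq_trans (trunc_log_ltn _ p_gt1) _.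
  by rewrite leq_exp2l.
have le2 K t : \sum_(1 <= i < K) (i <= t) <= minn K.-1 t.
  elim: K => [|[|K] IH]; [by rewrite big_geq|by rewrite big_geq|].
  rewrite big_nat_recr //=; move: IH => /=; case: (leqP K.+1 t); lia.
have := le2 (2 * n).+1 (trunc_log p (2 * n)); lia.
Qed.

(** The primes in [(2 ^ j, 2 ^ j.+1]] divide a central binomial coefficient, so passing from [j] to
    [j.+1] squares the bound. Powers of two are enough for the dyadic ranges below. *)
Lemma primorial_le j : \prod_(0 <= p < (2 ^ j).+1 | prime p) p <= 4 ^ (2 ^ j).
Proof.
elim: j => [|j IHj]; first by rewrite unlock.
rewrite (@big_cat_nat _ _ _ (2 ^ j).+1) //=; last by rewrite ltnS leq_exp2l.
have -> : 4 ^ (2 ^ j.+1) = 4 ^ (2 ^ j) * 4 ^ (2 ^ j) by rewrite -expnD addnn -mul2n -expnS.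
apply: leq_mul => //; apply: leq_trans (bin_central_le (2 ^ j)).
have nle : 2 ^ j <= 2 * 2 ^ j by lia.
apply: dvdn_leq; first by rewrite bin_gt0.
rewrite -big_filter; apply: prod_primes_dvd.
- by rewrite filter_uniq // iota_uniq.
- by apply/allP => p; rewrite mem_filter => /andP[].
move=> p; rewrite mem_filter mem_index_iota => /and3P[p_pr jp pj].
have := bin_fact nle; rewrite (_ : 2 * 2 ^ j - 2 ^ j = 2 ^ j); last by lia.
move=> /(congr1 (dvdn p)); rewrite [p %| (2 * _)`!]prime_dvd_fact // !Euclid_dvdM //.
rewrite !prime_dvd_fact // [p <= 2 ^ j]leqNgt jp !orbF => ->.
by rewrite -expnS -ltnS.
Qed.

Definition primes_in (a b : nat) : seq nat := [seq p <- index_iota a.+1 b.+1 | prime p].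

(** Factor the central binomial coefficient of [n], with [X = 2n]. Each prime power in it is at most
    [X]. Primes beyond [sqrt X] occur at most once, so those up to [X / 8] cost no more than the
    primorial bound [4 ^ (X / 8)], only the square root of the lower bound [2 ^ (X / 2)]. The primes
    in [(X / 8, X]] must supply the rest. *)
Lemma chebyshev_prod j : 3 <= j ->
  2 ^ (2 ^ j.-1) <=
    (2 ^ j) ^ (2 ^ (uphalf j)).+1 * 4 ^ (2 ^ (j - 3)) *
    (2 ^ j) ^ size (primes_in (2 ^ (j - 3)) (2 ^ j)).
Proof.
move=> j3; have jE : 2 ^ j = 2 * 2 ^ j.-1 by rewrite -expnS prednK //; lia.
set n := 2 ^ j.-1; set X := 2 ^ j; set s := 2 ^ uphalf j; set Y := 2 ^ (j - 3).
have X_gt0 : 0 < X by rewrite expn_gt0.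
apply: leq_trans (exp2_le_bin_central n) _.
rewrite -[X in X <= _]partnT ?bin_gt0; last by lia.
have XC : X <= 'C(2 * n, n).
  apply: leq_trans (exp2_le_bin_central n); rewrite /X leq_exp2l // /n.
  by apply: leq_trans (ltn_expl j.-1 (ltnSn 1)); lia.
rewrite /partn (@big_cat_nat _ _ _ X.+1) //=.
rewrite [X in _ * X]big_nat_cond [X in _ * X]big1 ?muln1; last first.
  move=> p /andP[/andP[Xp _] _]; have [p_pr|pNpr] := boolP (prime p); last first.
    by rewrite lognE (negbTE pNpr).
  have := logn_bin_central n p_pr; suff -> : trunc_log p (2 * n) = 0.
    by rewrite leqn0 => /eqP ->.
  by apply/eqP; rewrite trunc_log_eq0; apply/orP; right; lia.
pose h1 p := if p < s.+1 then X else 1.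
pose h2 p := if (p < Y.+1) && prime p then p else 1.
pose h3 p := if (Y.+1 <= p) && prime p then X else 1.
have nX : 2 * n = X by [].
apply: (@leq_trans (\prod_(0 <= p < X.+1) (h1 p * h2 p * h3 p))).
  apply: leq_prod => p _; rewrite /h1 /h2 /h3.
  have [p_pr|pNpr] := boolP (prime p); last first.
    by rewrite lognE (negbTE pNpr) /= !andbF; case: ifP; rewrite ?muln1.
  have p_gt1 := prime_gt1 p_pr; rewrite !andbT.
  have pX : p ^ logn p 'C(2 * n, n) <= X.
    apply: leq_trans (trunc_logP p_gt1 X_gt0); rewrite leq_exp2l //.
    by rewrite -nX logn_bin_central.
  have [ps|ps] := ltnP p s.+1.
    by apply: leq_trans pX _; case: (ltnP p Y.+1) => _; rewrite ?muln1; nia.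
  rewrite mul1n; have [pY|pY] := ltnP p Y.+1; last by rewrite mul1n.
  rewrite muln1; apply: (@leq_trans (p ^ 1)) => //; rewrite leq_exp2l //.
  apply: leq_trans (logn_bin_central n p_pr) _; rewrite -ltnS nX.
  rewrite -(ltn_exp2l _ _ p_gt1); apply: leq_ltn_trans (trunc_logP p_gt1 X_gt0) _.
  apply: (@leq_trans (s.+1 ^ 2)); last by rewrite leq_exp2r.
  apply: (@leq_trans (s ^ 2).+1); last by rewrite ltn_exp2r.
  rewrite ltnS /s /X -expnM leq_exp2l //; lia.
rewrite !big_split /=; apply: leq_mul; first apply: leq_mul.
- rewrite /h1 -big_mkcond /= -(big_nat_widen 0 s.+1 X.+1 predT); last first.
    by rewrite ltnS /s /Y /X leq_exp2l //; lia.
  by rewrite prod_nat_const_nat subn0.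
- rewrite /h2 -big_mkcond /=.
  rewrite (eq_bigl (fun p => prime p && (p < Y.+1))); last by move=> p; rewrite andbC.
  rewrite -(big_nat_widen 0 Y.+1 X.+1 prime); first exact: primorial_le.
  by rewrite ltnS /s /Y /X leq_exp2l //; lia.
- rewrite /h3 -big_mkcond /=.
  rewrite (eq_bigl (fun p => prime p && (Y.+1 <= p))); last by move=> p; rewrite andbC.
  rewrite -(big_nat_widenl Y.+1 0 X.+1 prime) // -big_filter -/(primes_in Y X).
  by rewrite big_const_seq count_predT iter_muln muln1.
Qed.

Lemma leq_expn2r m n e : m <= n -> m ^ e <= n ^ e.
Proof. by move=> mn; case: e => // e; rewrite leq_exp2r. Qed.

Definition big_primes (j : nat) : seq nat := primes_in (2 ^ (j - 3)) (2 ^ j).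

Lemma mem_big_primes j p :
  (p \in big_primes j) = [&& prime p, 2 ^ (j - 3) < p & p <= 2 ^ j].
Proof. by rewrite mem_filter mem_index_iota ltnS. Qed.

Lemma big_primes_uniq j : uniq (big_primes j).
Proof. by rewrite filter_uniq ?iota_uniq. Qed.

Lemma chebyshev j : 18 <= j -> 2 ^ (j - 3) <= j * size (big_primes j).
Proof.
move=> j18; have := @chebyshev_prod j; rewrite -/(big_primes j).
set N := size _ => /(_ (leq_trans _ j18)) -/(_ isT).
rewrite -[4]/(2 ^ 2) -!expnM -!expnD leq_exp2l // => le.
(* The small primes cost [j (2 ^ uphalf j + 1)] in the exponent. This is below [2 ^ (j - 3)] once
   [j <= 2 ^ (j./2 - 4)], which holds from [j = 18] on: the origin of the threshold 18. *)
have h9 : 9 <= j./2 by lia.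
have hle : j <= 2 ^ (j./2 - 4).
  have [h hE] : exists h, j./2 = h + 9 by exists (j./2 - 9); lia.
  apply: (@leq_trans (2 * j./2).+1); first by lia.
  rewrite {}hE {h9}; elim: h => // h IH.
  by rewrite (_ : h.+1 + 9 - 4 = (h + 9 - 4).+1) ?expnS; lia.
have e1 : 2 ^ (j - 3) = 2 ^ (j./2 - 4) * 2 ^ (uphalf j).+1.
  by rewrite -expnD; congr (_ ^ _); lia.
have e2 : 2 ^ j.-1 = 4 * 2 ^ (j - 3) by rewrite -[4]/(2 ^ 2) -expnD; congr (_ ^ _); lia.
have : j * (2 ^ uphalf j).+1 <= 2 ^ (j - 3).
  rewrite e1; apply: leq_mul => //; rewrite expnS.
  have : 0 < 2 ^ uphalf j by rewrite expn_gt0.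
  lia.
by move: le; rewrite e2; lia.
Qed.

(** Trades the squared logarithm of the sieve bound for a single factor [y]; the exponents used
    later can afford this loss. *)
Lemma up_log2_sqr y : 0 < y -> (3 + 2 * up_log 2 y) ^ 2 <= 25 * y.
Proof.
have base l : (3 + 2 * l.+1) ^ 2 <= 25 * (2 ^ l).+1.
  have [|l5] := leqP l 4; first by move: l => [|[|[|[|[|]]]]].
  rewrite -(subnK l5); elim: {l l5}(l - 5) => [//|l].
  by rewrite addSn [2 ^ _.+1]expnS; move: (2 ^ (l + 5)) => u; rewrite -!mulnn; lia.
move=> y0; have [y1|y1] := leqP y 1.
  by have -> : y = 1 by lia.
have /= := up_log_gtn (ltnSn 1) y1; have : 0 < up_log 2 y by rewrite up_log_gt0.
case: (up_log 2 y) => // l _ /= ly; apply: leq_trans (base l) _; lia.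
Qed.

(** In base 2 logarithms the product bound becomes [(j - 3) size S <= t L] with
    [t = 3 + 2 up_log 2 y]. Against Chebyshev's bound this gives [size S y <= 16 c0 t N], and
    squaring removes [t] at the price of one factor [y]. So only the saving [sqrt y] survives, with
    the constant [80 = 16 * 5]. *)
Lemma primes_progression_count (S : seq nat) j q c L c0 y :
    18 <= j -> uniq S -> all prime S -> 0 < c -> 0 < q -> q <= y ->
    {in S, forall x, 2 ^ (j - 3) < x /\ exists2 i, i < L & x = c + q * i} ->
    L <= 2 ^ (j - 3) -> (forall i, i < L -> c + q * i <= 2 ^ j.+1) ->
    2 ^ j <= L * y -> L * y <= c0 * 2 ^ j ->
  size S ^ 2 * y <= (80 * c0 * size (big_primes j)) ^ 2.
Proof.
move=> j18 uS pS c0' q0 qy Sqc Lj cL jL Lc0; set N := size (big_primes j).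
have SL : {in S, forall x, L < x /\ exists2 i, i < L & x = c + q * i}.
  by move=> x /Sqc[xj ?]; split => //; apply: leq_ltn_trans xj.
have le1 := prod_primes_progression c0' uS pS SL q0.
have le2 : (2 ^ (j - 3)) ^ size S <= \prod_(x <- S) x.
  rewrite -(count_predT S) -iter_muln_1 -big_const_seq !big_seq.
  by apply: leq_prod => x xS; case: (Sqc x xS) => /ltnW.
have le3 : \prod_(i < L) (c + q * i) <= (2 ^ j.+1) ^ L.
  have -> : (2 ^ j.+1) ^ L = \prod_(i < L) 2 ^ j.+1 by rewrite prod_nat_const card_ord.
  by apply: leq_prod => i _; apply: cL.
have y0 : 0 < y by lia.
set t := 3 + 2 * up_log 2 y.
have le4 : q * (2 * y) * 4 <= 2 ^ t.
  rewrite /t expnD -[2 ^ 3]/8 mulnC expnM mulnC.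
  have := up_logP y (ltnSn 1); set u := 2 ^ up_log 2 y => yu.
  have -> : (2 ^ 2) ^ up_log 2 y = u * u by rewrite -expnM mulnC expnM expnS expn1.
  nia.
have le5 : (2 ^ (j - 3)) ^ size S * L`! <= (2 ^ t) ^ L * L`!.
  apply: leq_trans (leq_mul le2 (leqnn _)) _; apply: leq_trans le1 _.
  apply: leq_trans (leq_mul (leqnn _) le3) _.
  apply: (@leq_trans ((q * (2 * y)) ^ L * L ^ L)).
    by rewrite -!expnMn leq_expn2r //; rewrite expnS; nia.
  apply: leq_trans (leq_mul (leqnn _) (expnn_le_fact L)) _.
  by rewrite mulnA -expnMn leq_mul // leq_expn2r.
move: le5; rewrite leq_pmul2r ?fact_gt0 // -!expnM leq_exp2l // => le5.
have ch := chebyshev j18; rewrite -/N in ch.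
have jE : 2 ^ j = 8 * 2 ^ (j - 3) by rewrite -[8]/(2 ^ 3) -expnD; congr (_ ^ _); lia.
have le6 : size S * y * j <= 16 * c0 * t * N * j.
  have : (j - 3) * size S * y <= t * (c0 * (8 * 2 ^ (j - 3))).
    by rewrite -jE; apply: leq_trans (leq_mul le5 (leqnn y)) _; rewrite -mulnA leq_mul.
  have : j * (size S * y) <= 2 * ((j - 3) * (size S * y)) by nia.
  have : t * c0 * 2 ^ (j - 3) <= t * c0 * (j * N) by rewrite leq_mul.
  lia.
have le7 : size S * y <= 16 * c0 * t * N by move: le6; rewrite leq_pmul2r //; lia.
have le8 : (size S * y) ^ 2 <= (16 * c0 * N) ^ 2 * (25 * y).
  apply: leq_trans (_ : (16 * c0 * t * N) ^ 2 <= _); first by rewrite leq_sqr.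
  have := up_log2_sqr y0; rewrite -/t; set T := t ^ 2.
  have -> : (16 * c0 * t * N) ^ 2 = (16 * c0 * N) ^ 2 * T by rewrite /T; ring.
  by move=> ?; rewrite leq_mul.
rewrite -(leq_pmul2r y0); apply: leq_trans (_ : (size S * y) ^ 2 <= _).
  by rewrite expnMn -mulnA.
apply: leq_trans le8 _; apply: eq_leq; ring.
Qed.

(** * Roots of powers modulo an integer *)

(** Only units are kept: modulo a high prime power the roots of 0 alone would be too numerous. *)
Definition kth_roots (k q r : nat) : {set 'I_q} :=
  [set t : 'I_q | coprime t q && (t ^ k == r %[mod q])].

Lemma kth_roots_prime k p r : prime p -> 0 < k ->
  #|[set t : 'I_p | t ^ k == r %[mod p]]| <= k.
Proof.
move=> p_pr k_gt0; set A := [set t | _].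
pose f (t : 'I_p) : 'F_p := ((t : nat)%:R)%R.
have eqF (a b : nat) : ((a%:R : 'F_p) == b%:R)%R = (a == b %[mod p]).
  apply/eqP/eqP => e; first by rewrite -(val_Fp_nat p_pr a) e val_Fp_nat.
  by apply: ord_inj; rewrite !val_Fp_nat.
have f_inj : injective f.
  move=> a b /eqP; rewrite eqF !modn_small ?ltn_ord // => /eqP; exact: val_inj.
pose P : {poly 'F_p} := ('X^k - (r%:R)%:P)%R.
have sP : size P = k.+1 by rewrite size_XnsubC.
have P0 : (P != 0)%R by rewrite -size_poly_eq0 sP.
have := @max_poly_roots _ P (map f (enum A)) P0.
rewrite size_map -cardE sP ltnS; apply; last by rewrite map_inj_uniq ?enum_uniq.
apply/allP => y /mapP[t]; rewrite mem_enum inE -eqF GRing.natrX => /eqP tr yE.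
by rewrite /root /P yE !hornerE /f tr GRing.subrr.
Qed.

(** Hensel-type cancellation: with [v = logn p k], the quotient of [a ^ k - b ^ k] by [a - b] is
    congruent to [k b ^ k.-1] modulo [p ^ v.+1], so it absorbs at most [v] factors [p]. *)
Lemma kth_power_congr p k e a b : prime p -> 0 < k -> ~~ (p %| b) ->
  a = b %[mod p ^ (logn p k).+1] -> a ^ k = b ^ k %[mod p ^ e] ->
  a = b %[mod p ^ (e - logn p k)].
Proof.
move=> p_pr k0 pb; set v := logn p k.
wlog ba : a b pb / b <= a.
  move=> W ab abk; have [ba|/ltnW ba] := leqP b a; first exact: W.
  apply/esym; apply: W => //.
  apply: contra pb => pa; have : b = a %[mod p].
    have pv : p %| p ^ v.+1 by rewrite expnS dvdn_mulr.
    by rewrite -(modn_dvdm b pv) -ab modn_dvdm.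
  by rewrite /dvdn => ->.
move=> ab abk; have [->//|neq] := eqVneq a b.
have ab0 : 0 < a - b by rewrite subn_gt0 ltn_neqAle eq_sym neq.
have bak : b ^ k <= a ^ k by rewrite leq_expn2r.
apply/eqP; rewrite eqn_mod_dvd // pfactor_dvdn //.
move/eqP: abk; rewrite eqn_mod_dvd // subn_exp.
set Psi := \sum_(_ < _) _.
have PsiE : Psi = k * b ^ k.-1 %[mod p ^ v.+1].
  have -> : k * b ^ k.-1 = \sum_(i < k) b ^ k.-1 by rewrite sum_nat_const card_ord.
  rewrite /Psi.
  elim/big_ind2: _ => // [x1 x2 y1 y2 e1 e2|i _].
    by rewrite -modnDm e1 e2 modnDm.
  have ik : i <= k.-1 by rewrite -ltnS prednK.
  have -> : b ^ k.-1 = b ^ (k.-1 - i) * b ^ i by rewrite -expnD subnK.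
  by rewrite -modnMml -modnXm ab modnXm modnMml.
have pPsi : ~~ (p ^ v.+1 %| Psi).
  rewrite /dvdn PsiE -/(dvdn _ _) Gauss_dvdl; last first.
    by rewrite coprimeXl // coprimeXr // prime_coprime.
  by rewrite pfactor_dvdn // ltnn.
have Psi0 : 0 < Psi by rewrite lt0n; apply: contraNneq pPsi => ->.
rewrite pfactor_dvdn ?muln_gt0 ?ab0 // lognM //.
move: pPsi; rewrite pfactor_dvdn // -leqNgt => Pv ePv.
by rewrite leq_subLR (leq_trans ePv) // [v + _]addnC leq_add2l.
Qed.

(** A root is determined by its residue modulo [p ^ v.+1] and its quotient by [p ^ (e - v)], where
    [v = logn p k]. The quotient takes at most [p ^ v <= k] values. The residue takes at most
    [p ^ v.+1 <= k ^ 2] values if [v > 0], and at most [k] values if [v = 0]. *)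
Lemma kth_roots_prime_power k p e r : prime p -> 0 < k -> 0 < e ->
  #|kth_roots k (p ^ e) r| <= k ^ 3.
Proof.
move=> p_pr k0 e0; set v := logn p k.
have pv0 n : 0 < p ^ n by rewrite expn_gt0 prime_gt0.
have pvk : p ^ v <= k by apply: dvdn_leq => //; exact: pfactor_dvdnn.
have quo_lt (t : 'I_(p ^ e)) : t %/ p ^ (e - v) < p ^ v.
  rewrite ltn_divLR // -expnD; apply: leq_trans (ltn_ord t) _.
  by rewrite leq_exp2l ?prime_gt1 //; lia.
pose f1 (t : 'I_(p ^ e)) : 'I_(p ^ v.+1) := Ordinal (ltn_pmod t (pv0 v.+1)).
pose f t := (f1 t, Ordinal (quo_lt t)).
have f_inj : {in kth_roots k (p ^ e) r &, injective f}.
  move=> a b; rewrite !inE => /andP[_ /eqP ar] /andP[cb /eqP br].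
  move=> [abm abq]; apply: val_inj => /=.
  rewrite (divn_eq a (p ^ (e - v))) (divn_eq b (p ^ (e - v))) abq; congr (_ + _).
  apply: kth_power_congr => //; last by rewrite ar br.
  by rewrite -prime_coprime // coprime_sym; rewrite coprime_pexpr in cb.
rewrite -(card_in_imset f_inj).
have sub : f @: kth_roots k (p ^ e) r \subset setX (f1 @: kth_roots k (p ^ e) r) [set: 'I_(p ^ v)].
  by apply/subsetP => _ /imsetP[t tR ->]; rewrite !inE /= imset_f.
apply: leq_trans (subset_leq_card sub) _; rewrite cardsX cardsT card_ord.
rewrite (expnD k 2 1) expn1 leq_mul //.
have [v0|v0] := posnP v; last first.
  apply: leq_trans (max_card _) _; rewrite card_ord.
  apply: (@leq_trans ((p ^ v) ^ 2)); last by rewrite leq_expn2r.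
  by rewrite -expnM leq_exp2l ?prime_gt1 //; lia.
apply: (@leq_trans k); last by rewrite -[X in X <= _]expn1 leq_pexp2l.
have dp d : d = p -> #|[set t : 'I_d | t ^ k == r %[mod p]]| <= k.
  by move=> ->; exact: kth_roots_prime.
apply: leq_trans (dp (p ^ v.+1) _); last by rewrite v0 expn1.
apply: subset_leq_card; apply/subsetP => y /imsetP[t /[!in_set]/andP[_ /eqP tr] {y}->].
have pdv : p %| p ^ v.+1 by rewrite v0 expn1.
have pde : p %| p ^ e by rewrite -(prednK e0) expnS dvdn_mulr.
rewrite /= -modnXm modn_dvdm // modnXm.
by rewrite -(modn_dvdm (t ^ k) pde) tr modn_dvdm.
Qed.

Lemma kth_roots_card_le k q r : 0 < k -> 0 < q ->
  #|kth_roots k q r| <= (k ^ 3) ^ size (primes q).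
Proof.
move=> k0; have [n] := ubnP q; elim: n q r => // n IHn q r qn q0.
have [q1|q1] := leqP q 1.
  have e : q = 1 by lia.
  by move: e => {q0 qn q1} ->; rewrite (leq_trans (max_card _)) ?card_ord.
set p := pdiv q; have p_pr : prime p by exact: pdiv_prime.
have pq : p \in primes q by rewrite mem_primes p_pr q0 pdiv_dvd.
set a := q`_p; set b := q`_p^'.
have qE : a * b = q by rewrite partnC.
have a_gt0 : 0 < a by exact: part_gt0.
have b_gt0 : 0 < b by exact: part_gt0.
have e_gt0 : 0 < logn p q by rewrite logn_gt0.
have aE : a = p ^ logn p q by rewrite /a p_part.
have cab : coprime a b by exact: coprime_partC.
have a_gt1 : 1 < a by rewrite aE -[1](exp1n (logn p q)) ltn_exp2r ?prime_gt1.
have sz : size (primes q) = (size (primes b)).+1.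
  rewrite primes_part.
  have -> : size (primes q) = count (pred1 p) (primes q) + count (predC (pred1 p)) (primes q).
    by rewrite count_predC.
  by rewrite (count_uniq_mem _ (primes_uniq q)) pq size_filter add1n; congr _.+1; apply: eq_count.
rewrite sz expnS.
pose f (t : 'I_q) := (Ordinal (ltn_pmod t a_gt0), Ordinal (ltn_pmod t b_gt0)).
have f_inj : injective f.
  move=> s t [sa sb]; apply: val_inj => /=.
  rewrite -(modn_small (ltn_ord s)) -(modn_small (ltn_ord t)).
  by apply/eqP; rewrite -{2 4}qE chinese_remainder // sa sb !eqxx.
rewrite -(card_imset _ f_inj).
apply: (@leq_trans #|setX (kth_roots k a r) (kth_roots k b r)|).
  apply/subset_leq_card/subsetP => y /imsetP[t /[!in_set]/andP[ct /eqP tr] {y}->].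
  have dq d : d %| q -> coprime (t %% d) d && ((t %% d) ^ k == r %[mod d]).
    move=> dq; rewrite coprime_modl (coprime_dvdr dq) //=.
    by rewrite modnXm -(modn_dvdm (t ^ k) dq) tr modn_dvdm.
  have aq : a %| q by rewrite -qE dvdn_mulr.
  have bq : b %| q by rewrite -qE dvdn_mull.
  rewrite ?in_setX ?in_set /=.
  by rewrite (dq a aq) (dq b bq).
rewrite cardsX; apply: leq_mul; last first.
  apply: IHn => //; rewrite -ltnS; apply: leq_trans qn; rewrite ltnS -qE.
  by rewrite -[X in X < _]mul1n ltn_pmul2r.
move: aE => {qE f f_inj cab a_gt0 a_gt1} -> .
exact: kth_roots_prime_power.
Qed.

(** Primes at least [B] pay for their own factor [B], and at most [B] primes lie below [B]. *)
Lemma primes_power_le B q : 0 < q -> B ^ size (primes q) <= B ^ B * q.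
Proof.
move=> q0; have [->|B0] := posnP B.
  by rewrite expn0 mul1n; case: (primes q) => [|? ?]; rewrite /= ?expn0 ?exp0n.
have le1 : \prod_(p <- primes q) p <= q.
  apply: dvdn_leq => //; apply: prod_primes_dvd; first exact: primes_uniq.
    by apply/allP => p; rewrite mem_primes => /andP[].
  by move=> p; rewrite mem_primes => /and3P[].
apply: (@leq_trans (\prod_(p <- primes q) ((if p < B then B else 1) * p))).
  rewrite -(count_predT (primes q)) -iter_muln_1 -big_const_seq !big_seq.
  apply: leq_prod => p; rewrite mem_primes => /andP[/prime_gt0 p0 _].
  by case: ltnP; nia.
rewrite big_split /=; apply: leq_mul => //.
rewrite -big_mkcond /= -big_filter big_const_seq iter_muln_1 count_predT leq_pexp2l //.
rewrite -{2}[B](size_iota 0); apply: uniq_leq_size.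
  by rewrite filter_uniq // primes_uniq.
by move=> p; rewrite mem_filter mem_iota add0n => /andP[].
Qed.

(** A divisor-type bound: the number of roots is [O(q ^ (1/h))] for each fixed [h], stated as an
    [h]-th power to stay in [nat]. *)
Lemma kth_roots_card k h q r : 0 < k -> 0 < q ->
  #|kth_roots k q r| ^ h <= (k ^ (3 * h)) ^ (k ^ (3 * h)) * q.
Proof.
move=> k0 q0; apply: leq_trans (primes_power_le _ q0).
apply: leq_trans (leq_expn2r h (kth_roots_card_le r k0 q0)) _.
by apply: eq_leq; rewrite -!expnM; congr (_ ^ _); ring.
Qed.

(** * Minors of vectors of prime powers *)

Definition pool (j : nat) : finType := seq_sub (big_primes j).

Definition pval j (x : pool j) : nat := ssval x.

Lemma pval_inj j : injective (@pval j). Proof. exact: val_inj. Qed.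

Lemma pval_in j (x : pool j) : [&& prime (pval x), 2 ^ (j - 3) < pval x & pval x <= 2 ^ j].
Proof. by rewrite -mem_big_primes; exact: (ssvalP x). Qed.

Lemma pval_prime j (x : pool j) : prime (pval x).
Proof. by have /and3P[] := pval_in x. Qed.

Lemma pval_gt j (x : pool j) : 2 ^ (j - 3) < pval x.
Proof. by have /and3P[] := pval_in x. Qed.

Lemma pval_le j (x : pool j) : pval x <= 2 ^ j.
Proof. by have /and3P[] := pval_in x. Qed.

Lemma card_pool j : #|pool j| = size (big_primes j).
Proof. by rewrite card_seq_sub // big_primes_uniq. Qed.

(** Chebyshev's bound with the logarithm sacrificed; it turns powers of [2 ^ j] into powers of the
    number of primes when the modulus is huge. *)
Lemma card_pool_ge j : 18 <= j -> 2 ^ j <= #|pool j| ^ 2.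
Proof.
move=> j18; have := chebyshev j18; rewrite -card_pool; set N := #|_| => jN.
have le : j ^ 2 <= 2 ^ (j - 6).
  rewrite -(subnK j18); move: (j - 18) => {j18 jN N j} h.
  rewrite (_ : h + 18 - 6 = h + 12); last by lia.
  elim: h => [//|h]; rewrite !addSn [2 ^ _.+1]expnS -!mulnn; move: (2 ^ _) => u; lia.
have j20 : 0 < j ^ 2 by rewrite expn_gt0; lia.
rewrite -(leq_pmul2l j20) -expnMn.
apply: leq_trans (leq_expn2r 2 jN).
apply: leq_trans (leq_mul le (leqnn _)) _.
by rewrite -expnD -expnM leq_exp2l //; lia.
Qed.

Lemma card_fiber_le (A B : finType) (w : A -> B) (S : {set A}) (c : B -> nat) :
  (forall b, #|[set a in S | w a == b]| <= c b) -> #|S| <= \sum_b c b.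
Proof.
move=> le; rewrite -sum1_card (partition_big w predT) //=.
apply: leq_sum => b _; apply: leq_trans (le b); rewrite -sum1_card.
by apply/eq_leq/eq_bigl => a; rewrite inE.
Qed.

Lemma card_pool_set j (S : {set pool j}) : #|S| = size [seq pval x | x <- enum S].
Proof. by rewrite size_map -cardE. Qed.

Lemma pool_progression_count j (S : {set pool j}) q c L c0 y :
    18 <= j -> 0 < c -> 0 < q -> q <= y ->
    {in S, forall x, exists2 i, i < L & pval x = c + q * i} ->
    L <= 2 ^ (j - 3) -> (forall i, i < L -> c + q * i <= 2 ^ j.+1) ->
    2 ^ j <= L * y -> L * y <= c0 * 2 ^ j ->
  #|S| ^ 2 * y <= (80 * c0 * #|pool j|) ^ 2.
Proof.
move=> j18 c_gt0 q_gt0 qy SL L1 L2 L3 L4; rewrite card_pool_set card_pool.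
apply: (primes_progression_count j18) L1 L2 L3 L4 => //.
- by rewrite map_inj_uniq ?enum_uniq //; apply: pval_inj.
- by apply/allP => p /mapP[x _ ->]; apply: pval_prime.
- by move=> p /mapP[x]; rewrite mem_enum => xS ->; split; [apply: pval_gt|apply: SL].
Qed.

Definition pool_class j q c : {set pool j} := [set x | pval x == c %[mod q]].

(** The saving is [q ^ (1/(4k))], uniformly up to moduli far beyond the primes themselves. Moduli
    below 16 are absorbed by the constant. If [q > 2 ^ j] the class has at most one prime, and
    [q ^ 2 <= 2 ^ (4 k j) <= N ^ (8 k)]. In between, the square-root saving is more than enough. *)
Lemma pool_class_card j k q c : 18 <= j -> 0 < k -> 0 < q -> q <= 2 ^ (2 * k * j) ->
  #|pool_class j q c| ^ (8 * k) * q ^ 2 <= (160 * #|pool j|) ^ (8 * k).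
Proof.
move=> j18 k0 q0 qj; set S := pool_class j q c; set N := #|pool j|.
have SN : #|S| <= N by exact: max_card.
have [q16|q16] := ltnP q 16.
  rewrite expnMn mulnC; apply: leq_mul; last by rewrite leq_expn2r.
  apply: (@leq_trans (16 ^ 2)); first by rewrite leq_expn2r // ltnW.
  by apply: (@leq_trans (160 ^ 2)) => //; rewrite leq_exp2l //; lia.
have jE : 2 ^ j = 8 * 2 ^ (j - 3) by rewrite -[8]/(2 ^ 3) -expnD; congr (_ ^ _); lia.
have X0 : 8 <= 2 ^ (j - 3) by rewrite -[8]/(2 ^ 3) leq_exp2l //; lia.
have [jq|qj'] := ltnP (2 ^ j) q.
  have S1 : #|S| <= 1.
    apply/card_le1P => x; rewrite inE => /eqP xc y; rewrite !inE.
    apply/eqP/eqP => [yc|->//]; apply: pval_inj.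
    have small (z : pool j) : pval z < q by apply: leq_ltn_trans jq; apply: pval_le.
    by rewrite -(modn_small (small x)) -(modn_small (small y)) xc yc.
  apply: (@leq_trans (1 * N ^ (8 * k))); last first.
    by rewrite mul1n leq_expn2r //; lia.
  apply: leq_mul; first by rewrite -[X in _ <= X](exp1n (8 * k)) leq_expn2r.
  apply: leq_trans (leq_expn2r 2 qj) _.
  apply: (@leq_trans ((N ^ 2) ^ (4 * k))); last by rewrite -expnM mulnA.
  apply: leq_trans (leq_expn2r _ (card_pool_ge j18)).
  by rewrite -!expnM leq_exp2l //; nia.
(* The progression must start at a positive term, so the class 0 is represented by [q]. *)
pose c1 := if c %% q == 0 then q else c %% q.
have c1P : 0 < c1 <= q.
  rewrite /c1; case: eqP => [_|/eqP]; first by rewrite q0 leqnn.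
  by rewrite -lt0n => ->; rewrite ltnW // ltn_pmod.
have le : #|S| ^ 2 * q <= (80 * 2 * N) ^ 2.
  apply: (@pool_progression_count j S q c1 (2 ^ j %/ q).+1) => //.
  - by case/andP: c1P.
  - move=> x; rewrite inE => /eqP xc.
    have xj := pval_le x; have x0 := prime_gt0 (pval_prime x).
    have xE := divn_eq (pval x) q; rewrite xc in xE.
    rewrite /c1; case: eqP xE => [-> |/eqP c0] xE; last first.
      exists (pval x %/ q); last by lia.
      by rewrite ltnS leq_div2r.
    exists (pval x %/ q).-1; first by rewrite ltnS (leq_trans (leq_pred _)) // leq_div2r.
    by move: x0 xE; case: (pval x %/ q) => [|a] /=; [lia|nia].
  - have : 2 ^ j %/ q <= 2 ^ j %/ 16 by rewrite leq_div2l.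
    by move: jE X0; move: (2 ^ j) (2 ^ (j - 3)) => u v; lia.
  - move=> i; rewrite ltnS leq_divRL // expnS; case/andP: c1P => _.
    by move: (2 ^ j) qj' => u; nia.
  - by apply: ltnW; rewrite -ltn_divLR.
  - rewrite mulSn; have := leq_trunc_div (2 ^ j) q; move: qj'.
    by move: (2 ^ j) (2 ^ j %/ q * q) => u v; lia.
apply: (@leq_trans ((#|S| ^ 2 * q) ^ (4 * k))).
  rewrite expnMn -expnM (_ : 2 * (4 * k) = 8 * k); last by lia.
  by rewrite leq_mul // leq_pexp2l //; lia.
apply: leq_trans (leq_expn2r _ le) _.
by rewrite -expnM (_ : 2 * (4 * k) = 8 * k) //; lia.
Qed.

(** The three ranges are as for residue classes, now with a progression of difference 1 in a short
    interval. The surplus [2 ^ (6 * k)] allows for primes that are only known to exceed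
    [2 ^ (j - 3)] when [k]-th powers are compared with their bases. *)
Lemma pool_interval_card j k y (S : {set pool j}) : 18 <= j -> 0 < k -> 0 < y ->
    y <= 2 ^ (2 * k * j) ->
    {in S &, forall x1 x2, pval x1 <= pval x2 ->
      (pval x2 - pval x1) * y <= 2 ^ (j + 6 * k - 2)} ->
  #|S| ^ (8 * k) * y <= (80 * 2 ^ (6 * k) * #|pool j|) ^ (8 * k).
Proof.
move=> j18 k0 y0 yj Sy; set N := #|pool j|.
have [->|[x0 x0S]] := set_0Vmem S.
  by rewrite cards0 exp0n ?muln_gt0 ?k0.
have SN : #|S| <= N by exact: max_card.
have N0 : 0 < N by apply/card_gt0P; exists x0.
have [y16|y16] := ltnP y (2 ^ (6 * k + 2)).
  rewrite mulnC [80 * _]mulnC -mulnA expnMn; apply: leq_mul; last first.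
    by rewrite leq_expn2r //; lia.
  apply: leq_trans (ltnW y16) _; rewrite -expnM leq_exp2l //; nia.
have jE : 2 ^ j = 8 * 2 ^ (j - 3) by rewrite -[8]/(2 ^ 3) -expnD; congr (_ ^ _); lia.
pose x1 := [arg min_(x < x0 in S) pval x].
have [x1S x1min] : x1 \in S /\ forall x, x \in S -> pval x1 <= pval x.
  by rewrite /x1; case: arg_minnP.
set E := 2 ^ (j + 6 * k - 2).
pose L := (E %/ y).+1.
have SL : {in S, forall x, exists2 i, i < L & pval x = pval x1 + 1 * i}.
  move=> x xS; exists (pval x - pval x1); last by rewrite mul1n subnKC ?x1min.
  by rewrite ltnS leq_divRL // Sy // x1min.
have EL : E %/ y <= 2 ^ (j - 4).
  rewrite (_ : E = 2 ^ (j - 4) * 2 ^ (6 * k + 2)); last by rewrite -expnD; congr (_ ^ _); lia.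
  have p0 : 0 < 2 ^ (6 * k + 2) by rewrite expn_gt0.
  by apply: leq_trans (leq_div2l _ p0 y16) _; rewrite mulnK.
have j4E : 2 ^ (j - 3) = 2 * 2 ^ (j - 4) by rewrite -expnS; congr (_ ^ _); lia.
have j40 : 0 < 2 ^ (j - 4) by rewrite expn_gt0.
have [jy|yj'] := ltnP (2 ^ j) y.
  have EL2 : L <= 2 ^ (6 * k).
    rewrite /L ltn_divLR //; apply: (@leq_ltn_trans (2 ^ (6 * k) * 2 ^ j)).
      by rewrite -expnD leq_exp2l //; lia.
    by rewrite ltn_pmul2l ?expn_gt0.
  have SL2 : #|S| <= L.
    rewrite card_pool_set -[X in _ <= X](size_iota 0 L) -[X in _ <= X](size_map (fun i => pval x1 + i)).
    apply: uniq_leq_size; first by rewrite map_inj_uniq ?enum_uniq //; apply: pval_inj.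
    move=> p /mapP[x]; rewrite mem_enum => /SL[i iL ->] ->.
    by rewrite mul1n; apply/mapP; exists i => //; rewrite mem_iota.
  rewrite -mulnA [80 * _]mulnC -mulnA expnMn; apply: leq_mul.
    by rewrite leq_expn2r // (leq_trans SL2).
  apply: leq_trans yj _; apply: (@leq_trans ((N ^ 2) ^ (2 * k))).
    apply: leq_trans (leq_expn2r _ (card_pool_ge j18)).
    by rewrite -!expnM leq_exp2l //; nia.
  rewrite -expnM; apply: (@leq_trans (N ^ (8 * k))); last by rewrite leq_expn2r //; lia.
  by rewrite leq_pexp2l //; lia.
have le : #|S| ^ 2 * y <= (80 * 2 ^ (6 * k) * N) ^ 2.
  apply: (@pool_progression_count j S 1 (pval x1) L) => //.
  - exact: prime_gt0 (pval_prime x1).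
  - by rewrite /L j4E; move: EL j40; move: (E %/ y) (2 ^ (j - 4)) => u v; lia.
  - move=> i; rewrite /L expnS jE j4E; move: (pval_le x1); rewrite jE j4E.
    by move: EL; move: (E %/ y) (2 ^ (j - 4)) => u v; lia.
  - apply: ltnW; rewrite -ltn_divLR // ltnS leq_div2r // /E leq_exp2l //; lia.
  - rewrite /L mulSn; apply: (@leq_trans (2 ^ j + E)).
      by rewrite leq_add // leq_trunc_div.
    have -> : E = 2 ^ (6 * k - 2) * 2 ^ j by rewrite -expnD; congr (_ ^ _); lia.
    have -> : 2 ^ (6 * k) = 4 * 2 ^ (6 * k - 2) by rewrite -[4]/(2 ^ 2) -expnD; congr (_ ^ _); lia.
    have : 0 < 2 ^ (6 * k - 2) by rewrite expn_gt0.
    by move: (2 ^ j) (2 ^ _) => u v; nia.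
apply: (@leq_trans ((#|S| ^ 2 * y) ^ (4 * k))).
  rewrite expnMn -expnM (_ : 2 * (4 * k) = 8 * k); last by lia.
  by rewrite leq_mul // -[X in X <= _]expn1 leq_pexp2l // muln_gt0 k0.
apply: leq_trans (leq_expn2r _ le) _.
by rewrite -expnM (_ : 2 * (4 * k) = 8 * k) //; lia.
Qed.

(** * Average divisibility and average size of one minor *)

Definition kdet k j (x y : pool j * pool j) : int :=
  (((pval x.1 * pval y.2) ^ k)%N%:Z - ((pval x.2 * pval y.1) ^ k)%N%:Z)%R.

Definition quad j : finType := ((pool j * pool j) * (pool j * pool j))%type.

Definition quad_key j (z : quad j) := (z.1.1, (z.2.1, z.2.2)).

Lemma card_quad_fiber j (S : {set quad j}) b :
  #|[set z in S | quad_key z == b]| =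
  #|[set x | ((b.1, x), (b.2.1, b.2.2)) \in S]|.
Proof.
rewrite -(card_imset _ (f := fun x => ((b.1, x), (b.2.1, b.2.2)) : quad j)); last first.
  by move=> x1 x2 [].
apply: eq_card => z; rewrite !inE; apply/andP/imsetP => [[zS /eqP zb]|[x]].
  exists z.1.2; rewrite -zb /= -!surjective_pairing ?inE //.
  by case: z zS {zb} => [[? ?] [? ?]].
by rewrite inE => xS ->; split => //=; apply/eqP; rewrite /quad_key /= -!surjective_pairing.
Qed.

Lemma eqmod_mulr_cancel q a b c : coprime q c ->
  a * c = b * c %[mod q] -> a = b %[mod q].
Proof.
move=> cqc; wlog ba : a b / b <= a.
  move=> W e; have [ba|/ltnW ba] := leqP b a; first exact: W.
  by apply/esym/W => //; rewrite e.
move=> /eqP; rewrite eqn_mod_dvd ?leq_mul // -mulnBl Gauss_dvdl // => dv.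
by apply/eqP; rewrite eqn_mod_dvd.
Qed.

(** With three primes fixed, the fourth one has a prescribed [k]-th power modulo [q], hence lies in
    at most [K] classes. Dividing modulo [q] is legitimate because a prime that divides [q] and one
    of the two products is a factor of the other product. For the fourth prime this leaves two
    exceptional values; for [b.2.1] it is excluded by the two inequalities. *)
Lemma kdet_dvd_fiber k j q (b : pool j * (pool j * pool j)) K s : 0 < k -> 0 < q ->
    b.2.1 != b.1 -> b.2.1 != b.2.2 ->
    (forall r, #|kth_roots k q r| <= K) -> (forall c, #|pool_class j q c| <= s) ->
  #|[set x | q %| `|kdet k (b.1, x) (b.2.1, b.2.2)|]| <= 2 + K * s.
Proof.
case: b => x1 [y1 y2] /= k0 q0 yx yy hK hs.
set S := [set x | _].
have dE x : (q %| `|kdet k (x1, x) (y1, y2)|) =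
    ((pval x1 * pval y2) ^ k == (pval x * pval y1) ^ k %[mod q]).
  rewrite /kdet /=; set a := (_ ^ k); set b := (_ ^ k).
  have [ab|/ltnW ab] := leqP a b; last by rewrite eqn_mod_dvd // distnEl.
  by rewrite eq_sym eqn_mod_dvd // distnEr.
have two : #|[set x1; y2]| <= 2 by rewrite cards2; case: eqP.
have pdiv_pow (a b c d : pool j) : pval a %| q ->
    (pval a * pval b) ^ k = (pval c * pval d) ^ k %[mod q] -> (a == c) || (a == d).
  move=> aq e; have : pval a %| (pval c * pval d) ^ k.
    rewrite /dvdn -(modn_dvdm _ aq) -e modn_dvdm // -/(dvdn _ _).
    by rewrite Euclid_dvdX ?pval_prime // dvdn_mulr.
  rewrite Euclid_dvdX ?pval_prime // Euclid_dvdM ?pval_prime // k0 andbT.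
  by rewrite !dvdn_prime2 ?pval_prime // !(inj_eq (@pval_inj j)).
have [S0|[x0]] := set_0Vmem (S :\: [set x1; y2]).
  apply: (@leq_trans 2); last exact: leq_addr.
  by apply: leq_trans two; apply: subset_leq_card; rewrite -setD_eq0 S0.
rewrite !inE dE => /andP[_ /eqP x0E].
have cop (x : pool j) : x \notin [set x1; y2] ->
    (pval x1 * pval y2) ^ k = (pval x * pval y1) ^ k %[mod q] -> coprime (pval x) q.
  move=> xN e; rewrite prime_coprime ?pval_prime //; apply: contra xN => xq.
  by rewrite !inE; apply: (pdiv_pow _ y1) => //; rewrite e.
have cy1 : coprime (pval y1) q.
  rewrite prime_coprime ?pval_prime //; apply/negP => yq.
  have := pdiv_pow y1 x0 x1 y2 yq; rewrite mulnC -x0E => /(_ erefl).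
  by rewrite (negbTE yx) (negbTE yy).
have sub : S \subset [set x1; y2] :|:
    \bigcup_(t in kth_roots k q (pval x0 ^ k)) pool_class j q t.
  apply/subsetP => x; rewrite inE dE => /eqP xE; rewrite in_setU.
  have [//|xN] := boolP (x \in [set x1; y2]); rewrite orFb.
  apply/bigcupP; exists (Ordinal (ltn_pmod (pval x) q0)); last first.
    by rewrite inE /= modn_mod.
  rewrite inE /= coprime_modl (cop x xN xE) /= modnXm.
  have : pval x ^ k * pval y1 ^ k == pval x0 ^ k * pval y1 ^ k %[mod q].
    by rewrite -!expnMn -xE x0E.
  by move=> /eqP/(eqmod_mulr_cancel _) -> //; rewrite coprimeXr // coprime_sym.
apply: leq_trans (subset_leq_card sub) _; apply: leq_trans (leq_card_setU _ _) _.
apply: leq_add => //; apply: leq_trans (_ : #|kth_roots k q (pval x0 ^ k)| * s <= _).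
  rewrite -sum_nat_const.
  apply: (@leq_trans (\sum_(t in kth_roots k q (pval x0 ^ k)) #|pool_class j q t|)); last first.
    by apply: leq_sum => t _; exact: hs.
  elim/big_rec2: _ => [|t a B _ le]; first by rewrite cards0.
  apply: leq_trans (leq_card_setU _ _) _.
  exact: leq_add.
by rewrite leq_mul2r hK orbT.
Qed.

Lemma sum_bool_card (T : finType) (P : pred T) : \sum_b P b = #|[set b | P b]|.
Proof.
rewrite -sum1_card [RHS]big_mkcond /=.
by apply: eq_bigr => b _; rewrite inE; case: (P b).
Qed.

Lemma card_sub_inj (A B : finType) (f : A -> B) (P : pred A) :
  {in P &, injective f} -> #|[set a | P a]| <= #|B|.
Proof.
move=> f_inj; rewrite -(card_in_imset (f := f)) ?max_card //.
by move=> a b; rewrite !inE; exact: f_inj.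
Qed.

Lemma exists_max_bound (I : finType) (F : I -> nat) :
  exists2 s, forall i, F i <= s & (s = 0) \/ exists i, s = F i.
Proof.
exists (\max_i F i); first by move=> i; exact: leq_bigmax.
have [/eqP I0|I0] := eqVneq #|I| 0.
  by left; rewrite big1 // => i _; move: I0; rewrite (cardD1 i).
rewrite -lt0n in I0; right; have [i ->] := eq_bigmax F I0; by exists i.
Qed.

(** Each coincidence of [b.2.1] with another fixed prime leaves [N ^ 2] triples, with at most [N]
    choices of the fourth prime: whence the summand [2 N ^ 3]. *)
Lemma card_quad_le j (S : {set quad j}) s :
  (forall b, b.2.1 != b.1 -> b.2.1 != b.2.2 ->
     #|[set x | ((b.1, x), (b.2.1, b.2.2)) \in S]| <= s) ->
  #|S| <= #|pool j| ^ 3 * (2 + s).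
Proof.
set N := #|pool j| => hs.
pose c (b : pool j * (pool j * pool j)) := s + ((b.2.1 == b.1) * N + (b.2.1 == b.2.2) * N).
apply: leq_trans (card_fiber_le (w := @quad_key j) (c := c) _) _.
  move=> b; rewrite card_quad_fiber /c.
  have leN : #|[set x | (b.1, x, (b.2.1, b.2.2)) \in S]| <= N by exact: max_card.
  have [_|n1] := eqVneq b.2.1 b.1.
    by rewrite mul1n addnCA (leq_trans leN) ?leq_addr.
  have [_|n2] := eqVneq b.2.1 b.2.2; first by rewrite mul1n (leq_trans leN) // mul0n add0n leq_addl.
  by rewrite (leq_trans (hs b n1 n2)) // leq_addr.
rewrite /c big_split sum_nat_const big_split /= !card_prod -/N addnC mulnDr.
have h1 : \sum_(b : pool j * (pool j * pool j)) (b.2.1 == b.1) <= N ^ 2.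
  rewrite sum_bool_card -mulnn -card_prod; apply: (card_sub_inj (f := fun b => (b.1, b.2.2))).
  by move=> [x1 [y1 y2]] [x1' [y1' y2']]; rewrite !unfold_in /= => /eqP -> /eqP -> [-> ->].
have h2 : \sum_(b : pool j * (pool j * pool j)) (b.2.1 == b.2.2) <= N ^ 2.
  rewrite sum_bool_card -mulnn -card_prod; apply: (card_sub_inj (f := fun b => (b.1, b.2.2))).
  by move=> [x1 [y1 y2]] [x1' [y1' y2']]; rewrite !unfold_in /= => /eqP -> /eqP -> [-> ->].
rewrite -!big_distrl /=; apply: leq_add; last by rewrite !expnS expn0 muln1 mulnA.
rewrite -mulnDl [N ^ 3]expnSr mulnAC leq_mul // muln2 -addnn.
exact: leq_add.
Qed.

(** The number of roots is [O(q ^ (1/(8k)))] and a class has [O(N q ^ (-1/(4k)))] primes, so the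
    product still saves [q ^ (1/(8k))]. The degenerate quadruples save a whole factor [N], which
    suffices since [q <= N ^ (8 * k)]. *)
Lemma card_kdet_dvd k : 0 < k -> exists C, forall j q, 18 <= j -> 0 < q -> q <= 2 ^ (2 * k * j) ->
  #|[set z : quad j | q %| `|kdet k z.1 z.2|]| ^ (8 * k) * q <= (C * #|pool j| ^ 4) ^ (8 * k).
Proof.
move=> k0; set C0 := (k ^ (3 * (8 * k))) ^ (k ^ (3 * (8 * k))).
exists (320 * (1 + C0)) => j q j18 q0 qj; set N := #|pool j|.
have e0 : 0 < 8 * k by rewrite muln_gt0 k0.
have [K hK K_ex] := exists_max_bound (fun r : 'I_q => #|kth_roots k q r|).
have [s hs s_ex] := exists_max_bound (fun c : 'I_q => #|pool_class j q c|).
have hK' r : #|kth_roots k q r| <= K.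
  apply: leq_trans (hK (Ordinal (ltn_pmod r q0))); apply/eq_leq/eq_card => t.
  by rewrite !inE /= modn_mod.
have hs' c : #|pool_class j q c| <= s.
  apply: leq_trans (hs (Ordinal (ltn_pmod c q0))); apply/eq_leq/eq_card => t.
  by rewrite !inE /= modn_mod.
have K8 : K ^ (8 * k) <= C0 * q.
  case: K_ex => [->|[r ->]]; first by rewrite exp0n.
  exact: kth_roots_card.
have s8 : s ^ (8 * k) * q ^ 2 <= (160 * N) ^ (8 * k).
  case: s_ex => [->|[c ->]]; first by rewrite exp0n.
  exact: pool_class_card.
have q8 : q <= N ^ (8 * k).
  apply: leq_trans qj _; apply: (@leq_trans ((N ^ 2) ^ (2 * k))).
    by apply: leq_trans (leq_expn2r _ (card_pool_ge j18)); rewrite -expnM mulnC.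
  rewrite -expnM; have [->|N0] := posnP N; last by rewrite leq_pexp2l //; lia.
  by rewrite !exp0n // muln_gt0 muln_gt0 k0.
have le : #|[set z : quad j | q %| `|kdet k z.1 z.2|]| <= N ^ 3 * (4 + K * s).
  apply: leq_trans (card_quad_le (s := 2 + K * s) _) _; last by rewrite addnA.
  move=> b n1 n2; apply: leq_trans (kdet_dvd_fiber k0 q0 n1 n2 hK' hs').
  by apply: subset_leq_card; apply/subsetP => x; rewrite !inE.
apply: leq_trans (leq_mul (leq_expn2r _ le) (leqnn q)) _.
have le2 : (4 + K * s) ^ (8 * k) * q <= (8 * N) ^ (8 * k) + C0 * (320 * N) ^ (8 * k).
  apply: (@leq_trans ((8 ^ (8 * k) + (2 * (K * s)) ^ (8 * k)) * q)).
    rewrite leq_mul //; have [u|u] := leqP 4 (K * s).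
      by apply: leq_trans (leq_addl _ _); rewrite leq_expn2r //; lia.
    by apply: leq_trans (leq_addr _ _); rewrite leq_expn2r //; lia.
  rewrite mulnDl; apply: leq_add; first by rewrite expnMn leq_mul.
  rewrite !expnMn; apply: (@leq_trans (2 ^ (8 * k) * (C0 * (s ^ (8 * k) * q ^ 2)))).
    rewrite -mulnA leq_mul // [q ^ 2]expnS expn1.
    rewrite [s ^ _ * _]mulnCA mulnA -mulnA leq_mul //.
  rewrite mulnCA leq_mul // -expnMn -[320]/(2 * 160) -[2 * 160 * N]mulnA [X in _ <= X]expnMn.
  by rewrite leq_mul.
rewrite expnMn -mulnA; apply: leq_trans (leq_mul (leqnn _) le2) _.
have -> : (320 * (1 + C0) * N ^ 4) ^ (8 * k) = (N ^ 3) ^ (8 * k) * ((1 + C0) * (320 * N)) ^ (8 * k).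
  by rewrite -expnMn; congr (_ ^ _); ring.
rewrite leq_mul // [X in _ <= X]expnMn.
apply: (@leq_trans ((1 + C0) * (320 * N) ^ (8 * k))).
  by rewrite mulnDl mul1n leq_add // leq_expn2r // leq_mul.
by rewrite leq_mul // -[X in X <= _]expn1 leq_pexp2l.
Qed.

Lemma leq_expB_dist a b B k : B <= a -> B <= b -> 0 < k ->
  `|(a%:Z - b%:Z)%R| * B ^ k.-1 <= `|((a ^ k)%N%:Z - (b ^ k)%N%:Z)%R|.
Proof.
wlog ba : a b / b <= a.
  move=> W Ba Bb k0; have [ba|/ltnW ab] := leqP b a; first exact: W.
  by rewrite distnC [X in _ <= X]distnC W.
move=> Ba Bb; case: k => // k _.
rewrite !distnEl ?leq_expn2r // subn_exp leq_mul //= big_ord_recl /= subn0 expn0 muln1.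
by apply: leq_trans (leq_addr _ _); rewrite leq_expn2r.
Qed.

(** With three primes fixed, a small minor confines the fourth to a short interval: by the mean
    value inequality a small difference of [k]-th powers forces a small difference of the bases,
    which are products of two primes larger than [2 ^ (j - 3)]. *)
Lemma card_kdet_small k : 0 < k -> exists C, forall j y, 18 <= j -> 0 < y -> y <= 2 ^ (2 * k * j) ->
  #|[set z : quad j | `|kdet k z.1 z.2| * y <= 2 ^ (2 * k * j)]| ^ (8 * k) * y <=
    (C * #|pool j| ^ 4) ^ (8 * k).
Proof.
move=> k0; exists (80 * 2 ^ (6 * k)) => j y j18 y0 yj; set N := #|pool j|.
pose S (b : pool j * (pool j * pool j)) :=
  [set x | `|kdet k (b.1, x) (b.2.1, b.2.2)| * y <= 2 ^ (2 * k * j)].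
have [s hs s_ex] := exists_max_bound (fun b => #|S b|).
have le : #|[set z : quad j | `|kdet k z.1 z.2| * y <= 2 ^ (2 * k * j)]| <= N ^ 3 * s.
  apply: leq_trans (card_fiber_le (w := @quad_key j) (c := fun => s) _) _; last first.
    by rewrite sum_nat_const !card_prod !expnS expn0 muln1.
  move=> b; rewrite card_quad_fiber; apply: leq_trans (hs b).
  by apply: subset_leq_card; apply/subsetP => x; rewrite !inE.
apply: leq_trans (leq_mul (leq_expn2r _ le) (leqnn y)) _.
rewrite expnMn -mulnA.
have -> : (80 * 2 ^ (6 * k) * N ^ 4) ^ (8 * k) = (N ^ 3) ^ (8 * k) * (80 * 2 ^ (6 * k) * N) ^ (8 * k).
  by rewrite -expnMn; congr (_ ^ _); ring.
rewrite leq_mul //; case: s_ex => [->|[[x1 [y1 y2]] ->]].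
  by rewrite exp0n // muln_gt0 k0.
apply: pool_interval_card => //.
have key x : x \in S (x1, (y1, y2)) ->
    `|((pval x1 * pval y2)%N%:Z - (pval x * pval y1)%N%:Z)%R| * y <= 2 ^ (2 * j + 6 * (k - 1)).
  rewrite inE /kdet /= => hx; set B := 2 ^ (2 * (j - 3)).
  have Bk : 0 < B ^ k.-1 by rewrite !expn_gt0.
  have hB (a b : pool j) : B <= pval a * pval b.
    have := leq_mul (ltnW (pval_gt a)) (ltnW (pval_gt b)).
    by rewrite -expnD addnn -mul2n.
  rewrite -(leq_pmul2r Bk) mulnAC; apply: (@leq_trans (2 ^ (2 * k * j))).
    apply: leq_trans hx; rewrite leq_mul //; exact: leq_expB_dist.
  rewrite /B -expnM -expnD leq_exp2l //; clear -j18 k0.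
  by case: k k0 => // k _; rewrite subn1 /=; nia.
move=> a b /key ka /key kb ab.
rewrite -(leq_pmul2r (prime_gt0 (pval_prime y1))).
apply: (@leq_trans (2 ^ (2 * j + 6 * (k - 1)) + 2 ^ (2 * j + 6 * (k - 1)))); last first.
  apply: (@leq_trans (2 ^ (j + 6 * k - 2) * 2 ^ (j - 3))).
    by rewrite addnn -mul2n -expnS -expnD leq_exp2l //; lia.
  by rewrite leq_mul // ltnW // pval_gt.
move: ka kb; move: (2 ^ _) => E ka kb; apply: leq_trans (leq_add ka kb).
rewrite -mulnDl mulnAC leq_mul2r; apply/orP; right.
by move: ab; move: (pval x1 * pval y2) => u; nia.
Qed.

Import Order.TTheory GRing.Theory Num.Theory.
Local Open Scope ring_scope.

(** * Counting vectors hitting a net *)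

Definition pair_dot (m : nat) (e u : 'I_m -> int * int) : int :=
  \sum_(i < m) ((e i).1 * (u i).1 + (e i).2 * (u i).2).

Lemma pair_dotD m (e f u : 'I_m -> int * int) :
  pair_dot (fun i => e i + f i) u = pair_dot e u + pair_dot f u.
Proof.
by rewrite /pair_dot -big_split /=; apply: eq_bigr => i _; rewrite /= !mulrDl addrACA.
Qed.

Definition det2 (u v : int * int) : int := u.1 * v.2 - u.2 * v.1.

Definition reach m (u v : 'I_m -> int * int) (a b : int) :=
  exists e, pair_dot e u = a /\ pair_dot e v = b.

(** Cramer's rule on the pair [i], with zeros on the other pairs. *)
Lemma reach_det m (u v : 'I_m -> int * int) i a b :
  reach u v (det2 (u i) (v i) * a) (det2 (u i) (v i) * b).
Proof.
exists (fun l => if l == i then (a * (v i).2 - b * (u i).2, b * (u i).1 - a * (v i).1) else 0).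
split; rewrite /pair_dot (bigD1 i) //= eqxx big1 ?addr0 /det2 //=.
all: try by move=> l /negbTE ->; rewrite !mul0r addr0.
all: ring.
Qed.

(** A Bezout relation between the minors combines the vectors given by Cramer's rule. *)
Lemma reach_gcd m (u v : 'I_m -> int * int) (r : seq 'I_m) a b :
  let g := (\big[gcdn/0%N]_(i <- r) `|det2 (u i) (v i)|%N)%:Z in
  reach u v (g * a) (g * b).
Proof.
elim: r a b => [|i r IHr] a b /=.
  rewrite big_nil !mul0r; exists (fun=> 0).
  by split; rewrite /pair_dot big1 // => i _; rewrite !mul0r addr0.
rewrite big_cons; set G := \big[gcdn/0%N]_(j <- r) _ in IHr *; set D := det2 _ _.
have [c [d cd]] := Bezoutz D G%:Z.
have -> : (gcdn `|D|%N G)%:Z = c * D + d * G%:Z by rewrite cd.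
have [e1 [e1u e1v]] := reach_det u v i (c * a) (c * b).
have [e2 [e2u e2v]] := IHr (d * a) (d * b).
exists (fun i => e1 i + e2 i); rewrite !pair_dotD e1u e1v e2u e2v -/D.
by split; ring.
Qed.

Lemma normr_det2_le (U T x y p q : int) :
  0 <= p <= U -> 0 <= q <= U -> `|x| <= T -> `|y| <= T -> `|x * q - y * p| <= 2 * U * T.
Proof.
move=> /andP[p0 pU] /andP[q0 qU] xT yT; apply: le_trans (ler_normB _ _) _.
rewrite !normrM (ger0_norm p0) (ger0_norm q0).
have := ler_pM (normr_ge0 x) q0 xT qU; have := ler_pM (normr_ge0 y) p0 yT pU; lia.
Qed.

(* Any integer solution can be reduced modulo the determinant [D] in all pairs
   but one, because [D] times any vector is reached from the pair [i0] alone. *)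
Lemma reach_small m (u v : 'I_m -> int * int) (U H : int) i0 a b :
    (forall i, [/\ 0 <= (u i).1 <= U, 0 <= (u i).2 <= U,
                   0 <= (v i).1 <= U & 0 <= (v i).2 <= U]) ->
    let D := det2 (u i0) (v i0) in
    D != 0 -> reach u v a b -> `|a| <= H -> `|b| <= H ->
  exists e, [/\ pair_dot e u = a, pair_dot e v = b,
    forall i, i != i0 -> `|(e i).1| <= `|D| /\ `|(e i).2| <= `|D|
    & `|D| * `|(e i0).1| <= 2 * U * (H + 2 * m%:Z * U * `|D|) /\
      `|D| * `|(e i0).2| <= 2 * U * (H + 2 * m%:Z * U * `|D|)].
Proof.
move=> uvU D D0 [f [fu fv]] aH bH.
pose r i : int * int := (((f i).1 %% D)%Z, ((f i).2 %% D)%Z).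
pose q i : int * int := (((f i).1 %/ D)%Z, ((f i).2 %/ D)%Z).
pose w (z : 'I_m -> int * int) := \sum_(i < m | i != i0) ((q i).1 * (z i).1 + (q i).2 * (z i).2).
(* Removing multiples of [D] from the other pairs changes the two products by [D w(u)] and [D w(v)];
   Cramer's rule restores both on the pair [i0]. *)
pose e i := if i == i0 then
   ((f i0).1 + (w u * (v i0).2 - w v * (u i0).2), (f i0).2 + (w v * (u i0).1 - w u * (v i0).1))
   else r i.
have eE (z : 'I_m -> int * int) : pair_dot f z - D * w z = (f i0).1 * (z i0).1 + (f i0).2 * (z i0).2 +
    \sum_(i < m | i != i0) ((r i).1 * (z i).1 + (r i).2 * (z i).2).
  rewrite /pair_dot (bigD1 i0) //= -addrA /w mulr_sumr -sumrB; congr (_ + _).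
  apply: eq_bigr => i _ /=.
  by rewrite {1}(divz_eq (f i).1 D) {1}(divz_eq (f i).2 D); ring.
have eS (z : 'I_m -> int * int) : pair_dot e z = (e i0).1 * (z i0).1 + (e i0).2 * (z i0).2 +
    \sum_(i < m | i != i0) ((r i).1 * (z i).1 + (r i).2 * (z i).2).
  rewrite /pair_dot (bigD1 i0) //=; congr (_ + _).
  by apply: eq_bigr => i /negbTE ii; rewrite /e ii.
have eu : pair_dot e u = a.
  rewrite eS -fu; have := eE u; rewrite /e eqxx /= /D /det2 => h.
  by apply: (@addIr _ (- (D * w u))); rewrite /D /det2 h; ring.
have ev : pair_dot e v = b.
  rewrite eS -fv; have := eE v; rewrite /e eqxx /= /D /det2 => h.
  by apply: (@addIr _ (- (D * w v))); rewrite /D /det2 h; ring.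
have rD i : 0 <= (r i).1 <= `|D| /\ 0 <= (r i).2 <= `|D|.
  by rewrite /r /= !modz_ge0 // !ltW // ltz_mod.
exists e; split => // [i /negbTE ii|].
  rewrite /e ii; have [/andP[r1 r1D] /andP[r2 r2D]] := rD i.
  by split; [rewrite (ger0_norm r1)|rewrite (ger0_norm r2)].
pose s (z : 'I_m -> int * int) := \sum_(i < m | i != i0) ((r i).1 * (z i).1 + (r i).2 * (z i).2).
have U0 : 0 <= U by have [/andP[h1 h2] _ _ _] := uvU i0; apply: le_trans h2.
have sB (z : 'I_m -> int * int) : (forall i, 0 <= (z i).1 <= U /\ 0 <= (z i).2 <= U) ->
    `|s z| <= 2 * m%:Z * U * `|D|.
  move=> zU; apply: le_trans (ler_norm_sum _ _ _) _.
  apply: (@le_trans _ _ (\sum_(i < m | i != i0) (2 * U * `|D|))).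
    apply: ler_sum => i _; apply: le_trans (ler_normD _ _) _.
    have [/andP[r1 r1D] /andP[r2 r2D]] := rD i; have [/andP[z1 z1U] /andP[z2 z2U]] := zU i.
    rewrite !normrM (ger0_norm r1) (ger0_norm r2) (ger0_norm z1) (ger0_norm z2).
    have := ler_pM r1 z1 r1D z1U; have := ler_pM r2 z2 r2D z2U; lia.
  rewrite sumr_const -[X in X <= _]mulr_natl (_ : 2 * m%:Z * U * `|D| = m%:Z * (2 * U * `|D|)); last by ring.
  apply: ler_wpM2r; first by rewrite !mulr_ge0.
  by rewrite natz lez_nat (leq_trans (max_card _)) // card_ord.
have su : `|s u| <= 2 * m%:Z * U * `|D| by apply: sB => i; have [] := uvU i.
have sv : `|s v| <= 2 * m%:Z * U * `|D| by apply: sB => i; have [] := uvU i.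
have au : (e i0).1 * (u i0).1 + (e i0).2 * (u i0).2 = a - s u by rewrite -eu eS addrK.
have bv : (e i0).1 * (v i0).1 + (e i0).2 * (v i0).2 = b - s v by rewrite -ev eS addrK.
have tau : `|a - s u| <= H + 2 * m%:Z * U * `|D|.
  by apply: le_trans (ler_normB _ _) _; apply: lerD.
have tbv : `|b - s v| <= H + 2 * m%:Z * U * `|D|.
  by apply: le_trans (ler_normB _ _) _; apply: lerD.
have [u1 u2 v1 v2] := uvU i0.
rewrite -!normrM.
have -> : D * (e i0).1 = (a - s u) * (v i0).2 - (b - s v) * (u i0).2.
  by rewrite -au -bv /D /det2; ring.
have -> : D * (e i0).2 = (b - s v) * (u i0).1 - (a - s u) * (v i0).1.
  by rewrite -au -bv /D /det2; ring.
by split; apply: normr_det2_le.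
Qed.

(** * Coefficient vectors as finite types *)

Lemma coef_inj A : injective (@coef A).
Proof. by move=> i j /addIr [] /val_inj. Qed.

Lemma coef_bound A (i : 'I_(2 * A + 1)) : `|coef i| <= A%:Z.
Proof. by rewrite /coef; have := ltn_ord i; lia. Qed.

Fact enc_subproof B : (B < 2 * B + 1)%N. Proof. lia. Qed.

(** A section of [coef] for [|z| <= B] only; other integers get a junk index. *)
Definition enc (B : nat) (z : int) : 'I_(2 * B + 1) :=
  insubd (Ordinal (enc_subproof B)) `|(z + B%:Z)%R|%N.

Lemma encK B z : `|z| <= B%:Z -> coef (enc B z) = z.
Proof.
by move=> zB; rewrite /coef /enc val_insubd ifT; lia.
Qed.

Lemma card_coef_le B C : (C <= B)%N -> #|[pred x : 'I_(2 * B + 1) | `|coef x| <= C%:Z]| = (2 * C + 1)%N.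
Proof.
move=> CB; rewrite -[RHS]card_ord -(card_imset _ (f := fun y : 'I_(2 * C + 1) => enc B (coef y))).
  apply: eq_card => x; rewrite !inE; apply/idP/imsetP => [xC|[y _ ->]].
    exists (enc C (coef x)) => //; apply: coef_inj.
    by rewrite (encK xC) encK ?coef_bound.
  by rewrite encK ?coef_bound // (le_trans (coef_bound y)) ?lez_nat.
move=> y1 y2 /(congr1 (@coef B)); rewrite !encK; [exact: coef_inj| |].
all: by rewrite (le_trans (coef_bound _)) ?lez_nat.
Qed.

Definition block (A m : nat) : finType := {ffun 'I_m -> 'I_(2 * A + 1) * 'I_(2 * A + 1)}.

Definition bval A m (a : block A m) (i : 'I_m) : int * int := (coef (a i).1, coef (a i).2).

Lemma card_block A m : #|block A m| = ((2 * A + 1) ^ (2 * m))%N.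
Proof. by rewrite card_ffun card_prod !card_ord mulnn -expnM. Qed.

Lemma bval_inj A m (a b : block A m) : bval a =1 bval b -> a = b.
Proof.
move=> ab; apply/ffunP => i; have [] := ab i => /coef_inj + /coef_inj.
by case: (a i) (b i) => ? ? [? ?] /= -> ->.
Qed.

Definition benc B m (z : 'I_m -> int * int) : block B m :=
  [ffun i => (enc B (z i).1, enc B (z i).2)].

Lemma bencK B m (z : 'I_m -> int * int) i :
  `|(z i).1| <= B%:Z -> `|(z i).2| <= B%:Z -> bval (benc B z) i = z i.
Proof. by move=> z1 z2; rewrite /bval ffunE /= !encK //; case: (z i). Qed.

(** One pair has its own range because reduction modulo a minor leaves all the size in the pair of
    that minor. *)
Definition sub_block A m i0 (C1 C2 : nat) : pred (block A m) :=
  [pred a | [forall i, let C := (if i == i0 then C2 else C1)%:Z in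
     (`|(bval a i).1| <= C) && (`|(bval a i).2| <= C)]].

Lemma card_sub_block A m i0 C1 C2 : (C1 <= A)%N -> (C2 <= A)%N ->
  #|@sub_block A m i0 C1 C2| = ((2 * C1 + 1) ^ (2 * m.-1) * (2 * C2 + 1) ^ 2)%N.
Proof.
move=> C1A C2A.
pose F (i : 'I_m) := [pred p : 'I_(2 * A + 1) * 'I_(2 * A + 1) |
   (`|coef p.1| <= (if i == i0 then C2 else C1)%:Z) &&
   (`|coef p.2| <= (if i == i0 then C2 else C1)%:Z)].
have -> : #|@sub_block A m i0 C1 C2| = #|family F|.
  by apply: eq_card => a; rewrite !inE; apply: eq_forallb => i; rewrite ?inE.
rewrite card_family foldrE big_image /=.
have cF C : (C <= A)%N -> #|[pred p : 'I_(2 * A + 1) * 'I_(2 * A + 1) |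
   (`|coef p.1| <= C%:Z) && (`|coef p.2| <= C%:Z)]| = ((2 * C + 1) ^ 2)%N.
  move=> CA; rewrite -mulnn -(card_coef_le CA) -cardX.
  by apply: eq_card => p; rewrite !inE.
rewrite (bigD1 i0) //= eqxx cF // mulnC; congr (_ * _)%N.
rewrite (eq_bigr (fun=> ((2 * C1 + 1) ^ 2)%N)); last first.
  by move=> i /negbTE ii; rewrite ii cF.
rewrite prod_nat_const expnM; congr (_ ^ _)%N.
by rewrite cardC1 card_ord.
Qed.

(** * Nets with one point in each cell and residue class *)

Definition in_net (H M : int) (Lc : nat) (cc : int -> int -> int) (c : int) : bool :=
  (`|(c %/ H)%Z|%N <= Lc)%N && (c == cc (c %/ H)%Z (c %% M)%Z).

(** The points of the cell of [c] congruent to [c] modulo [Q], numbered from the left; they stay in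
    the cell for [i < H / Q]. *)
Definition cell_point (H Q c : int) (i : nat) : int :=
  (c %/ H)%Z * H + ((c %% H)%Z %% Q)%Z + Q * i%:Z.

Lemma cell_pointP (H Q c : int) (i : nat) : 0 < H -> 0 < Q -> (i < `|(H %/ Q)%Z|)%N ->
  let t := cell_point H Q c i in
  [/\ (t %/ H)%Z = (c %/ H)%Z, (Q %| t - c)%Z, `|t - c| <= H
    & i = `|((t %% H)%Z %/ Q)%Z|%N].
Proof.
move=> H0 Q0 iH /=; set r := ((c %% H)%Z %% Q)%Z.
have Hn0 : H != 0 by lia.
have Qn0 : Q != 0 by lia.
have r0 : 0 <= r by apply: modz_ge0.
have rQ : r < Q by apply: ltz_pmod.
have iH' : Q * (i%:Z + 1) <= H.
  have h0 : 0 <= (H %/ Q)%Z by rewrite divz_ge0 // ltW.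
  have i1 : i%:Z + 1 <= (H %/ Q)%Z by move: iH h0; lia.
  rewrite (le_trans (ler_wpM2l (ltW Q0) i1)) // mulrC.
  by rewrite lez_floor.
have s0 : 0 <= r + Q * i%:Z by apply: addr_ge0 => //; apply: mulr_ge0 => //; lia.
have sH : r + Q * i%:Z < H by apply: lt_le_trans iH'; rewrite mulrDr mulr1 addrC ltrD2l.
have sH' : 0 <= r + Q * i%:Z < `|H|%N by rewrite s0 gtz0_abs.
have rQ' : 0 <= r < `|Q|%N by rewrite r0 gtz0_abs.
have tH : (cell_point H Q c i %/ H)%Z = (c %/ H)%Z.
  by rewrite /cell_point -/r -addrA divzMDl // (divz_small sH') addr0.
have tmH : (cell_point H Q c i %% H)%Z = r + Q * i%:Z.
  by rewrite /cell_point -/r -addrA modzMDl modz_small // s0.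
have c0 := modz_ge0 c Hn0; have cH := ltz_pmod c H0.
have tc : cell_point H Q c i - c = r + Q * i%:Z - (c %% H)%Z.
  by rewrite /cell_point -/r [X in _ - X = _](divz_eq c H); ring.
split => //.
- by rewrite tc -eqz_mod_dvd addrC mulrC modzMDl /r modz_mod.
- by rewrite tc; move: s0 sH c0 cH; move: (r + _) (c %% H)%Z => x y; lia.
- by rewrite tmH addrC mulrC divzMDl // (divz_small rQ') addr0.
Qed.

Lemma in_net_eq H M Lc cc c c' : in_net H M Lc cc c -> in_net H M Lc cc c' ->
  (c %/ H)%Z = (c' %/ H)%Z -> (c = c' %[mod M])%Z -> c = c'.
Proof. by move=> /andP[_ /eqP cE] /andP[_ /eqP cE'] h m; rewrite cE cE' h m. Qed.

(* Shifting [a] by the vectors [e] moves the pair of values over all points of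
   its pair of cells with the same residues modulo [Q]; distinct pairs of net
   points produce distinct images. *)
Lemma net_pair_count (A m E1 E2 Lc : nat) (H M Q : int) cc (u v : 'I_m -> int * int) i0 :
    0 < H -> 0 < Q -> (M %| Q)%Z -> (E1 <= E2)%N ->
    (forall a b : int, (Q %| a)%Z -> (Q %| b)%Z -> `|a| <= H -> `|b| <= H ->
      exists e, [/\ pair_dot e u = a, pair_dot e v = b &
        forall i, let E := (if i == i0 then E2 else E1)%:Z in
          `|(e i).1| <= E /\ `|(e i).2| <= E]) ->
  (`|(H %/ Q)%Z| ^ 2 * #|[set a : block A m | in_net H M Lc cc (pair_dot (bval a) u) &&
      in_net H M Lc cc (pair_dot (bval a) v)]| <=
   (2 * (A + E1) + 1) ^ (2 * m.-1) * (2 * (A + E2) + 1) ^ 2)%N.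
Proof.
move=> H0 Q0 MQ E12 hE; set S := [set a | _]; set n := `|(H %/ Q)%Z|%N.
have /choice[e eP] : forall ab : int * int, exists e : 'I_m -> int * int,
    (Q %| ab.1)%Z -> (Q %| ab.2)%Z -> `|ab.1| <= H -> `|ab.2| <= H ->
      [/\ pair_dot e u = ab.1, pair_dot e v = ab.2 &
        forall i, let E := (if i == i0 then E2 else E1)%:Z in
          `|(e i).1| <= E /\ `|(e i).2| <= E].
  move=> [a b] /=.
  case: (pselect [/\ (Q %| a)%Z, (Q %| b)%Z, `|a| <= H & `|b| <= H]) => [[h1 h2 h3 h4]|h].
    by have [e he] := hE a b h1 h2 h3 h4; exists e.
  by exists (fun=> 0) => h1 h2 h3 h4; case: h.
pose pt c (i : 'I_n) := cell_point H Q c i.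
pose sh (x : block A m * ('I_n * 'I_n)) i :=
  let cu := pair_dot (bval x.1) u in let cv := pair_dot (bval x.1) v in
  bval x.1 i + e (pt cu x.2.1 - cu, pt cv x.2.2 - cv) i.
have shP x : let cu := pair_dot (bval x.1) u in let cv := pair_dot (bval x.1) v in
   [/\ pair_dot (sh x) u = pt cu x.2.1, pair_dot (sh x) v = pt cv x.2.2 &
        forall i, let E := (A + if i == i0 then E2 else E1)%:Z in
          `|(sh x i).1| <= E /\ `|(sh x i).2| <= E].
  move=> cu cv; rewrite /sh -/cu -/cv.
  have [_ q1 h1 _] := cell_pointP cu H0 Q0 (ltn_ord x.2.1).
  have [_ q2 h2 _] := cell_pointP cv H0 Q0 (ltn_ord x.2.2).
  have [/= eu ev eb] := eP (pt cu x.2.1 - cu, pt cv x.2.2 - cv) q1 q2 h1 h2.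
  rewrite !pair_dotD eu ev -/cu -/cv; split; try by ring.
  move=> i /=; have [b1 b2] := eb i; rewrite PoszD; split.
    by apply: le_trans (ler_normD _ _) _; apply: lerD b1; apply: coef_bound.
  by apply: le_trans (ler_normD _ _) _; apply: lerD b2; apply: coef_bound.
have shB x i : bval (benc (A + E2) (sh x)) i = sh x i.
  have [_ _ b] := shP x; have [b1 b2] := b i.
  by apply: bencK; [apply: le_trans b1 _|apply: le_trans b2 _]; case: ifP; rewrite // !lez_nat leq_add2l.
rewrite -(@card_sub_block (A + E2) m i0) ?leq_add2l //.
have -> : (n ^ 2 * #|S| = #|setX S [set: 'I_n * 'I_n]|)%N.
  by rewrite cardsX cardsT card_prod card_ord mulnC.
rewrite -(card_in_imset (f := fun x => benc (A + E2) (sh x))).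
  apply/subset_leq_card/subsetP => b /imsetP[x _ {b}->].
  rewrite !inE; apply/forallP => i; rewrite shB.
  by have [_ _ bd] := shP x; have [b1 b2] := bd i; move: b1 b2; case: ifP => _ -> ->.
move=> x y xS yS xy; move: xS yS; rewrite !inE !andbT => /andP[xu xv] /andP[yu yv].
have shxy : sh x =1 sh y by move=> i; rewrite -!shB xy.
have dotxy z : pair_dot (sh x) z = pair_dot (sh y) z.
  by apply: eq_bigr => i _; rewrite shxy.
have [xsu xsv _] := shP x; have [ysu ysv _] := shP y.
have key z (i j : 'I_n) : in_net H M Lc cc (pair_dot (bval x.1) z) ->
    in_net H M Lc cc (pair_dot (bval y.1) z) ->
    pt (pair_dot (bval x.1) z) i = pt (pair_dot (bval y.1) z) j ->
    pair_dot (bval x.1) z = pair_dot (bval y.1) z /\ i = j.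
  set c := pair_dot _ z; set c' := pair_dot _ z => nc nc' e0.
  have [d1 q1 _ i1] := cell_pointP c H0 Q0 (ltn_ord i).
  have [d2 q2 _ i2] := cell_pointP c' H0 Q0 (ltn_ord j).
  split; last by apply: val_inj => /=; rewrite i1 i2; move: e0; rewrite /pt => ->.
  apply: (in_net_eq nc nc'); first by rewrite -d1 -d2; move: e0; rewrite /pt => ->.
  have m1 : (c = pt c i %[mod M])%Z by apply/esym/eqP; rewrite eqz_mod_dvd (dvdz_trans MQ).
  have m2 : (c' = pt c' j %[mod M])%Z by apply/esym/eqP; rewrite eqz_mod_dvd (dvdz_trans MQ).
  by rewrite m1 m2 e0.
have [cu iu] := key u x.2.1 y.2.1 xu yu (etrans (esym xsu) (etrans (dotxy u) ysu)).
have [cv iv] := key v x.2.2 y.2.2 xv yv (etrans (esym xsv) (etrans (dotxy v) ysv)).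
have x2 : x.2 = y.2 by rewrite [x.2]surjective_pairing [y.2]surjective_pairing iu iv.
have x1 : x.1 = y.1.
  apply: bval_inj => i; have := shxy i; rewrite /sh cu cv iu iv.
  exact: addIr.
by rewrite [x]surjective_pairing [y]surjective_pairing x1 x2.
Qed.

(* [cc j r] is one chosen point of the cell [[j * H, (j + 1) * H)] congruent to
   [r] modulo [M]; the net consists of these points for [`|j| <= Lc]. *)
Definition net_spec (H M : int) (Lc : nat) (cc : int -> int -> int) :=
  forall j r : int, (`|j|%N <= Lc)%N -> 0 <= r < M ->
    (cc j r %/ H)%Z = j /\ (cc j r %% M)%Z = r.

Lemma net_specP H M Lc cc t : 0 < M -> net_spec H M Lc cc -> (`|(t %/ H)%Z|%N <= Lc)%N ->
  let c := cc (t %/ H)%Z (t %% M)%Z in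
  [/\ in_net H M Lc cc c, (c %/ H)%Z = (t %/ H)%Z & (c = t %[mod M])%Z].
Proof.
move=> M0 hcc tL c; have Mn0 : M != 0 by lia.
have [|h1 h2] := hcc (t %/ H)%Z (t %% M)%Z tL; first by rewrite modz_ge0 //= ltz_pmod.
split; rewrite /c ?h1 ?h2 //.
by rewrite /in_net h1 h2 eqxx tL.
Qed.

Lemma same_cell_dist (H t c : int) : 0 < H -> (t %/ H)%Z = (c %/ H)%Z -> `|c - t| <= H.
Proof.
move=> H0 e; have Hn0 : H != 0 by lia.
have -> : c - t = (c %% H)%Z - (t %% H)%Z.
  by rewrite [X in X - _ = _](divz_eq c H) [X in _ - X = _](divz_eq t H) e; ring.
have := modz_ge0 c Hn0; have := ltz_pmod c H0.
have := modz_ge0 t Hn0; have := ltz_pmod t H0.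
by move: (c %% H)%Z (t %% H)%Z => x y; lia.
Qed.

(** Each vector of the slightly smaller box is moved to the net point of its cell by changing the
    pair [i0] alone. The move forgets only the rank of the value among the points of its cell and
    class modulo [M], so a vector has at most [H / M + 1] preimages. *)
Lemma net_single_count (A m E Lc : nat) (H M : int) cc (u : 'I_m -> int * int) i0 :
    0 < H -> 0 < M -> net_spec H M Lc cc -> (E <= A)%N ->
    (forall d : int, (M %| d)%Z -> `|d| <= H ->
      exists e : int * int, [/\ e.1 * (u i0).1 + e.2 * (u i0).2 = d, `|e.1| <= E%:Z & `|e.2| <= E%:Z]) ->
    (forall a : block A m, (`|(pair_dot (bval a) u %/ H)%Z|%N <= Lc)%N) ->
  ((2 * A + 1) ^ (2 * m.-1) * (2 * (A - E) + 1) ^ 2 <=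
   `|(H %/ M)%Z|.+1 * #|[set a : block A m | in_net H M Lc cc (pair_dot (bval a) u)]|)%N.
Proof.
move=> H0 M0 hcc EA hE hL.
have Hn0 : H != 0 by lia.
have /choice[e eP] : forall d : int, exists e : int * int, (M %| d)%Z -> `|d| <= H ->
    [/\ e.1 * (u i0).1 + e.2 * (u i0).2 = d, `|e.1| <= E%:Z & `|e.2| <= E%:Z].
  move=> d; case: (pselect ((M %| d)%Z /\ `|d| <= H)) => [[h1 h2]|h].
    by have [x hx] := hE d h1 h2; exists x.
  by exists 0 => h1 h2; case: h.
pose t (a : block A m) := pair_dot (bval a) u.
pose c a := cc (t a %/ H)%Z (t a %% M)%Z.
have cP a : [/\ in_net H M Lc cc (c a), (c a %/ H)%Z = (t a %/ H)%Z & (c a = t a %[mod M])%Z].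
  exact: (net_specP M0 hcc (hL a)).
have dP a : (M %| c a - t a)%Z /\ `|c a - t a| <= H.
  by have [_ h1 h2] := cP a; split; [rewrite -eqz_mod_dvd h2|apply: same_cell_dist].
pose sh a i := bval a i + if i == i0 then e (c a - t a) else 0.
have shu a : pair_dot (sh a) u = c a.
  rewrite /sh pair_dotD -/(t a).
  have -> : pair_dot (fun i => if i == i0 then e (c a - t a) else 0) u = c a - t a.
    rewrite /pair_dot (bigD1 i0) //= eqxx big1 ?addr0; last first.
      by move=> i /negbTE ->; rewrite !mul0r addr0.
    by have [d1 d2] := dP a; have [] := eP _ d1 d2.
  by rewrite addrC subrK.
rewrite -(@card_sub_block A m i0 A (A - E)) ?leq_subr //.
set S := [set a | _].
have idx_lt a : (`|((t a %% H)%Z %/ M)%Z| < `|(H %/ M)%Z|.+1)%N.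
  have : (((t a %% H)%Z %/ M)%Z <= (H %/ M)%Z)%R.
    by apply: lez_pdiv2r; apply: ltW => //; exact: ltz_pmod.
  have : 0 <= ((t a %% H)%Z %/ M)%Z by rewrite divz_ge0 // modz_ge0.
  by move: ((t a %% H)%Z %/ M)%Z (H %/ M)%Z => x y; lia.
have shB a : sub_block i0 A (A - E) a -> bval (benc A (sh a)) =1 sh a.
  move=> /forallP aS i; have /andP[a1 a2] := aS i.
  have [d1 d2] := dP a; have [_ e1 e2] := eP _ d1 d2.
  apply: bencK; rewrite /sh /=; move: a1 a2; case: ifP => _ /= a1 a2; rewrite ?addr0 //.
    by apply: le_trans (ler_normD _ _) _; apply: le_trans (lerD a1 e1) _; lia.
  by apply: le_trans (ler_normD _ _) _; apply: le_trans (lerD a2 e2) _; lia.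
pose f a := (Ordinal (idx_lt a), benc A (sh a)).
have dsh a : sub_block i0 A (A - E) a -> pair_dot (bval (benc A (sh a))) u = c a.
  by move=> aS; rewrite -shu; apply: eq_bigr => i _; rewrite shB.
rewrite -(card_in_imset (f := f)).
  have -> : (`|(H %/ M)%Z|.+1 * #|S| = #|setX [set: 'I_(`|(H %/ M)%Z|.+1)] S|)%N.
    by rewrite cardsX cardsT card_ord.
  apply/subset_leq_card/subsetP => b /imsetP[a aS {b}->].
  by rewrite !inE /= dsh //; have [] := cP a.
move=> a b aS bS [i1 i2].
have cab : c a = c b by rewrite -dsh // i2 dsh.
have [_ ca1 ca2] := cP a; have [_ cb1 cb2] := cP b.
have tab : t a = t b.
  rewrite (divz_eq (t a) H) (divz_eq (t b) H) -ca1 -cb1 cab; congr (_ + _).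
  rewrite (divz_eq (t a %% H)%Z M) (divz_eq (t b %% H)%Z M).
  have q0 x : 0 <= ((x %% H)%Z %/ M)%Z by rewrite divz_ge0 // modz_ge0.
  have -> : ((t a %% H)%Z %/ M)%Z = ((t b %% H)%Z %/ M)%Z.
    by rewrite -[LHS]gez0_abs // -[RHS]gez0_abs // i1.
  congr (_ + _); have modE x y : (x %/ H)%Z = (y %/ H)%Z -> (x = y %[mod M])%Z ->
      ((x %% H)%Z = (y %% H)%Z %[mod M])%Z.
    move=> xy xyM; apply/eqP; rewrite eqz_mod_dvd.
    have -> : (x %% H)%Z - (y %% H)%Z = x - y.
      by rewrite [X in _ = X - _](divz_eq x H) [X in _ = _ - X](divz_eq y H) xy; ring.
    by rewrite -eqz_mod_dvd xyM.
  by apply: modE; [rewrite -ca1 -cb1 cab|rewrite -ca2 -cb2 cab].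
apply: bval_inj => i; have : sh a i = sh b i by rewrite -!shB // i2.
by rewrite /sh cab tab; apply: addIr.
Qed.

(** Given the net point and all other coefficients, the first coefficient of the pair [i0] is
    determined, its multiplier being nonzero. The gain is a single factor [2A + 1], but no minor is
    involved: this serves for pairs of tuples whose minors all vanish. *)
Lemma net_trivial_count (A m Lc Mn : nat) (H : int) cc (u : 'I_m -> int * int) i0 :
    (0 < Mn)%N -> (u i0).1 != 0 ->
  (#|[set a : block A m | in_net H Mn%:Z Lc cc (pair_dot (bval a) u)]| * (2 * A + 1) <=
   (2 * Lc + 1) * Mn * (2 * A + 1) ^ (2 * m))%N.
Proof.
move=> M0 u0; set S := [set a | _].
pose t (a : block A m) := pair_dot (bval a) u.
have res_lt x : (`|(x %% Mn%:Z)%Z| < Mn)%N.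
  have h1 : (x %% Mn%:Z)%Z < Mn%:Z by apply: ltz_pmod; lia.
  have h2 : 0 <= (x %% Mn%:Z)%Z by apply: modz_ge0; lia.
  by move: h1 h2; move: (x %% Mn%:Z)%Z => y; lia.
pose set1 (a : block A m) w : block A m := [ffun i => if i == i0 then (w, (a i0).2) else a i].
pose f (x : block A m * 'I_(2 * A + 1)) :=
  (enc Lc (t x.1 %/ H)%Z, Ordinal (res_lt (t x.1)), set1 x.1 x.2).
have f_inj : {in setX S [set: 'I_(2 * A + 1)] &, injective f}.
  move=> [a w] [b z]; rewrite !inE !andbT /= => aS bS [ab1 ab2 ab3].
  have cE x : in_net H Mn%:Z Lc cc x -> x = cc (x %/ H)%Z (x %% Mn%:Z)%Z by move=> /andP[_ /eqP].
  have tab : t a = t b.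
    rewrite /t (cE _ aS) (cE _ bS) -/(t a) -/(t b); congr (cc _ _).
      rewrite -(@encK Lc (t a %/ H)%Z); last by case/andP: aS; rewrite /t; lia.
      rewrite ab1 encK //; by case/andP: bS; rewrite /t; lia.
    have r0 x : 0 <= (x %% Mn%:Z)%Z by apply: modz_ge0; lia.
    by rewrite -[LHS]gez0_abs // -[RHS]gez0_abs // ab2.
  have abi i : i != i0 -> a i = b i.
    by move=> /negbTE ii; have /ffunP/(_ i) := ab3; rewrite !ffunE ii.
  have /ffunP/(_ i0) := ab3; rewrite !ffunE eqxx => -[wz ab4].
  have ab5 : (a i0).1 = (b i0).1.
    apply: coef_inj; apply: (mulIf u0); move: tab.
    rewrite /t /pair_dot !(bigD1 (P := predT) i0) //= ab4.
    under eq_bigr => i ii do rewrite /bval (abi i ii).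
    by move=> /addIr /addIr.
  congr (_, _) => //; apply/ffunP => i; have [->|/abi //] := eqVneq i i0.
  by rewrite [a i0]surjective_pairing [b i0]surjective_pairing ab5 ab4.
have -> : (#|S| * (2 * A + 1) = #|setX S [set: 'I_(2 * A + 1)]|)%N.
  by rewrite cardsX cardsT card_ord.
rewrite -(card_in_imset f_inj); apply: leq_trans (max_card _) _.
by rewrite !card_prod !card_ord card_block.
Qed.

(** * The second moment method *)

Definition tup (j m : nat) : finType := {ffun 'I_m -> pool j * pool j}.

Lemma card_tup j m : #|tup j m| = (#|pool j| ^ (2 * m))%N.
Proof. by rewrite card_ffun card_prod card_ord mulnn -expnM. Qed.

Definition pows k j m (x : tup j m) (i : 'I_m) : int * int :=
  ((pval (x i).1 ^ k)%N%:Z, (pval (x i).2 ^ k)%N%:Z).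

Lemma det2_pows k j m (x y : tup j m) i :
  det2 (pows k x i) (pows k y i) = kdet k (x i) (y i).
Proof. by rewrite /det2 /pows /kdet /= !expnMn !PoszM. Qed.

Lemma pows_bound k j m (x : tup j m) i :
  0 <= (pows k x i).1 <= (2 ^ (k * j))%N%:Z /\ 0 <= (pows k x i).2 <= (2 ^ (k * j))%N%:Z.
Proof.
by rewrite /pows /= !lez_nat mulnC !expnM !leq_expn2r // pval_le.
Qed.

Definition gdet k j m (x y : tup j m) : nat := \big[gcdn/0%N]_(i < m) `|kdet k (x i) (y i)|%N.

Definition mdet k j m (x y : tup j m) : nat := (\max_(i < m) `|kdet k (x i) (y i)|)%N.

(** How far the largest minor falls short of its maximal order [U ^ 2], where [U = 2 ^ (k * j)]; the
    shift in the distinguished pair will have size about [A / K] times this. *)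
Definition spread k j m (x y : tup j m) : nat := (2 ^ (2 * k * j) %/ mdet k x y)%N.

Lemma kdet_le k j (p q : pool j * pool j) : (`|kdet k p q| <= 2 ^ (2 * k * j))%N.
Proof.
have b (x y : pool j) : ((pval x * pval y) ^ k <= 2 ^ (2 * k * j))%N.
  have -> : (2 ^ (2 * k * j) = (2 ^ j * 2 ^ j) ^ k)%N.
    by rewrite -expnD -expnM; congr (_ ^ _)%N; lia.
  by rewrite leq_expn2r // leq_mul ?pval_le.
by rewrite /kdet; have := b p.1 q.2; have := b p.2 q.1; lia.
Qed.

Lemma card_tup_pairs j m (R : pool j * pool j -> pool j * pool j -> bool) :
  (#|[set z : tup j m * tup j m | [forall i, R (z.1 i) (z.2 i)]]| <=
   #|[set q : quad j | R q.1 q.2]| ^ m)%N.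
Proof.
pose f (z : tup j m * tup j m) : {ffun 'I_m -> quad j} := [ffun i => (z.1 i, z.2 i)].
have f_inj : injective f.
  move=> [x y] [x' y'] /ffunP e; congr (_, _); apply/ffunP => i.
    by have := e i; rewrite !ffunE => -[].
  by have := e i; rewrite !ffunE => -[].
rewrite -(card_imset _ f_inj) -[m in X in (_ <= X)%N]card_ord -card_ffun_on.
apply/subset_leq_card/subsetP => h /imsetP[z]; rewrite inE => /forallP zR {h}->.
by apply/ffun_onP => i; rewrite ffunE in_set; exact: zR.
Qed.

Lemma mdet_eq0 k j m (x y : tup j m) : (mdet k x y == 0%N) = [forall i, kdet k (x i) (y i) == 0].
Proof.
apply/eqP/forallP => [/eqP|h]; last by apply: big1 => i _; rewrite (eqP (h i)).
by rewrite -leqn0 => /bigmax_leqP h i; rewrite -absz_eq0 -leqn0 h.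
Qed.

Lemma mdet_le k j m (x y : tup j m) : (mdet k x y <= 2 ^ (2 * k * j))%N.
Proof. by apply/bigmax_leqP => i _; exact: kdet_le. Qed.

Lemma gdet_dvd k j m (x y : tup j m) i : (gdet k x y %| `|kdet k (x i) (y i)|)%N.
Proof. by rewrite /gdet (bigD1 i) //= dvdn_gcdl. Qed.

Lemma mdet_attained k j m (x y : tup j m) : mdet k x y != 0%N ->
  exists i, `|kdet k (x i) (y i)|%N = mdet k x y.
Proof.
move=> n0; have [i0|] := altP (@forallP _ (fun i => kdet k (x i) (y i) == 0)).
  by move: n0; rewrite mdet_eq0; have /forallP -> := i0.
rewrite negb_forall => /existsP[i0 _].
have c0 : (0 < #|'I_m|)%N by apply/card_gt0P; exists i0.
by have [i iE] := bigop.eq_bigmax (fun i : 'I_m => `|kdet k (x i) (y i)|%N) c0; exists i; rewrite /mdet iE.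
Qed.

Lemma gdet_bound k j m (x y : tup j m) : mdet k x y != 0%N ->
  (0 < gdet k x y <= 2 ^ (2 * k * j))%N.
Proof.
move=> n0; have [i iE] := mdet_attained n0; have := gdet_dvd k x y i; rewrite iE => gd.
have m0 : (0 < mdet k x y)%N by rewrite lt0n.
rewrite (leq_trans (dvdn_leq m0 gd)) ?mdet_le // andbT lt0n.
by apply: contraNneq n0 => g0; rewrite g0 dvd0n in gd.
Qed.

Lemma spread_bound k j m (x y : tup j m) : mdet k x y != 0%N ->
  (0 < spread k x y <= 2 ^ (2 * k * j))%N.
Proof.
move=> n0; rewrite /spread divn_gt0 ?lt0n // leq_div andbT -?lt0n.
exact: mdet_le.
Qed.

Lemma sum_inv_sqr_le (R : realFieldType) n : \sum_(1 <= q < n.+1) (q%:R ^- 2 : R) <= 2.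
Proof.
case: n => [|n]; first by rewrite big_geq.
suff : \sum_(1 <= q < n.+2) (q%:R ^- 2 : R) <= 2 - n.+1%:R^-1.
  by move=> /le_trans; apply; rewrite gerBl invr_ge0 ler0n.
elim: n => [|n IHn]; first by rewrite big_nat1 /= expr1n invr1; lra.
rewrite big_nat_recr //=; apply: le_trans (lerD IHn (lexx _)) _.
have a0 : (0 : R) < n.+1%:R by rewrite ltr0n.
rewrite -[n.+2]addn1 natrD; move: (n.+1%:R) a0 => a a0.
have -> : 2 - (a + 1)^-1 = 2 - a^-1 + (a * (a + 1))^-1 by field; rewrite !lt0r_neq0 //; lra.
by rewrite lerD2l lef_pV2 ?posrE ?expr2 ?mulr_gt0 ?addr_gt0 // ler_wpM2r //; lra.
Qed.

(** The value [q] is taken at most [V / q ^ l] times, so the moment is at most [V] times the sum of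
    the [q ^ (B - l)], where [l - B >= 2]. *)
Lemma moment_le (R : realFieldType) (T : finType) (P : pred T) (f : T -> nat) (n B l : nat) (V : nat) :
    (B + 2 <= l)%N -> (forall z, P z -> (0 < f z <= n)%N) ->
    (forall q, (0 < q <= n)%N -> (#|[set z | P z && (f z == q)]| * q ^ l <= V)%N) ->
  \sum_(z | P z) ((f z)%:R ^+ B : R) <= 2 * V%:R.
Proof.
move=> Bl fn hV.
have -> : \sum_(z | P z) ((f z)%:R ^+ B : R) =
    \sum_(q < n.+1) \sum_(z | P z && (f z == q :> nat)) ((f z)%:R ^+ B : R).
  rewrite (partition_big (fun z => inord (f z) : 'I_n.+1) predT) //=.
  apply: eq_bigr => q _; apply: eq_bigl => z.
  have [Pz|//] := boolP (P z); rewrite /= -val_eqE /= inordK // ltnS.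
  by have /andP[] := fn z Pz.
rewrite -(big_mkord predT (fun q => \sum_(z | P z && (f z == q)) ((f z)%:R ^+ B : R))).
rewrite big_ltn // big1 ?add0r; last first.
  by move=> z /andP[/fn /andP[f0 _] /eqP f0']; rewrite f0' in f0.
apply: (@le_trans _ _ (\sum_(1 <= q < n.+1) (V%:R * q%:R ^- 2))); last first.
  by rewrite -mulr_sumr mulrC ler_wpM2r ?ler0n // sum_inv_sqr_le.
rewrite big_nat_cond [X in _ <= X]big_nat_cond; apply: ler_sum => q /andP[/andP[q0 qn] _].
have q0' : (0 : R) < q%:R by rewrite ltr0n.
rewrite (eq_bigr (fun=> (q%:R ^+ B : R))); last by move=> z /andP[_ /eqP ->].
rewrite sumr_const -[X in X <= _]mulr_natl.
rewrite ler_pdivlMr ?exprn_gt0 // -mulrA -exprD.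
apply: (@le_trans _ _ (#|[set z | P z && (f z == q)]|%:R * (q%:R ^+ l))).
  rewrite (_ : #|[set z | P z && (f z == q)]| = #|[pred z | P z && (f z == q)]|); last first.
    by apply: eq_card => z; rewrite !inE.
  by rewrite ler_wpM2l ?ler0n // ler_weXn2l // ler1n.
by rewrite -natrX -natrM ler_nat hV // q0 -ltnS.
Qed.

(** A gcd or a spread equal to [q] constrains every pair of coordinates, and the [m] pairs vary
    independently. As [m = 8 * 8k], the saving [q ^ (1/(8k))] of one pair becomes [q ^ 8], which
    leaves room for sixth moments. *)
Lemma det_moments (R : realFieldType) k : (0 < k)%N -> exists C, forall j, (18 <= j)%N ->
  let m := (64 * k)%N in
  [/\ \sum_(z : tup j m * tup j m | mdet k z.1 z.2 != 0%N) ((gdet k z.1 z.2)%:R ^+ 6 : R)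
        <= 2 * (C ^ m * #|tup j m| ^ 2)%N%:R,
      \sum_(z : tup j m * tup j m | mdet k z.1 z.2 != 0%N) ((spread k z.1 z.2)%:R ^+ 6 : R)
        <= 2 * (C ^ m * #|tup j m| ^ 2)%N%:R
    & (#|[set z : tup j m * tup j m | mdet k z.1 z.2 == 0%N]| * (2 ^ (2 * k * j)) ^ 8 <=
       C ^ m * #|tup j m| ^ 2)%N].
Proof.
move=> k0; have [C1 hC1] := card_kdet_dvd k0; have [C2 hC2] := card_kdet_small k0.
exists (C1 + C2)%N => j j18 m; set n := (2 ^ (2 * k * j))%N; set V := (_ * _)%N.
have VE : (V = (((C1 + C2) * #|pool j| ^ 4) ^ (8 * k)) ^ 8)%N.
  rewrite /V card_tup -!expnM expnMn -expnM; congr (_ ^ _ * _ ^ _)%N; rewrite /m; lia.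
have pw (c q : nat) : (c ^ (8 * k) * q <= ((C1 + C2) * #|pool j| ^ 4) ^ (8 * k) ->
    c ^ m * q ^ 8 <= V)%N.
  move=> h; rewrite VE; apply: leq_trans (leq_expn2r 8 h); rewrite expnMn -expnM.
  by rewrite /m (_ : 8 * k * 8 = 64 * k)%N //; lia.
have mono (C q S : nat) : (C <= C1 + C2 -> S ^ (8 * k) * q <= (C * #|pool j| ^ 4) ^ (8 * k) ->
    S ^ (8 * k) * q <= ((C1 + C2) * #|pool j| ^ 4) ^ (8 * k))%N.
  by move=> CC h; apply: leq_trans h _; rewrite leq_expn2r // leq_mul.
have hdvd q : (0 < q <= n)%N ->
    (#|[set z : tup j m * tup j m | [forall i, q %| `|kdet k (z.1 i) (z.2 i)|]]| * q ^ 8 <= V)%N.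
  move=> /andP[q0 qn].
  apply: leq_trans (leq_mul (@card_tup_pairs j m (fun a b => q %| `|kdet k a b|)%N) (leqnn _)) _.
  by apply: pw; apply: mono (leq_addr _ _) _; exact: hC1.
have hsm q : (0 < q <= n)%N ->
    (#|[set z : tup j m * tup j m | [forall i, `|kdet k (z.1 i) (z.2 i)| * q <= n]]| * q ^ 8 <= V)%N.
  move=> /andP[q0 qn].
  apply: leq_trans (leq_mul (@card_tup_pairs j m (fun a b => `|kdet k a b| * q <= n)%N) (leqnn _)) _.
  by apply: pw; apply: mono (leq_addl _ _) _; exact: hC2.
split.
- apply: (@moment_le R _ _ _ n 6 8) => // [z|q qn]; first exact: gdet_bound.
  apply: leq_trans (hdvd q qn); rewrite leq_mul //; apply/subset_leq_card/subsetP => z.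
  rewrite !inE => /andP[_ /eqP gq]; apply/forallP => i; rewrite -gq; exact: gdet_dvd.
- apply: (@moment_le R _ _ _ n 6 8) => // [z|q qn]; first exact: spread_bound.
  apply: leq_trans (hsm q qn); rewrite leq_mul //; apply/subset_leq_card/subsetP => z.
  rewrite !inE => /andP[_ /eqP gq]; apply/forallP => i; rewrite -gq mulnC.
  apply: leq_trans (leq_trunc_div n (mdet k z.1 z.2)); rewrite /spread -/n leq_mul //.
  exact: (@leq_bigmax _ (fun i : 'I_m => `|kdet k (z.1 i) (z.2 i)|%N)).
(* Vanishing minors are divisible by the largest admissible modulus [n]. *)
- have n1 : (0 < n <= n)%N by rewrite leqnn expn_gt0.
  apply: leq_trans (hdvd n n1); rewrite leq_mul //; apply/subset_leq_card/subsetP => z.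
  rewrite !inE mdet_eq0 => /forallP h; apply/forallP => i.
  by rewrite (eqP (h i)) dvdn0.
Qed.

(** The factor by which the spacing of the shifts exceeds the spacing of the net: a gcd at most [w]
    already divides the factorial of [w]. *)
Definition excess k j m w (x y : tup j m) : nat :=
  if (gdet k x y <= w)%N then 1%N else gdet k x y.

Definition net_hits A m k j H M Lc cc (x : tup j m) : {set block A m} :=
  [set a | in_net H M Lc cc (pair_dot (bval a) (pows k x))].

Lemma pair_shift_bound (A U K m d t : nat) : (0 < K)%N -> (0 < d <= U ^ 2)%N ->
  (d * t <= 2 * U * (A * U %/ K + 2 * m * U * d))%N ->
  (t <= 4 * (U ^ 2 %/ d) * A %/ K + 4 * m * U ^ 2)%N.
Proof.
move=> K0 /andP[d0 dU] dt; set Y := (U ^ 2 %/ d)%N.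
have Y0 : (0 < Y)%N by rewrite divn_gt0.
have YU : (U ^ 2 <= 2 * Y * d)%N.
  have : (U ^ 2 < Y.+1 * d)%N by rewrite -ltn_divLR.
  by move: Y0; move: (U ^ 2)%N => u; nia.
rewrite addnC -leq_subLR leq_divRL //.
set s := (t - 4 * m * U ^ 2)%N.
have ds : (d * s <= 2 * U * (A * U %/ K))%N.
  rewrite /s mulnBr leq_subLR; apply: leq_trans dt _; apply: eq_leq; ring.
rewrite -(leq_pmul2l d0) mulnA; apply: (@leq_trans (2 * U * (A * U %/ K) * K)).
  by rewrite leq_mul2r ds orbT.
rewrite -mulnA; apply: (@leq_trans (2 * U * (A * U))); first by rewrite leq_mul // leq_trunc_div.
rewrite (_ : 2 * U * (A * U) = 2 * A * U ^ 2)%N; last by ring.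
by apply: leq_trans (leq_mul (leqnn _) YU) _; apply: eq_leq; ring.
Qed.

Lemma tup_pair_count A m k j K w Lc cc (x y : tup j m) :
    (0 < m)%N -> (0 < K)%N -> mdet k x y != 0%N ->
    let U := (2 ^ (k * j))%N in let H := (A * U %/ K)%N in
    let Q := (excess k w x y * w`!)%N in
    (0 < H)%N ->
  ((H %/ Q) ^ 2 *
     #|net_hits A k H%:Z (w`!)%:Z Lc cc x :&: net_hits A k H%:Z (w`!)%:Z Lc cc y| <=
   (2 * (A + U ^ 2) + 1) ^ (2 * m.-1) *
   (2 * (A + (4 * spread k x y * A %/ K + 4 * m * U ^ 2)) + 1) ^ 2)%N.
Proof.
move=> m0 K0 n0 U H Q H0.
have [i0 iE] := mdet_attained n0; have /andP[g0 gU] := gdet_bound n0.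
have U2 : (2 ^ (2 * k * j) = U ^ 2)%N by rewrite -expnM; congr (_ ^ _)%N; lia.
have gQ : (gdet k x y %| Q)%N.
  rewrite /Q /excess; case: leqP => gw; last by rewrite dvdn_mulr.
  by rewrite mul1n dvdn_fact ?g0.
have Q0 : (0 < Q)%N by rewrite /Q /excess muln_gt0 fact_gt0 andbT; case: ifP.
have -> : ((H %/ Q) = `|(H%:Z %/ Q%:Z)%Z|)%N by rewrite divz_nat.
have -> : net_hits A k H%:Z (w`!)%:Z Lc cc x :&: net_hits A k H%:Z (w`!)%:Z Lc cc y =
    [set a : block A m | in_net H%:Z (w`!)%:Z Lc cc (pair_dot (bval a) (pows k x)) &&
      in_net H%:Z (w`!)%:Z Lc cc (pair_dot (bval a) (pows k y))].
  by apply/setP => a; rewrite !inE.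
set D := det2 (pows k x i0) (pows k y i0).
have DE : `|D|%N = mdet k x y by rewrite /D det2_pows.
have D0 : D != 0 by rewrite -absz_eq0 DE.
have DU : (`|D| <= U ^ 2)%N by rewrite DE -U2 mdet_le.
apply: (@net_pair_count A m (U ^ 2)%N _ Lc H%:Z (w`!)%:Z Q%:Z cc _ _ i0) => //.
- by rewrite dvdzE /= /Q dvdn_mull.
- by apply: leq_trans (leq_addl _ _); rewrite leq_pmull // muln_gt0.
move=> a b Qa Qb aH bH.
have re : reach (pows k x) (pows k y) a b.
  have gE : (\big[gcdn/0%N]_(i < m) `|det2 (pows k x i) (pows k y i)|)%N = gdet k x y.
    by rewrite /gdet; apply: eq_bigr => i _; rewrite det2_pows.
  have gz z : (Q%:Z %| z)%Z -> exists c, z = (gdet k x y)%:Z * c.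
    move=> Qz; have /dvdzP[c ->] : ((gdet k x y)%:Z %| z)%Z.
      by apply: dvdz_trans Qz; rewrite dvdzE.
    by exists c; rewrite mulrC.
  have [c ->] := gz a Qa; have [d ->] := gz b Qb.
  by have := reach_gcd (pows k x) (pows k y) (index_enum 'I_m) c d; rewrite /= gE.
have uvU i : [/\ 0 <= (pows k x i).1 <= U%:Z, 0 <= (pows k x i).2 <= U%:Z,
                   0 <= (pows k y i).1 <= U%:Z & 0 <= (pows k y i).2 <= U%:Z].
  by have [] := pows_bound k x i; have [] := pows_bound k y i.
have [e [eu ev e1 e2]] := reach_small uvU D0 re aH bH.
exists e; split => // i; case: eqP => [->|/eqP ii] /=; last first.
  have [h1 h2] := e1 i ii; split.
    by apply: le_trans h1 _; rewrite -abszE lez_nat.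
  by apply: le_trans h2 _; rewrite -abszE lez_nat.
have d0 : (0 < `|D| <= U ^ 2)%N by rewrite DU absz_gt0 D0.
have fin (z : int) : `|D| * `|z| <= 2 * U%:Z * (H%:Z + 2 * m%:Z * U%:Z * `|D|) ->
    `|z| <= (4 * spread k x y * A %/ K + 4 * m * U ^ 2)%N%:Z.
  rewrite -!abszE => dt; rewrite lez_nat /spread -DE U2; apply: pair_shift_bound => //.
by have [h1 h2] := e2; split; apply: fin.
Qed.

(** The pair count relative to its expected value. Lower-order errors are collected in [th]; the
    true losses are [excess], from the coarser lattice of shifts, and the spread, from the enlarged
    range of one pair. *)
Lemma tup_pair_ratio (R : realFieldType) A m k j K w Lc cc (x y : tup j m) (th : R) :
    (0 < m)%N -> (0 < K)%N -> mdet k x y != 0%N ->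
    let U := (2 ^ (k * j))%N in let H := (A * U %/ K)%N in let B := (2 * A + 1)%N in
    0 < th < 1 -> (2 * U ^ 2)%:R <= th * B%:R -> (8 * m * U ^ 2)%:R <= th * B%:R ->
    (U ^ 2 * w`!)%:R <= th * H%:R ->
  #|net_hits A k H%:Z (w`!)%:Z Lc cc x :&: net_hits A k H%:Z (w`!)%:Z Lc cc y|%:R *
    H%:R ^+ 2 * (1 - th) ^+ 2 <=
  (B ^ (2 * m))%:R * (w`!)%:R ^+ 2 * (1 + th) ^+ (2 * m.-1) *
    ((excess k w x y)%:R * (1 + 4 * (spread k x y)%:R / K%:R + th)) ^+ 2.
Proof.
move=> m0 K0 n0 U H B /andP[th0 th1] U2B mU2B MH.
set cnt := #|_|; set M := w`!; set ex := excess k w x y; set Y := spread k x y.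
have M0 : (0 < M)%N by exact: fact_gt0.
have U0 : (0 < U)%N by rewrite expn_gt0.
have H0 : (0 < H)%N.
  rewrite -(ltr0n R) -(pmulr_rgt0 _ th0); apply: lt_le_trans MH.
  by rewrite ltr0n muln_gt0 expn_gt0 U0.
have K0' : (0 : R) < K%:R by rewrite ltr0n.
have U2 : (2 ^ (2 * k * j) = U ^ 2)%N by rewrite -expnM; congr (_ ^ _)%N; lia.
have exU : (0 < ex <= U ^ 2)%N.
  have /andP[g0 gU] := gdet_bound n0; rewrite /ex /excess; case: ifP => _.
    by rewrite expn_gt0 U0.
  by rewrite g0 -U2.
have /andP[ex0 exU2] := exU.
set Q := (ex * M)%N; have Q0 : (0 < Q)%N by rewrite muln_gt0 ex0.
have QH : Q%:R <= th * H%:R :> R.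
  by apply: le_trans MH; rewrite ler_nat leq_mul.
have HQ : (H%:R * (1 - th) : R) <= (H %/ Q)%:R * Q%:R.
  apply: (@le_trans _ _ (H%:R - Q%:R)); first by rewrite mulrBr mulr1 lerD2l lerN2 mulrC.
  rewrite lerBlDr -natrM -natrD ler_nat -mulSnr ltnW //.
  by rewrite -ltn_divLR.
have H1 : (0 : R) <= H%:R * (1 - th) by rewrite mulr_ge0 ?ler0n // subr_ge0 ltW.
have cl : ((H %/ Q) ^ 2 * cnt <= (2 * (A + U ^ 2) + 1) ^ (2 * m.-1) *
    (2 * (A + (4 * Y * A %/ K + 4 * m * U ^ 2)) + 1) ^ 2)%N.
  exact: (@tup_pair_count A m k j K w Lc cc x y m0 K0 n0 H0).
have B0 : (0 : R) < B%:R by rewrite ltr0n /B addn1.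
have c1 : (2 * (A + U ^ 2) + 1)%:R <= B%:R * (1 + th) :> R.
  rewrite (_ : 2 * (A + U ^ 2) + 1 = B + 2 * U ^ 2)%N; last by rewrite /B; ring.
  by rewrite natrD mulrDr mulr1 lerD2l mulrC.
have c2 : (2 * (A + (4 * Y * A %/ K + 4 * m * U ^ 2)) + 1)%:R <= B%:R * (1 + 4 * Y%:R / K%:R + th) :> R.
  rewrite (_ : 2 * _ + 1 = B + 2 * (4 * Y * A %/ K) + 8 * m * U ^ 2)%N; last by rewrite /B; ring.
  rewrite (natrD _ (B + _)%N) (natrD _ B) !mulrDr mulr1; apply: lerD; last by rewrite mulrC.
  rewrite lerD2l; apply: (@le_trans _ _ (2 * ((4 * Y * A)%:R / K%:R))).
    rewrite natrM ler_wpM2l // ler_pdivlMr // -natrM ler_nat; exact: leq_trunc_div.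
  rewrite !mulrA ler_wpM2r ?invr_ge0 ?ler0n // -!natrM ler_nat /B.
  apply: (@leq_trans (2 * A * (4 * Y))); first by apply: eq_leq; ring.
  by rewrite -[X in (_ <= X)%N]mulnA leq_mul // leq_addr.
have cQ : cnt%:R * H%:R ^+ 2 * (1 - th) ^+ 2 <= Q%:R ^+ 2 * ((H %/ Q) ^ 2 * cnt)%:R :> R.
  rewrite natrM natrX.
  have -> : cnt%:R * H%:R ^+ 2 * (1 - th) ^+ 2 = (H%:R * (1 - th)) ^+ 2 * cnt%:R :> R by ring.
  have -> : Q%:R ^+ 2 * ((H %/ Q)%:R ^+ 2 * cnt%:R) = ((H %/ Q)%:R * Q%:R) ^+ 2 * cnt%:R :> R by ring.
  by apply: ler_wpM2r; rewrite ?ler0n // lerXn2r // nnegrE // (le_trans H1).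
apply: le_trans cQ _.
apply: (@le_trans _ _ (Q%:R ^+ 2 * ((B%:R * (1 + th)) ^+ (2 * m.-1) * (B%:R * (1 + 4 * Y%:R / K%:R + th)) ^+ 2))).
  apply: ler_wpM2l; first by rewrite exprn_ge0 // ler0n.
  apply: (@le_trans _ _ ((2 * (A + U ^ 2) + 1) ^ (2 * m.-1) * (2 * (A + (4 * Y * A %/ K + 4 * m * U ^ 2)) + 1) ^ 2)%:R).
    by rewrite ler_nat.
  rewrite natrM !natrX; apply: ler_pM; rewrite ?exprn_ge0 ?ler0n //.
    by rewrite lerXn2r // nnegrE ?ler0n // (le_trans _ c1) // ler0n.
  by rewrite lerXn2r // nnegrE ?ler0n // (le_trans _ c2) // ler0n.
have -> : (2 * m = 2 * m.-1 + 2)%N by rewrite -{1}(prednK m0) mulnS addnC.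
rewrite /Q natrM natrX exprD [(B%:R * (1 + th)) ^+ _]exprMn.
set b1 := B%:R ^+ _; set b2 := (1 + th) ^+ _; rewrite le_eqVlt; apply/orP; left; apply/eqP; ring.
Qed.

Lemma coprime_solve (a b d : int) : 0 < a -> coprimez a b ->
  exists e1 e2 : int, [/\ e1 * a + e2 * b = d, 0 <= e2 < a & `|e1| * a <= `|d| + a * `|b|].
Proof.
move=> a0 /coprimezP[[s t] /= st]; have an0 : a != 0 by lia.
have /dvdzP[e1 e1E] : (a %| d - ((d * t) %% a)%Z * b)%Z.
  apply/dvdzP; exists (d * s + ((d * t) %/ a)%Z * b).
  have := divz_eq (d * t) a; set r := ((d * t) %% a)%Z; set q := ((d * t) %/ a)%Z => h.
  have -> : r = d * t - q * a by rewrite h addrC addKr.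
  by rewrite -[X in X - _ = _]mulr1 -st; ring.
have r0 : 0 <= ((d * t) %% a)%Z by exact: modz_ge0.
have ra : ((d * t) %% a)%Z < a by exact: ltz_pmod.
exists e1, ((d * t) %% a)%Z; split; first by rewrite -e1E subrK.
  by rewrite r0.
rewrite -[X in _ * X <= _](gtr0_norm a0) -normrM -e1E.
apply: le_trans (ler_normB _ _) _; rewrite lerD2l normrM (ger0_norm r0).
by apply: ler_wpM2r => //; exact: ltW.
Qed.

Lemma pair_dot_block_le A m k j (x : tup j m) (a : block A m) :
  `|pair_dot (bval a) (pows k x)| <= (2 * m * A * 2 ^ (k * j))%N%:Z.
Proof.
apply: le_trans (ler_norm_sum _ _ _) _.
apply: (@le_trans _ _ (\sum_(i < m) (2 * A * 2 ^ (k * j))%N%:Z)); last first.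
  rewrite sumr_const card_ord -[X in X <= _]mulr_natl natz -PoszM lez_nat.
  by apply: eq_leq; ring.
apply: ler_sum => i _; apply: le_trans (ler_normD _ _) _; rewrite !normrM.
have [/andP[u0 uU] /andP[v0 vU]] := pows_bound k x i.
rewrite (ger0_norm u0) (ger0_norm v0) (_ : 2 * A * _ = A * 2 ^ (k * j) + A * 2 ^ (k * j))%N; last by ring.
by rewrite PoszD PoszM; apply: lerD; apply: ler_pM => //; exact: coef_bound.
Qed.

Lemma abs_divz_le (t H : int) (L : nat) : 0 < H -> `|t| <= L%:Z * H -> (`|(t %/ H)%Z| <= L)%N.
Proof.
move=> H0 tL; have Hn0 : H != 0 by lia.
have h1 : (t %/ H)%Z * H <= t by exact: lez_floor.
have h2 : t < ((t %/ H)%Z + 1) * H by exact: ltz_ceil.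
move: tL h1 h2; rewrite ler_norml => /andP[t1 t2]; move: (t %/ H)%Z => q h1 h2.
have : q <= L%:Z by rewrite -(ler_pM2r H0) (le_trans h1).
have : - L%:Z < q + 1 by rewrite -(ltr_pM2r H0) mulNr (le_lt_trans t1).
lia.
Qed.

(** Distinct primes have coprime powers, so the pair [i0] alone realises every shift. The factor
    [8 ^ k] compares [U] with the smallest possible [k]-th power. *)
Lemma tup_single_count A m k j K w Lc cc (x : tup j m) i0 :
    (18 <= j)%N -> (0 < K)%N -> (4 * m * K <= Lc)%N ->
    let U := (2 ^ (k * j))%N in let H := (A * U %/ K)%N in
    let E := (8 ^ k * (A %/ K + 1 + U))%N in
    (0 < H)%N -> (E <= A)%N -> net_spec H%:Z (w`!)%:Z Lc cc -> (x i0).1 != (x i0).2 ->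
  ((2 * A + 1) ^ (2 * m.-1) * (2 * (A - E) + 1) ^ 2 <=
   (H %/ w`!).+1 * #|net_hits A k H%:Z (w`!)%:Z Lc cc x|)%N.
Proof.
move=> j18 K0 KL U H E H0 EA hcc x12.
have -> : ((H %/ w`!) = `|(H%:Z %/ (w`!)%:Z)%Z|)%N by rewrite divz_nat.
have U0 : (0 < U)%N by rewrite expn_gt0.
have AUH : (A * U <= 2 * K * H)%N.
  have : (A * U < H.+1 * K)%N by rewrite -ltn_divLR.
  by move: (A * U)%N H0 K0; move: (H) => h a; nia.
apply: (@net_single_count A m E Lc H%:Z (w`!)%:Z cc (pows k x) i0) => //.
- by rewrite ltz_nat fact_gt0.
- move=> d _ dH.
  set p := (pows k x i0).1; set q := (pows k x i0).2.
  have [/andP[p0 pU] /andP[q0 qU]] := pows_bound k x i0.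
  have cpq : coprimez p q.
    rewrite /coprimez /gcdz /p /q /pows /= eqz_nat -/(coprime _ _).
    rewrite coprimeXl // coprimeXr // prime_coprime ?pval_prime //.
    by rewrite dvdn_prime2 ?pval_prime // (inj_eq (@pval_inj j)).
  have p_gt0 : 0 < p by rewrite /p /pows /= ltz_nat expn_gt0 prime_gt0 ?pval_prime.
  have [e1 [e2 [e12 /andP[e20 e2p] e1p]]] := coprime_solve d p_gt0 cpq.
  exists (e1, e2); split => //=; last first.
    rewrite ger0_norm //; apply: le_trans (ltW e2p) _; apply: le_trans pU _.
    rewrite lez_nat /E; apply: (@leq_trans (1 * U)); first by rewrite mul1n.
    by rewrite leq_mul ?expn_gt0 // leq_addl.
  have pE : (U <= 8 ^ k * `|p|)%N.
    rewrite /p /pows /= -expnMn /U mulnC expnM leq_expn2r //.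
    apply: leq_trans (leq_mul (leqnn 8) (ltnW (pval_gt (x i0).1))).
    by rewrite -[8%N]/(2 ^ 3)%N -expnD leq_exp2l //; lia.
  have t1 : (`|e1| * `|p| <= H + U * U)%N.
    have {}e1p : (`|e1| * `|p| <= `|d| + `|p| * `|q|)%N.
      by rewrite -lez_nat PoszM PoszD PoszM !abszE (gtr0_norm p_gt0).
    apply: leq_trans e1p _; apply: leq_add; first by rewrite -lez_nat abszE.
    by apply: leq_mul; rewrite -lez_nat abszE ger0_norm.
  have t2 : (`|e1| * U <= 8 ^ k * (H + U * U))%N.
    apply: leq_trans (leq_mul (leqnn _) pE) _; rewrite mulnCA leq_mul //.
  rewrite -abszE lez_nat -(leq_pmul2r U0); apply: leq_trans t2 _; rewrite /E -mulnA leq_mul //.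
  rewrite mulnDl leq_add2r /H -[X in (_ <= X)%N](mulnK _ K0) leq_div2r //.
  rewrite mulnAC leq_mul2r; apply/orP; right.
  by rewrite addn1 ltnW // ltn_ceil.
- move=> a; apply: abs_divz_le => //; apply: le_trans (pair_dot_block_le k x a) _.
  rewrite -PoszM lez_nat -/U -mulnA; apply: leq_trans (leq_mul (leqnn _) AUH) _.
  by rewrite (_ : 2 * m * (2 * K * H) = 4 * m * K * H)%N ?leq_mul //; ring.
Qed.

(** * Cauchy-Schwarz and the two moments *)

Lemma cauchy_schwarz_nat (T : finType) (S : {set T}) (f : T -> nat) :
  ((\sum_(a in S) f a) ^ 2 <= #|S| * \sum_(a in S) f a ^ 2)%N.
Proof.
rewrite -(leq_pmul2l (ltn0Sn 1)) -mulnn big_distrlr /= big_distrr /=.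
apply: (@leq_trans (\sum_(a in S) \sum_(b in S) (f a ^ 2 + f b ^ 2))%N).
  by apply: leq_sum => a _; rewrite big_distrr; apply: leq_sum => b _; exact: nat_Cauchy.
under eq_bigr => a _ do rewrite big_split /= sum_nat_const.
by rewrite big_split /= sum_nat_const -big_distrr /= mul2n -addnn.
Qed.

(** Cauchy-Schwarz for the number of [x] whose set contains a given [a], a function supported on the
    union. *)
Lemma second_moment_cover (A X : finType) (h : X -> {set A}) :
  ((\sum_x #|h x|) ^ 2 <= #|\bigcup_x h x| * \sum_(z : X * X) #|h z.1 :&: h z.2|)%N.
Proof.
pose f a := #|[set x | a \in h x]|.
set S := \bigcup_x h x.
have fE a : f a = (\sum_x (a \in h x))%N.
  by rewrite /f -sum1_card big_mkcond /=; apply: eq_bigr => x _; rewrite inE; case: (_ \in _).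
have cE (B : {set A}) : B \subset S -> #|B| = (\sum_(a in S) (a \in B))%N.
  move=> BS; rewrite -sum1_card big_mkcond [RHS]big_mkcond /=; apply: eq_bigr => a _.
  by have [aB|aB] := boolP (a \in B); [rewrite (subsetP BS)|case: ifP].
have hS x : h x \subset S by exact: bigcup_sup.
have -> : (\sum_x #|h x| = \sum_(a in S) f a)%N.
  transitivity (\sum_x \sum_(a in S) (a \in h x))%N.
    by apply: eq_bigr => x _; apply: cE.
  by rewrite exchange_big /=; apply: eq_bigr => a _; rewrite fE.
have -> : (\sum_(z : X * X) #|h z.1 :&: h z.2| = \sum_(a in S) f a ^ 2)%N.
  transitivity (\sum_(z : X * X) \sum_(a in S) (a \in h z.1 :&: h z.2))%N.
    by apply: eq_bigr => z _; apply: cE; rewrite subIset ?hS.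
  rewrite exchange_big /=; apply: eq_bigr => a _.
  rewrite fE -mulnn big_distrlr /= pair_big /=; apply: eq_bigr => -[x y] _ /=.
  by rewrite inE mulnb.
exact: cauchy_schwarz_nat.
Qed.

Lemma card_tup_diag j m (i0 : 'I_m) :
  (#|[set x : tup j m | (x i0).1 == (x i0).2]| * #|pool j| <= #|tup j m|)%N.
Proof.
pose f (z : tup j m * pool j) : tup j m := [ffun i => if i == i0 then ((z.1 i0).1, z.2) else z.1 i].
rewrite -cardsT -cardsX -(card_in_imset (f := f)) ?max_card //.
move=> [x p] [y q]; rewrite !inE /= !andbT => /eqP xd /eqP yd /ffunP e.
have := e i0; rewrite !ffunE eqxx => -[e1 e2]; congr (_, _) => //.
apply/ffunP => i; have [->|ii] := eqVneq i i0.
  by rewrite [x i0]surjective_pairing [y i0]surjective_pairing -xd -yd e1.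
by have := e i; rewrite !ffunE (negbTE ii).
Qed.

(** The factor [1 - 6 dl] is a lower bound for [(1 - dl) (1 - 2 dl)^2 / (1 + dl)], which accounts
    for the tuples with equal primes in the pair [i0], the two shortened ranges in that pair, and
    the rounding of [H / M]. *)
Lemma first_moment (R : realFieldType) A m k j K w Lc cc (i0 : 'I_m) (dl : R) :
    (18 <= j)%N -> (0 < K)%N -> (4 * m * K <= Lc)%N ->
    let U := (2 ^ (k * j))%N in let H := (A * U %/ K)%N in
    let E := (8 ^ k * (A %/ K + 1 + U))%N in let B := (2 * A + 1)%N in
    (0 < H)%N -> (E <= A)%N -> net_spec H%:Z (w`!)%:Z Lc cc ->
    0 < dl <= 1 / 10 -> E%:R <= dl * B%:R -> 1 <= dl * #|pool j|%:R ->
    (w`!)%:R <= dl * H%:R ->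
  (B ^ (2 * m))%:R * #|tup j m|%:R * (w`!)%:R * (1 - 6 * dl) <=
  H%:R * (\sum_(x : tup j m) #|net_hits A k H%:Z (w`!)%:Z Lc cc x|)%N%:R.
Proof.
move=> j18 K0 KL U H E B H0 EA hcc /andP[dl0 dl1] EB Ndl MH.
set M := w`!; set h := net_hits A k H%:Z (w`!)%:Z Lc cc.
pose good := [pred x : tup j m | (x i0).1 != (x i0).2].
have M0 : (0 : R) < M%:R by rewrite ltr0n fact_gt0.
have H0' : (0 : R) < H%:R by rewrite ltr0n.
have B0 : (0 : R) < B%:R by rewrite ltr0n /B addn1.
have m0 : (0 < m)%N by apply: leq_ltn_trans (ltn_ord i0).
have per x : good x -> (B ^ (2 * m))%:R * M%:R * (1 - 2 * dl) ^+ 2 <= (1 + dl) * H%:R * #|h x|%:R.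
  move=> gx; have := @tup_single_count A m k j K w Lc cc x i0 j18 K0 KL H0 EA hcc gx.
  rewrite -/h => c1.
  have c2 : B%:R * (1 - 2 * dl) <= (2 * (A - E) + 1)%:R :> R.
    have -> : (2 * (A - E) + 1)%:R = B%:R - 2 * E%:R :> R.
      by rewrite /B natrD natrM (natrB _ EA) [(2 * A + 1)%:R]natrD natrM; ring.
    by rewrite mulrBr mulr1 lerD2l lerN2 mulrCA ler_wpM2l // mulrC.
  have c3 : (H %/ M).+1%:R * M%:R <= (1 + dl) * H%:R :> R.
    rewrite mulrDl mul1r -natrM mulSn natrD addrC; apply: lerD => //.
    by rewrite ler_nat leq_trunc_div.
  have d0 : 0 <= B%:R * (1 - 2 * dl) by rewrite mulr_ge0 ?ler0n //; lra.
  have -> : (2 * m = 2 * m.-1 + 2)%N by rewrite -{1}(prednK m0) mulnS addnC.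
  rewrite expnD natrM [(B ^ 2)%:R]natrX.
  apply: (@le_trans _ _ (((B ^ (2 * m.-1) * (2 * (A - E) + 1) ^ 2)%:R) * M%:R)).
    rewrite natrM [((_ + 1) ^ 2)%:R]natrX.
    have -> : (B ^ (2 * m.-1))%:R * B%:R ^+ 2 * M%:R * (1 - 2 * dl) ^+ 2 =
      (B ^ (2 * m.-1))%:R * (B%:R * (1 - 2 * dl)) ^+ 2 * M%:R by ring.
    apply: ler_wpM2r; first exact: ltW.
    by apply: ler_wpM2l; rewrite ?ler0n // lerXn2r // nnegrE ?ler0n.
  apply: (@le_trans _ _ (((H %/ M).+1 * #|h x|)%:R * M%:R)).
    by apply: ler_wpM2r; rewrite ?ler_nat ?ltW.
  by rewrite natrM mulrAC; apply: ler_wpM2r; rewrite ?ler0n.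
have cgood : (1 - dl) * #|tup j m|%:R <= #|good|%:R :> R.
  have := cardC good; rewrite (_ : #|predC good| = #|[set x : tup j m | (x i0).1 == (x i0).2]|); last first.
    by apply: eq_card => x; rewrite !inE negbK.
  set b := #|[set x | _]| => gb.
  have := card_tup_diag j i0; rewrite -/b => bN.
  have b1 : b%:R <= dl * #|tup j m|%:R :> R.
    apply: (@le_trans _ _ (b%:R * (dl * #|pool j|%:R))).
      by rewrite -[X in X <= _]mulr1 ler_wpM2l ?ler0n.
    by rewrite mulrCA ler_wpM2l ?(ltW dl0) // -natrM ler_nat.
  by move: b1; rewrite -gb natrD; lra.
have sum_ge : (1 - dl) * #|tup j m|%:R * ((B ^ (2 * m))%:R * M%:R * (1 - 2 * dl) ^+ 2) <=
    (1 + dl) * H%:R * (\sum_x #|h x|)%N%:R.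
  apply: (@le_trans _ _ (\sum_(x | good x) ((B ^ (2 * m))%:R * M%:R * (1 - 2 * dl) ^+ 2))).
    rewrite sumr_const -[X in _ <= X]mulr_natl; apply: ler_wpM2r => //.
    by apply: mulr_ge0; [apply: mulr_ge0; rewrite ler0n|apply: exprn_ge0; lra].
  apply: (@le_trans _ _ (\sum_(x | good x) (1 + dl) * H%:R * #|h x|%:R)).
    by apply: ler_sum.
  rewrite -mulr_sumr; apply: ler_wpM2l; first by rewrite mulr_ge0 ?ler0n //; lra.
  by rewrite natr_sum [X in _ <= X](bigID good) /= lerDl sumr_ge0 // => x _; rewrite ler0n.
set a := (B ^ (2 * m))%:R in sum_ge *; set t := #|tup j m|%:R in sum_ge *.
set s := (\sum_x _)%N%:R in sum_ge *.
have a0 : 0 <= a * t * M%:R by rewrite /a /t -!natrM ler0n.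
have q0 : 0 < 1 + dl by lra.
rewrite -(ler_pM2l q0); apply: le_trans (_ : (1 - dl) * t * (a * M%:R * (1 - 2 * dl) ^+ 2) <= _); last by rewrite [X in _ <= X]mulrA.
have -> : (1 - dl) * t * (a * M%:R * (1 - 2 * dl) ^+ 2) = a * t * M%:R * ((1 - dl) * (1 - 2 * dl) ^+ 2) by ring.
rewrite mulrCA; apply: ler_wpM2l => //; nra.
Qed.

(** If [g <= w] and [Y <= y0], the loss is close to 1. Otherwise it is charged to sixth moments:
    [Y ^ 2 <= Y ^ 6 / y0] when [Y > y0], and [w g ^ 2 Y ^ 2 <= g ^ 3 Y ^ 2 <= g ^ 6 + Y ^ 6] when
    [g > w]. The prefactors [1 / w] and [1 / y0] make these terms small. *)
Lemma loss_le (R : realFieldType) (g Y w y0 : nat) (K th dl : R) :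
    (0 < Y)%N -> (0 < w)%N -> (0 < y0)%N -> 4 <= K -> 0 < th -> th <= dl -> dl <= 1 / 10 ->
    4 * y0%:R <= dl * K ->
  ((if (g <= w)%N then 1%N else g)%:R * (1 + 4 * Y%:R / K + th)) ^+ 2 <=
    (1 + 2 * dl) ^+ 2 + 9 / w%:R * (g%:R ^+ 6 + Y%:R ^+ 6) + 9 / y0%:R * Y%:R ^+ 6 :> R.
Proof.
move=> Y0 w0 y00 K4 th0 thdl dl1 yK.
have Y1 : (1 : R) <= Y%:R by rewrite ler1n.
have w0' : (0 : R) < w%:R by rewrite ltr0n.
have y0' : (0 : R) < y0%:R by rewrite ltr0n.
have K0 : 0 < K by lra.
have Yp n : 0 <= (Y%:R ^+ n : R) by rewrite exprn_ge0 // ler0n.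
have gp n : 0 <= (g%:R ^+ n : R) by rewrite exprn_ge0 // ler0n.
have t1 : 0 <= 9 / w%:R * (g%:R ^+ 6 + Y%:R ^+ 6) :> R.
  by rewrite mulr_ge0 ?addr_ge0 // divr_ge0 // ltW.
have t2 : 0 <= 9 / y0%:R * Y%:R ^+ 6 :> R by rewrite mulr_ge0 // divr_ge0 // ltW.
have t3 : 0 <= (1 + 2 * dl) ^+ 2 by rewrite sqr_ge0.
set L := 1 + 4 * Y%:R / K + th.
have YK : 4 * Y%:R / K <= Y%:R by rewrite ler_pdivrMr // mulrC ler_wpM2l // ler0n.
have YK0 : 0 <= 4 * Y%:R / K by rewrite divr_ge0 ?mulr_ge0 ?ler0n // ltW.
have L0 : 0 <= L by rewrite /L; lra.
have L3 : L <= 3 * Y%:R by rewrite /L; lra.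
have L9 : L ^+ 2 <= 9 * Y%:R ^+ 2.
  have -> : 9 * Y%:R ^+ 2 = (3 * Y%:R) ^+ 2 :> R by ring.
  by rewrite lerXn2r // nnegrE // (le_trans L0).
have [gw|gw] := leqP g w.
  rewrite mul1r; have [Yy|Yy] := leqP Y y0.
    have : L ^+ 2 <= (1 + 2 * dl) ^+ 2.
      rewrite lerXn2r // ?nnegrE //; first by lra.
      have : 4 * Y%:R / K <= dl.
        rewrite ler_pdivrMr //; apply: le_trans yK; rewrite ler_wpM2l // ler_nat //.
      by rewrite /L; lra.
    lra.
  have : 9 * Y%:R ^+ 2 <= 9 / y0%:R * Y%:R ^+ 6 :> R.
    rewrite -mulrA ler_wpM2l // [_^-1 * _]mulrC ler_pdivlMr //.
    apply: (@le_trans _ _ (Y%:R ^+ 3)); last by rewrite ler_weXn2l.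
    by rewrite [Y%:R ^+ 3]exprSr ler_wpM2l // ler_nat ltnW.
  lra.
have : (g%:R * L) ^+ 2 <= 9 / w%:R * (g%:R ^+ 6 + Y%:R ^+ 6).
  rewrite exprMn; apply: (@le_trans _ _ (g%:R ^+ 2 * (9 * Y%:R ^+ 2))).
    by rewrite ler_wpM2l.
  have -> : g%:R ^+ 2 * (9 * Y%:R ^+ 2) = 9 * (g%:R ^+ 2 * Y%:R ^+ 2) :> R by ring.
  rewrite -[9 / _ * _]mulrA ler_wpM2l // [_^-1 * _]mulrC ler_pdivlMr //.
  have g1 : (1 : R) <= g%:R by rewrite ler1n (leq_trans _ gw).
  apply: (@le_trans _ _ (g%:R ^+ 3 * Y%:R ^+ 2)).
    rewrite mulrC mulrA [g%:R ^+ 3]exprS mulrC [X in _ <= X]mulrC.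
    by rewrite ler_wpM2l // ler_wpM2r // ler_nat ltnW.
  have h : 0 <= (g%:R ^+ 3 - Y%:R ^+ 2) ^+ 2 :> R by rewrite sqr_ge0.
  have Y46 : Y%:R ^+ 4 <= Y%:R ^+ 6 :> R by rewrite ler_weXn2l.
  have e : (g%:R ^+ 3 - Y%:R ^+ 2) ^+ 2 = g%:R ^+ 6 + Y%:R ^+ 4 - 2 * (g%:R ^+ 3 * Y%:R ^+ 2) :> R by ring.
  have p0 : 0 <= g%:R ^+ 3 * Y%:R ^+ 2 :> R by rewrite mulr_ge0.
  rewrite e in h; lra.
lra.
Qed.

(** Pairs of tuples with a nonzero minor give the main term, their losses being summed by the
    moments. Degenerate pairs have only the trivial bound, but their proportion is [O(U ^ -16)], as
    [U ^ 16] is the eighth power of the maximal order of a minor. *)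
Lemma second_moment (R : realFieldType) A m k j K w Lc cc (i0 : 'I_m) (th dl : R) (y0 V : nat) :
    (0 < k)%N ->
    let U := (2 ^ (k * j))%N in let H := (A * U %/ K)%N in let B := (2 * A + 1)%N in
    let T := #|tup j m| in
    (4 <= K)%N -> (0 < w)%N -> (0 < y0)%N ->
    0 < th -> th <= dl -> dl <= 1 / 10 ->
    (2 * U ^ 2)%:R <= th * B%:R -> (8 * m * U ^ 2)%:R <= th * B%:R ->
    (U ^ 2 * w`!)%:R <= th * H%:R ->
    (1 + th) ^+ (2 * m.-1) <= (1 + dl) * (1 - th) ^+ 2 ->
    4 * y0%:R <= dl * K%:R ->
    \sum_(z : tup j m * tup j m | mdet k z.1 z.2 != 0%N) ((gdet k z.1 z.2)%:R ^+ 6 : R) <= 2 * V%:R ->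
    \sum_(z : tup j m * tup j m | mdet k z.1 z.2 != 0%N) ((spread k z.1 z.2)%:R ^+ 6 : R) <= 2 * V%:R ->
    (#|[set z : tup j m * tup j m | mdet k z.1 z.2 == 0%N]| * U ^ 16 <= V)%N ->
    36 * V%:R <= dl * w%:R * T%:R ^+ 2 -> 18 * V%:R <= dl * y0%:R * T%:R ^+ 2 ->
    (V * (2 * Lc + 1) * H ^ 2)%:R <= dl * (B * U ^ 16 * T ^ 2)%:R ->
  H%:R ^+ 2 * (\sum_(z : tup j m * tup j m)
      #|net_hits A k H%:Z (w`!)%:Z Lc cc z.1 :&: net_hits A k H%:Z (w`!)%:Z Lc cc z.2|)%N%:R <=
  (B ^ (2 * m))%:R * (w`!)%:R ^+ 2 * T%:R ^+ 2 * (1 + 12 * dl).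
Proof.
move=> k0 U H B T K4 w0 y00 th0 thdl dl1 U2B mU2B MH thm yK mg mY par wV yV parV.
set M := w`!; set h := net_hits A k H%:Z M%:Z Lc cc; set al : R := (B ^ (2 * m))%:R.
have m0 : (0 < m)%N by apply: leq_ltn_trans (ltn_ord i0).
have K0 : (0 < K)%N by apply: leq_trans K4.
have K4' : (4 : R) <= K%:R by rewrite ler_nat.
have U0 : (0 < U)%N by rewrite expn_gt0.
have B0 : (0 < B)%N by rewrite /B addn1.
have M1 : (1 : R) <= M%:R by rewrite ler1n fact_gt0.
have al0 : 0 <= al :> R by rewrite ler0n.
have th1 : 0 < 1 - th by lra.
have TT : (\sum_(z : tup j m * tup j m | mdet k z.1 z.2 != 0%N) (1 : R)) <= T%:R ^+ 2.
  rewrite sumr_const -natrX ler_nat -mulnn -card_prod; exact: max_card.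
rewrite natr_sum mulr_sumr (bigID (fun z => mdet k z.1 z.2 != 0%N)) /=.
have part1 : \sum_(z : tup j m * tup j m | mdet k z.1 z.2 != 0%N) H%:R ^+ 2 * #|h z.1 :&: h z.2|%:R <=
    al * M%:R ^+ 2 * T%:R ^+ 2 * ((1 + dl) * ((1 + 2 * dl) ^+ 2 + 2 * dl)).
  pose lossz (z : tup j m * tup j m) : R := (1 + 2 * dl) ^+ 2 +
    9 / w%:R * ((gdet k z.1 z.2)%:R ^+ 6 + (spread k z.1 z.2)%:R ^+ 6) +
    9 / y0%:R * (spread k z.1 z.2)%:R ^+ 6.
  have le1 z : mdet k z.1 z.2 != 0%N ->
      H%:R ^+ 2 * #|h z.1 :&: h z.2|%:R <= al * M%:R ^+ 2 * (1 + dl) * lossz z.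
    move=> zn0; have th01 : 0 < th < 1 by rewrite th0; lra.
    have := @tup_pair_ratio R A m k j K w Lc cc z.1 z.2 th m0 K0 zn0 th01 U2B mU2B MH.
    rewrite -/h => pr.
    have /andP[Y0 _] := spread_bound zn0.
    have ll := @loss_le R (gdet k z.1 z.2) _ w y0 K%:R th dl Y0 w0 y00 K4' th0 thdl dl1 yK.
    rewrite -/(excess k w z.1 z.2) -/(lossz z) in ll.
    have th2 : 0 < (1 - th) ^+ 2 by rewrite exprn_gt0.
    rewrite -(ler_pM2r th2); move: pr.
    rewrite [#|_|%:R * H%:R ^+ 2]mulrC => /le_trans; apply.
    have P0 : 0 <= al * M%:R ^+ 2 by rewrite mulr_ge0 // exprn_ge0 // ler0n.
    have P1 : 0 <= (1 + th) ^+ (2 * m.-1) by rewrite exprn_ge0 // addr_ge0 // ltW.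
    have main := ler_pM P1 (sqr_ge0 _) thm ll.
    have -> : al * M%:R ^+ 2 * (1 + dl) * lossz z * (1 - th) ^+ 2 =
      al * M%:R ^+ 2 * ((1 + dl) * (1 - th) ^+ 2 * lossz z) by ring.
    by rewrite -[X in X <= _]mulrA; exact: ler_wpM2l main.
  apply: le_trans (ler_sum _ le1) _; rewrite -mulr_sumr.
  have -> : al * M%:R ^+ 2 * T%:R ^+ 2 * ((1 + dl) * ((1 + 2 * dl) ^+ 2 + 2 * dl)) =
    al * M%:R ^+ 2 * (1 + dl) * (T%:R ^+ 2 * ((1 + 2 * dl) ^+ 2 + 2 * dl)) by ring.
  apply: ler_wpM2l.
    rewrite mulr_ge0 ?mulr_ge0 ?exprn_ge0 ?ler0n // addr_ge0 //.
    exact: le_trans (ltW th0) thdl.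
  have w0' : (0 : R) < w%:R by rewrite ltr0n.
  have y0' : (0 : R) < y0%:R by rewrite ltr0n.
  have c1 : \sum_(z : tup j m * tup j m | mdet k z.1 z.2 != 0%N) (1 + 2 * dl) ^+ 2 <= T%:R ^+ 2 * (1 + 2 * dl) ^+ 2.
    rewrite -[X in \sum_(_ | _) X]mul1r -mulr_suml; apply: ler_wpM2r => //; exact: sqr_ge0.
  have c2 : 9 / w%:R * (4 * V%:R) <= T%:R ^+ 2 * dl.
    rewrite mulrAC ler_pdivrMr //; move: wV; rewrite (_ : 9 * _ = 36 * V%:R); last by ring.
    by move/le_trans; apply; rewrite le_eqVlt; apply/orP; left; apply/eqP; ring.
  have c3 : 9 / y0%:R * (2 * V%:R) <= T%:R ^+ 2 * dl.
    rewrite mulrAC ler_pdivrMr //; move: yV; rewrite (_ : 9 * _ = 18 * V%:R); last by ring.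
    by move/le_trans; apply; rewrite le_eqVlt; apply/orP; left; apply/eqP; ring.
  have d1 : 0 <= 9 / w%:R :> R by rewrite divr_ge0 // ltW.
  have d2 : 0 <= 9 / y0%:R :> R by rewrite divr_ge0 // ltW.
  have e1 := ler_wpM2l d1 (lerD mg mY).
  have e2 := ler_wpM2l d2 mY.
  have e3 : 9 / w%:R * (2 * V%:R + 2 * V%:R) = 9 / w%:R * (4 * V%:R) :> R by ring.
  rewrite e3 in e1.
  move: c1; rewrite /lossz; move: ((1 + 2 * dl) ^+ 2) => q2 c1.
  rewrite !big_split /= -!mulr_sumr big_split /=.
  apply: le_trans (lerD (lerD c1 (le_trans e1 c2)) (le_trans e2 c3)) _.
  by rewrite le_eqVlt; apply/orP; left; apply/eqP; ring.
have part2 : \sum_(z : tup j m * tup j m | ~~ (mdet k z.1 z.2 != 0%N)) H%:R ^+ 2 * #|h z.1 :&: h z.2|%:R <=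
    al * M%:R ^+ 2 * T%:R ^+ 2 * dl.
  set D := #|[set z : tup j m * tup j m | mdet k z.1 z.2 == 0%N]| in par.
  have le2 z : #|h z.1 :&: h z.2|%:R * B%:R <= (2 * Lc + 1)%:R * M%:R * al :> R.
    rewrite -!natrM ler_nat.
    have u0 : (pows k z.1 i0).1 != 0.
      by rewrite /pows /= eqz_nat -lt0n expn_gt0 prime_gt0 ?pval_prime.
    have := @net_trivial_count A m Lc M H%:Z cc (pows k z.1) i0 (fact_gt0 w) u0.
    rewrite -/B; apply: leq_trans; rewrite leq_mul2r; apply/orP; right.
    by apply: subset_leq_card; apply: subsetIl.
  have B0' : (0 : R) < B%:R by rewrite ltr0n.
  have U16 : (0 : R) < (U ^ 16)%:R by rewrite ltr0n expn_gt0 U0.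
  have sum2 : (\sum_(z : tup j m * tup j m | ~~ (mdet k z.1 z.2 != 0%N)) H%:R ^+ 2 * #|h z.1 :&: h z.2|%:R) * B%:R <=
      D%:R * (H%:R ^+ 2 * ((2 * Lc + 1)%:R * M%:R * al)) :> R.
    rewrite mulr_suml; apply: (@le_trans _ _ (\sum_(z : tup j m * tup j m | ~~ (mdet k z.1 z.2 != 0%N)) (H%:R ^+ 2 * ((2 * Lc + 1)%:R * M%:R * al)))).
      by apply: ler_sum => z _; rewrite -mulrA; apply: ler_wpM2l => //; rewrite exprn_ge0 // ler0n.
    rewrite sumr_const -[X in X <= _]mulr_natl; apply: ler_wpM2r.
      by rewrite mulr_ge0 ?mulr_ge0 ?exprn_ge0 ?ler0n.
    by rewrite ler_nat; apply: subset_leq_card; apply/subsetP => z zP; rewrite in_set; move: zP; rewrite unfold_in negbK.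
  have BU0 : (0 : R) < B%:R * (U ^ 16)%:R by rewrite mulr_gt0.
  rewrite -(ler_pM2r BU0) mulrA.
  apply: (@le_trans _ _ ((D * U ^ 16)%:R * (H%:R ^+ 2 * ((2 * Lc + 1)%:R * M%:R * al)))).
    rewrite (natrM _ D) [D%:R * _ * _]mulrAC.
    by apply: ler_wpM2r => //; exact: ltW.
  apply: (@le_trans _ _ (V%:R * (H%:R ^+ 2 * ((2 * Lc + 1)%:R * M%:R * al)))).
    by rewrite ler_wpM2r ?ler_nat // mulr_ge0 ?mulr_ge0 ?exprn_ge0 ?ler0n.
  have -> : V%:R * (H%:R ^+ 2 * ((2 * Lc + 1)%:R * M%:R * al)) =
     M%:R * al * (V * (2 * Lc + 1) * H ^ 2)%:R :> R.
    by rewrite (natrM _ _ (H ^ 2)) natrM natrX; ring.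
  apply: (@le_trans _ _ (M%:R * al * (dl * (B * U ^ 16 * T ^ 2)%:R))).
    by apply: ler_wpM2l => //; rewrite mulr_ge0 ?ler0n.
  have -> : al * M%:R ^+ 2 * T%:R ^+ 2 * dl * (B%:R * (U ^ 16)%:R) =
    M%:R * (M%:R * al * (dl * (B * U ^ 16 * T ^ 2)%:R)) :> R.
    by rewrite (natrM _ _ (T ^ 2)) natrM (natrX _ T); ring.
  rewrite -[X in X <= _]mul1r; apply: ler_wpM2r => //.
  by rewrite !mulr_ge0 ?ler0n //; lra.
apply: le_trans (lerD part1 part2) _; rewrite -mulrDr; apply: ler_wpM2l.
  by rewrite !mulr_ge0 ?exprn_ge0 ?ler0n.
nra.
Qed.

Lemma exprD1_le (R : realFieldType) (t : R) n : 0 <= t <= 1 -> (1 + t) ^+ n <= 1 + 2 ^+ n * t.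
Proof.
move=> /andP[t0 t1]; suff : (1 + t) ^+ n <= 1 + (2 ^+ n - 1) * t by lra.
elim: n => [|n IHn]; first by rewrite !expr0; lra.
rewrite !exprS; apply: (@le_trans _ _ ((1 + t) * (1 + (2 ^+ n - 1) * t))).
  by apply: ler_wpM2l => //; lra.
have : 1 <= (2 : R) ^+ n by rewrite exprn_ege1 //; lra.
move: (2 ^+ n) => c c1.
have : (c - 1) * (t * t) <= (c - 1) * t by apply: ler_wpM2l; [lra|rewrite ler_piMr].
lra.
Qed.

(** The constant 24 comes from [(1 - 6 dl)^2 >= (1 - 24 dl) (1 + 12 dl)]. *)
Lemma moments_cover (R : realFieldType) (al S s z t M H : R) (dl : R) :
    0 < al -> 0 < t -> 0 < M -> 0 <= S -> 0 < dl -> dl <= 1 / 24 ->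
    s ^+ 2 <= S * z -> al * t * M * (1 - 6 * dl) <= H * s ->
    H ^+ 2 * z <= al * M ^+ 2 * t ^+ 2 * (1 + 12 * dl) ->
  al * (1 - 24 * dl) <= S.
Proof.
move=> al0 t0 M0 S0 dl0 dl1 cs m1 m2.
have p0 : 0 < al * M ^+ 2 * t ^+ 2 by rewrite !mulr_gt0 ?exprn_gt0.
have q0 : 0 <= al * t * M * (1 - 6 * dl) by rewrite !mulr_ge0 ?ltW //; lra.
have h1 : (al * t * M * (1 - 6 * dl)) ^+ 2 <= (H * s) ^+ 2.
  by rewrite lerXn2r // nnegrE // (le_trans q0).
have h2 : (H * s) ^+ 2 <= S * (H ^+ 2 * z).
  by rewrite exprMn [X in _ <= X]mulrCA; apply: ler_wpM2l => //; exact: sqr_ge0.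
have h3 : S * (H ^+ 2 * z) <= S * (al * M ^+ 2 * t ^+ 2 * (1 + 12 * dl)) by exact: ler_wpM2l.
have h4 : (al * M ^+ 2 * t ^+ 2) * (al * (1 - 6 * dl) ^+ 2) <= (al * M ^+ 2 * t ^+ 2) * (S * (1 + 12 * dl)).
  have -> : (al * M ^+ 2 * t ^+ 2) * (al * (1 - 6 * dl) ^+ 2) = (al * t * M * (1 - 6 * dl)) ^+ 2 by ring.
  have -> : (al * M ^+ 2 * t ^+ 2) * (S * (1 + 12 * dl)) = S * (al * M ^+ 2 * t ^+ 2 * (1 + 12 * dl)) by ring.
  by apply: le_trans h3; apply: le_trans h2.
rewrite (ler_pM2l p0) in h4.
have c0 : 0 < 1 + 12 * dl by lra.
rewrite -(ler_pM2r c0); apply: le_trans h4; rewrite -mulrA; apply: ler_wpM2l; first exact: ltW.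
by have := sqr_ge0 dl; rewrite expr2; lra.
Qed.

Lemma inv_nat_le24 (R : realFieldType) n : (24 <= n)%N ->
  (n%:R^-1 : R) <= 1 / 24 /\ (n%:R^-1 : R) <= 1 / 10.
Proof.
move=> n24; have n24' : 24 <= n%:R :> R by rewrite (ler_nat R 24).
have n1 : (n%:R^-1 : R) <= 1 / 24 by rewrite mul1r lef_pV2 // posrE; lra.
by split => //; lra.
Qed.

Lemma theta_choice (R : realFieldType) (c th dl : R) :
  0 < th -> th <= dl -> dl <= 1 / 10 -> c * th + 4 * th = dl ->
  1 + c * th <= (1 + dl) * (1 - th) ^+ 2.
Proof.
move=> th0 thdl dl1; move: (c * th) => c' cE.
rewrite (_ : (1 + dl) * (1 - th) ^+ 2 = 1 + dl - 2 * th - 2 * (dl * th) + th ^+ 2 + dl * th ^+ 2); last by ring.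
have := sqr_ge0 th; have : 0 <= dl * th ^+ 2 by rewrite mulr_ge0 ?sqr_ge0 //; lra.
have : dl * th <= th by rewrite ler_piMl //; lra.
lra.
Qed.

Theorem block_count_over (R : realFieldType) k D : (0 < k)%N -> (0 < D)%N -> let m := (64 * k)%N in
  exists w K J0 : nat, (4 <= K)%N /\ forall j A cc, (J0 <= j)%N ->
    let U := (2 ^ (k * j))%N in let H := (A * U %/ K)%N in
    (U ^ 4 <= A)%N -> (A <= 2 ^ (4 * k) * U ^ 4)%N ->
    net_spec H%:Z (w`!)%:Z (4 * m * K) cc ->
  (#|~: \bigcup_(x : tup j m) net_hits A k H%:Z (w`!)%:Z (4 * m * K) cc x| * D <=
    (2 * A + 1) ^ (2 * m))%N.
Proof.
move=> k0 D0 m; have [C hC] := det_moments R k0.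
(* With [dl = 1 / n], the final loss [24 dl] equals [1 / D]. *)
have [n nD] : exists n, n = (24 * D)%N by exists (24 * D)%N.
(* Once the moment constant [C] is known, [w] and [y0] push the tails of the gcd and of the spread
   below [dl]; then [K] makes [y0 / K] and the shifts of size [8 ^ k A / K] small. *)
pose w := (36 * C ^ m * n).+1; pose y0 := (18 * C ^ m * n).+1.
pose K := (4 * n * y0 * 8 ^ k)%N; set Lc := (4 * m * K)%N.
(* Here [S = 1 / th]: the term [2 ^ (2m)] pays for expanding the power of [1 + th], and 4 pays for
   the division by [(1 - th)^2]. *)
pose S := (n * (2 ^ (2 * m) + 4))%N; set M := w`!.
pose J0 := (18 + (4 * m + 1) * S + M * S * K + 2 * n * 8 ^ k + n ^ 2 +
  n * C ^ m * (2 * Lc + 1) * 2 ^ (4 * k))%N.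
have n0 : (24 <= n)%N by rewrite nD leq_pmulr.
have m0 : (0 < m)%N by rewrite muln_gt0 k0.
have e8 : (0 < 8 ^ k)%N by rewrite expn_gt0.
have K4 : (4 <= K)%N by rewrite /K -!mulnA leq_pmulr // !muln_gt0 e8 /= !andbT (leq_trans _ n0).
have K0 : (0 < K)%N by apply: leq_trans K4.
have S0 : (n <= S)%N by rewrite /S leq_pmulr // addn_gt0 orbT.
have M0 : (0 < M)%N by exact: fact_gt0.
exists w, K, J0; split => // j A cc jJ U H UA AU hcc.
have jU : (j < U)%N.
  apply: leq_trans (ltn_expl j (ltnSn 1)) _; rewrite /U leq_exp2l // leq_pmull //.
have j18 : (18 <= j)%N by apply: leq_trans jJ; rewrite /J0 -!addnA leq_addr.
have [jS jM jn jn2 jC] : [/\ (4 * m + 1) * S <= j, M * S * K <= j, 2 * n * 8 ^ k <= j,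
    n ^ 2 <= j & n * C ^ m * (2 * Lc + 1) * 2 ^ (4 * k) <= j]%N.
  move: jJ; rewrite /J0; move: ((4 * m + 1) * S)%N (M * S * K)%N (2 * n * 8 ^ k)%N (n ^ 2)%N (n * C ^ m * _ * _)%N.
  by move=> a b c d e; clear; split; lia.
have U0 : (0 < U)%N by rewrite expn_gt0.
pose B := (2 * A + 1)%N; pose T := #|tup j m|; pose N := #|pool j|.
have U1 : (1 <= U)%N by [].
have UU2 : (U <= U ^ 2)%N by rewrite -mulnn leq_pmulr.
have U24 : (U ^ 2 * U ^ 2 <= A)%N by rewrite -expnD.
have A0 : (0 < A)%N by apply: leq_trans UA; rewrite expn_gt0 U0.
have MSKU : (U ^ 2 * M * S <= H)%N.
  rewrite leq_divRL //; apply: (@leq_trans (U ^ 4 * U)); last by rewrite leq_mul2r UA orbT.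
  apply: (@leq_trans (U ^ 2 * U)); last by rewrite leq_mul // leq_pexp2l.
  rewrite (_ : U ^ 2 * M * S * K = U ^ 2 * (M * S * K))%N; last by rewrite !mulnA.
  by rewrite leq_mul // (leq_trans jM) // ltnW.
have SH : (S <= H)%N.
  by apply: leq_trans MSKU; rewrite leq_pmull // muln_gt0 expn_gt0 U0.
have H0 : (0 < H)%N by apply: leq_trans SH; apply: leq_trans S0; apply: leq_trans n0.
pose E := (8 ^ k * (A %/ K + 1 + U))%N.
have E1 : (n * (8 ^ k * (A %/ K)) <= A)%N.
  apply: (@leq_trans (K * (A %/ K))); last by rewrite mulnC leq_trunc_div.
  rewrite mulnA leq_mul2r /K; apply/orP; right.
  rewrite leq_mul2r (_ : 4 * n * y0 = n * (4 * y0))%N ?leq_pmulr ?orbT //.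
  by rewrite mulnCA mulnA.
have E2 : (n * (8 ^ k * (1 + U)) <= A)%N.
  apply: (@leq_trans (2 * n * 8 ^ k * U)); first by move: (8 ^ k)%N U0 {jn} => e; clear -n0; nia.
  apply: leq_trans U24; apply: (@leq_trans (U * U)); last by rewrite leq_mul.
  by rewrite leq_mul2r (leq_trans jn) ?orbT // ltnW.
have nE : (n * E <= B)%N.
  rewrite /E -addnA mulnDr mulnDr /B mul2n -addnn addn1; apply: leq_trans (leqnSn _).
  exact: leq_add.
have EA : (E <= A)%N.
  have := nE; rewrite /B => /(leq_trans (leq_mul n0 (leqnn E))); move: E {nE} => e; clear -A0; lia.
have NB : (n <= N)%N.
  rewrite -leq_sqr; apply: leq_trans (card_pool_ge j18).
  by apply: leq_trans jn2 _; apply: ltnW; apply: ltn_expl.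
have N0 : (0 < N)%N by apply: leq_trans NB; apply: leq_trans n0.
have T0 : (0 < T)%N by rewrite /T card_tup expn_gt0 N0.
set h := net_hits A k H%:Z M%:Z Lc cc.
have i0 : 'I_m by exact: Ordinal m0.
pose dl : R := n%:R^-1; pose th : R := S%:R^-1.
have n0' : (0 : R) < n%:R by rewrite ltr0n (leq_trans _ n0).
have S0' : (0 : R) < S%:R by rewrite ltr0n (leq_trans _ S0) // (leq_trans _ n0).
have dl0 : 0 < dl by rewrite invr_gt0.
have th0 : 0 < th by rewrite invr_gt0.
have thdl : th <= dl by rewrite lef_pV2 ?posrE // ler_nat.
have [dl1 dl2] : dl <= 1 / 24 /\ dl <= 1 / 10 by exact: inv_nat_le24.
have ledl (a b : nat) : (n * a <= b)%N -> a%:R <= dl * b%:R.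
  by move=> ab; rewrite mulrC ler_pdivlMr // -natrM ler_nat mulnC.
have leth (a b : nat) : (S * a <= b)%N -> a%:R <= th * b%:R.
  by move=> ab; rewrite mulrC ler_pdivlMr // -natrM ler_nat mulnC.
have [mg mY par] := hC j j18.
have AB : (A <= B)%N by rewrite /B; clear; lia.
have SU : (S * (4 * m + 1) <= U)%N by rewrite mulnC (leq_trans jS) // ltnW.
have fm := @first_moment R A m k j K w Lc cc i0 dl j18 K0 (leqnn _) H0 EA hcc.
have {}fm := fm (introT andP (conj dl0 dl2)) (ledl _ _ nE).
have {}fm := fm (ledl 1%N N _); rewrite muln1 in fm; have {}fm := fm NB.
have {}fm := fm (ledl M H _).
have MH : (n * M <= H)%N.
  apply: leq_trans MSKU; rewrite mulnC -mulnA mulnA leq_mul //.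
  by rewrite leq_pmull // expn_gt0 U0.
have {}fm := fm MH.
have cs := second_moment_cover h.
have thB a : (S * a <= A)%N -> a%:R <= th * B%:R.
  by move=> Sa; apply: leth; apply: leq_trans AB.
have SU2 : (S * (4 * m + 1) * U ^ 2 <= A)%N.
  by apply: leq_trans U24; rewrite leq_mul // (leq_trans SU).
have h1 : (2 * U ^ 2)%:R <= th * B%:R.
  apply: thB; apply: leq_trans SU2; rewrite mulnA leq_mul2r leq_mul2l; apply/orP; right.
  by apply/orP; right; rewrite addn1 (leq_trans _ (_ : 4 * 1 < _)%N) // ltnS leq_mul.
have h2 : (8 * m * U ^ 2)%:R <= th * B%:R.
  apply: leth; apply: (@leq_trans (2 * (S * (4 * m + 1) * U ^ 2))).
    rewrite (_ : 2 * (S * (4 * m + 1) * U ^ 2) = S * (8 * m * U ^ 2) + 2 * S * U ^ 2)%N; last by ring.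
    exact: leq_addr.
  by apply: (@leq_trans (2 * A)); [rewrite leq_mul|rewrite leq_addr].
have h3 : (U ^ 2 * M)%:R <= th * H%:R by apply: leth; rewrite mulnC.
have h4 : (1 + th) ^+ (2 * m.-1) <= (1 + dl) * (1 - th) ^+ 2.
  have th1 : th <= 1 by apply: le_trans thdl (le_trans dl2 _); rewrite mul1r invf_le1 ?ler1n ?ltr0n.
  have pw1 : (1 + th) ^+ (2 * m.-1) <= 1 + 2 ^+ (2 * m) * th.
    apply: le_trans (exprD1_le _ _) _; first by rewrite (ltW th0).
    rewrite lerD2l ler_wpM2r ?(ltW th0) // ler_weXn2l ?ler1n //.
    by rewrite leq_mul // leq_pred.
  have Sth : (2 ^+ (2 * m) + 4) * th = dl.
    have -> : (2 ^+ (2 * m) + 4 : R) = S%:R / n%:R.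
      by rewrite /S natrM natrD natrX mulrC mulKf // lt0r_neq0.
    by rewrite /th mulrAC mulfV ?mul1r // lt0r_neq0.
  by apply: le_trans pw1 _; apply: theta_choice => //; rewrite -mulrDl.
have h5 : 4 * y0%:R <= dl * K%:R.
  rewrite -natrM; apply: ledl; rewrite /K (_ : n * (4 * y0) = 4 * n * y0)%N; last by ring.
  by rewrite leq_pmulr.
have h6 : (#|[set z : tup j m * tup j m | mdet k z.1 z.2 == 0%N]| * U ^ 16 <= C ^ m * T ^ 2)%N.
  apply: leq_trans par; rewrite leq_mul // -!expnM leq_exp2l //; clear; lia.
have h7 : 36 * (C ^ m * T ^ 2)%:R <= dl * w%:R * T%:R ^+ 2.
  rewrite -natrM -natrX -mulrA -natrM; apply: ledl.
  apply: (@leq_trans (36 * C ^ m * n * T ^ 2)); first by apply: eq_leq; ring.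
  by rewrite leq_mul2r leqnSn orbT.
have h8 : 18 * (C ^ m * T ^ 2)%:R <= dl * y0%:R * T%:R ^+ 2.
  rewrite -natrM -natrX -mulrA -natrM; apply: ledl.
  apply: (@leq_trans (18 * C ^ m * n * T ^ 2)); first by apply: eq_leq; ring.
  by rewrite leq_mul2r leqnSn orbT.
have h9 : (C ^ m * T ^ 2 * (2 * Lc + 1) * H ^ 2)%:R <= dl * (B * U ^ 16 * T ^ 2)%:R.
  apply: ledl; apply: (@leq_trans (n * (C ^ m * T ^ 2 * (2 * Lc + 1) * (A * U) ^ 2))).
    by rewrite leq_mul2l leq_mul2l leq_sqr leq_div !orbT.
  rewrite (_ : n * _ = (n * C ^ m * (2 * Lc + 1)) * A * U ^ 2 * A * T ^ 2)%N; last by ring.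
  rewrite leq_mul2r; apply/orP; right.
  apply: (@leq_trans (n * C ^ m * (2 * Lc + 1) * A * U ^ 2 * (2 ^ (4 * k) * U ^ 4))).
    by rewrite leq_mul2l AU orbT.
  rewrite (_ : _ * (_ * U ^ 4) = (n * C ^ m * (2 * Lc + 1) * 2 ^ (4 * k)) * U ^ 6 * A)%N; last by ring.
  rewrite [X in (_ <= X)%N]mulnC leq_mul //.
  apply: (@leq_trans (U * U ^ 6)); first by rewrite leq_mul2r (leq_trans jC) ?orbT // ltnW.
  by rewrite -expnS leq_pexp2l.
have sm := @second_moment R A m k j K w Lc cc i0 th dl y0 (C ^ m * T ^ 2) k0 K4 (ltn0Sn _) (ltn0Sn _) th0 thdl dl2
  h1 h2 h3 h4 h5 mg mY h6 h7 h8 h9.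
have al0 : (0 : R) < (B ^ (2 * m))%:R by rewrite ltr0n expn_gt0 /B addn1.
have T0' : (0 : R) < T%:R by rewrite ltr0n.
have M0' : (0 : R) < M%:R by rewrite ltr0n.
set s := (\sum_x #|h x|)%N in fm cs; set z := (\sum_z _)%N in sm cs.
set G := #|\bigcup_x h x| in cs.
have csR : (s%:R : R) ^+ 2 <= G%:R * z%:R by rewrite -natrX -natrM ler_nat.
have fin := moments_cover al0 T0' M0' (ler0n R G) dl0 dl1 csR fm sm.
have GE : (G + #|~: \bigcup_x h x| = B ^ (2 * m))%N.
  by rewrite /G cardsC card_block.
have -> : (2 * A + 1 = B)%N by [].
rewrite -GE; set c := #|~: _|; set g := (G + c)%N.
have gE : (B ^ (2 * m) = g)%N by rewrite -GE.
have cg : c%:R <= g%:R * (24 * dl).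
  have : g%:R * (1 - 24 * dl) <= g%:R - c%:R by rewrite /g natrD addrK -natrD -/g -gE.
  by rewrite mulrBr mulr1 lerD2l lerN2.
have cn : c%:R * n%:R <= 24 * g%:R :> R.
  by rewrite -ler_pdivlMr //; apply: le_trans cg _; rewrite mulrCA mulrA.
rewrite -natrM -(natrM _ 24) ler_nat nD mulnCA leq_mul2l /= in cn.
exact: cn.
Qed.

(** The conclusion concerns integers alone, so the field carrying the estimates can be the
    rationals. *)
Definition block_count := block_count_over rat.

(** * Completing net points to solutions *)

(** If [2 ^ (k e) <= r / b < 2 ^ (k (e + 1))], Chebyshev's bound supplies a prime in
    [(2 ^ (e - 3), 2 ^ e]], which is off by at most [2 ^ 4] in the base. The 18 is the threshold of
    that bound. *)
Lemma prime_power_approx k (b r : nat) : (0 < k)%N -> (0 < b)%N -> (b * 2 ^ (18 * k) <= r)%N ->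
  exists y, [/\ prime y, (b * y ^ k <= r)%N & (r <= 16 ^ k * (b * y ^ k))%N].
Proof.
move=> k0 b0 br; set q := (r %/ b)%N.
have q18 : (2 ^ (18 * k) <= q)%N by rewrite leq_divRL // mulnC.
have q0 : (0 < q)%N by apply: leq_trans q18; rewrite expn_gt0.
have p1 : (1 < 2 ^ k)%N by rewrite -[1%N]/(2 ^ 0)%N ltn_exp2l.
set e := trunc_log (2 ^ k) q.
have /andP[e1 e2] := trunc_log_bounds p1 q0; rewrite -/e in e1 e2.
have e18 : (18 <= e)%N by apply: trunc_log_max => //; rewrite -expnM mulnC.
have : (0 < size (big_primes e))%N.
  have := chebyshev e18; case: (size _) => // ; rewrite muln0 leqn0.
  by rewrite expn_eq0.
case E : (big_primes e) => [//|y l] _.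
have : y \in big_primes e by rewrite E mem_head.
rewrite mem_big_primes => /and3P[py y1 y2]; exists y; split => //.
  apply: leq_trans (leq_trunc_div r b); rewrite mulnC leq_mul2r; apply/orP; right.
  by apply: leq_trans e1; rewrite -expnM mulnC expnM leq_expn2r.
apply: ltnW; apply: leq_trans (ltn_ceil r b0) _; rewrite mulnC mulnCA leq_mul2l; apply/orP; right.
apply: leq_trans e2 _; apply: (@leq_trans (16 ^ k * (2 ^ (e - 3)) ^ k)).
  rewrite -[16%N]/(2 ^ 4)%N -!expnM -expnD leq_exp2l //; move: e18; clear -k0; nia.
by rewrite leq_mul2l leq_expn2r ?orbT // ltnW.
Qed.

(** Each prime removes at least the fraction [16 ^ -k] of the remaining target until this falls to
    [h]; the variables left over are then set to 2, at a cost of at most [A 2 ^ k] each. *)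
Lemma greedy_sum (I : eqType) k (s : seq I) (b : I -> int) (A h : nat) (r : int) :
    (0 < k)%N -> uniq s -> {in s, forall i, 0 < b i <= A%:Z} -> 0 <= r ->
    (A * 2 ^ (18 * k) <= h)%N ->
    ((16 ^ k - 1) ^ size s)%N%:Z * r <= ((16 ^ k) ^ size s * h)%N%:Z ->
  exists y : I -> nat, (forall i, prime (y i)) /\
    `|\sum_(i <- s) b i * (y i ^ k)%N%:Z - r| <= (h + size s * A * 2 ^ k)%N%:Z.
Proof.
move=> k0; elim: s r => [|i s IHs] r /=.
  move=> _ _ r0 _; rewrite !expn0 !mul1r mul1n => rh; exists (fun=> 2%N); split => //.
  by rewrite big_nil sub0r normrN ger0_norm // !mul0n addn0.
move=> /andP[iS uS] sb r0 hA hr.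
have [b0 bA] : 0 < b i /\ b i <= A%:Z by apply/andP/sb; rewrite mem_head.
have sb' : {in s, forall i, 0 < b i <= A%:Z} by move=> l ls; apply: sb; rewrite inE ls orbT.
have [rh|rh] := lerP r h%:Z.
  exists (fun=> 2%N); split => //.
  have s0 : 0 <= \sum_(l <- i :: s) b l * (2 ^ k)%N%:Z.
    rewrite big_seq sumr_ge0 // => l ls; rewrite mulr_ge0 //.
    by have /andP[/ltW] := sb l ls.
  have s1 : \sum_(l <- i :: s) b l * (2 ^ k)%N%:Z <= ((size s).+1 * A * 2 ^ k)%N%:Z.
    rewrite big_seq; apply: (@le_trans _ _ (\sum_(l <- i :: s | l \in i :: s) (A * 2 ^ k)%N%:Z)).
      apply: ler_sum => l ls; rewrite PoszM ler_wpM2r //.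
      by have /andP[_] := sb l ls.
    rewrite -big_seq big_const_seq count_predT iter_addr addr0 /=.
    by rewrite (_ : (_ * _ * _)%N%:Z = (A * 2 ^ k)%N%:Z *+ (size s).+1) // -mulr_natl natz -PoszM mulnA.
  move: s0 s1; rewrite PoszD; move: (\sum_(l <- _) _) => x; lia.
have b0' : (0 < `|b i|)%N by lia.
have rb : (`|b i| * 2 ^ (18 * k) <= `|r|)%N.
  apply: (@leq_trans (A * 2 ^ (18 * k))); first by rewrite leq_mul2r; apply/orP; right; lia.
  by apply: leq_trans hA _; lia.
have [y0 [py y1 y2]] := prime_power_approx k0 b0' rb.
set v := b i * (y0 ^ k)%N%:Z.
have vE : (`|b i| * y0 ^ k)%N%:Z = v by rewrite /v PoszM abszE gtr0_norm.
have v1 : v <= r by rewrite -vE -[X in _ <= X](ger0_norm r0) -abszE lez_nat.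
have v2 : r <= (16 ^ k)%N%:Z * v.
  by rewrite -[X in X <= _](ger0_norm r0) -abszE -vE -PoszM lez_nat.
have c0 : 0 <= (16 ^ k - 1)%N%:Z :> int by [].
have C1 : (16 ^ k)%N%:Z = (16 ^ k - 1)%N%:Z + 1 :> int.
  by rewrite -PoszD subnK // expn_gt0.
have C0 : 0 < (16 ^ k)%N%:Z :> int by rewrite ltz_nat expn_gt0.
have h1 : ((16 ^ k - 1) ^ size s)%N%:Z * (r - v) <= ((16 ^ k) ^ size s * h)%N%:Z.
  rewrite -(ler_pM2l C0); move: hr; rewrite !expnS -mulnA !PoszM => hr.
  apply: le_trans hr; rewrite [X in _ <= X * _]mulrC mulrCA -mulrA ler_wpM2l //.
  by move: v2; rewrite C1; move: ((16 ^ k - 1)%N%:Z) => c; lia.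
have rv0 : 0 <= r - v by rewrite subr_ge0.
have [y [yp yE]] := IHs (r - v) uS sb' rv0 hA h1.
exists (fun l => if l == i then y0 else y l); split; first by move=> l; case: ifP.
rewrite big_cons eqxx -/v big_seq (eq_bigr (fun l => b l * (y l ^ k)%N%:Z)); last first.
  by move=> l ls; case: eqP ls => [->|//]; rewrite (negbTE iS).
rewrite -big_seq; move: yE; set Sy := \sum_(l <- s) _ => yE.
rewrite (_ : v + Sy - r = Sy - (r - v)); last by ring.
apply: le_trans yE _; rewrite lez_nat leq_add2l -!mulnA leq_mul2r leqnSn orbT //.
Qed.

(** For each [p], pigeonhole among [M ^ 2] positions with [b] prime to [p] gives a set [J] of [M]
    positions on which [b] is constant modulo [M]. Changing the variable from 2 to another prime on
    some of them adds a multiple of a fixed integer [u] prime to [p], and all multiples modulo [M]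
    occur. Each [p] uses up [M] positions, which explains the term [M size ps]; the gcd [d] of the
    integers [u] is divisible by none of the [p]. *)
Lemma residues_reachable (I : finType) k (M W : nat) (b : I -> int) (ps : seq nat) (V : {set I}) :
    (0 < k)%N -> (0 < M)%N -> (3 <= W)%N ->
    {in ps, forall p, [/\ prime p, (p <= W)%N &
      (M ^ 2 + M * size ps <= #|[set i in V | ~~ (p%:Z %| b i)%Z]|)%N]} ->
  exists d : int, {in ps, forall p : nat, ~~ (p%:Z %| d)%Z} /\ forall rho, (d %| rho)%Z ->
    exists y : I -> nat, [/\ forall i, prime (y i) /\ (y i <= W)%N,
      forall i, i \notin V -> y i = 2%N &
      (\sum_(i in V) b i * ((y i ^ k)%N%:Z - (2 ^ k)%N%:Z) = rho %[mod M])%Z].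
Proof.
move=> k0 M0 W3; elim: ps V => [|p ps IHps] V hps.
  exists 0; split=> // rho /dvdzP[c ->]; exists (fun=> 2%N); split => //.
    by move=> i; split => //; exact: ltnW.
  by rewrite mulr0 big1 // => i _; rewrite subrr mulr0.
have [pp pW pV] := hps p (mem_head _ _).
set Vp := [set i in V | ~~ (p%:Z %| b i)%Z] in pV.
have Mz : (M%:Z != 0 :> int) by rewrite eqz_nat -lt0n.
have res_lt i : (`|(b i %% M)%Z| < M)%N.
  have := ltz_pmod (b i) (_ : 0 < M%:Z); rewrite ltz_nat M0 => /(_ isT).
  by have := modz_ge0 (b i) Mz; move: (b i %% M)%Z => x; lia.
pose res i := Ordinal (res_lt i).
have [beta hbeta] : exists beta, (M <= #|[set i in Vp | res i == beta]|)%N.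
  apply/existsP; apply: contraT; rewrite negb_exists => /forallP hb.
  have : (#|Vp| <= \sum_(beta : 'I_M) M.-1)%N.
    rewrite -sum1_card (partition_big res predT) //=; apply: leq_sum => beta _.
    rewrite -ltnS prednK //; have := hb beta; rewrite -ltnNge; apply: leq_ltn_trans.
    by rewrite -sum1_card; apply/eq_leq/eq_bigl => i; rewrite !inE.
  rewrite sum_nat_const card_ord => le; have := leq_trans pV le.
  by rewrite -mulnn /= mulnS; move: (M * M.-1)%N (leq_mul (leqnn M) (leq_pred M)) M0; lia.
have [J JV JM] : exists2 J : {set I}, J \subset [set i in Vp | res i == beta] & #|J| = M.
  have [s [us sM sV]] : exists s, [/\ uniq s, size s = M & {subset s <= [set i in Vp | res i == beta]}].
    exists (take M (enum [set i in Vp | res i == beta])); split.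
    - by rewrite take_uniq ?enum_uniq.
    - by rewrite size_takel // -cardE.
    - by move=> i /mem_take; rewrite mem_enum.
  exists [set i in s]; first by apply/subsetP => i; rewrite inE; exact: sV.
  by rewrite cardsE (card_uniqP us).
have JVp i : i \in J -> [/\ i \in V, ~~ (p%:Z %| b i)%Z & (b i = (beta : nat)%:Z %[mod M])%Z].
  move=> /(subsetP JV); rewrite !inE => /andP[/andP[iV pbi] /eqP rb]; split => //.
  rewrite -rb /= gez0_abs ?modz_mod //; exact: modz_ge0.
have [i1 i1J] : exists i, i \in J by apply/card_gt0P; rewrite JM.
have [_ pb1 b1] := JVp i1 i1J.
(* Replacing 2 by [q] changes the [k]-th power by an integer prime to [p]: odd if [p = 2], congruent
   to [- 2 ^ k] otherwise. *)
pose q := if p == 2%N then 3%N else p.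
have qp : prime q /\ (q <= W)%N by rewrite /q; case: ifP.
pose f := (q ^ k)%N%:Z - (2 ^ k)%N%:Z.
have pf : ~~ (p%:Z %| f)%Z.
  rewrite /f /q; case: eqP => [->|/eqP p2].
    rewrite -eqz_mod_dvd !modz_nat eqz_nat !modn2 !oddX /=.
    by case: (k) k0.
  have pk : (p ^ k %% p = 0)%N by apply/eqP; rewrite -/(dvdn p _) dvdn_exp.
  rewrite -eqz_mod_dvd !modz_nat eqz_nat pk eq_sym -/(dvdn p (2 ^ k)).
  by rewrite Euclid_dvdX // dvdn_prime2 // negb_and p2.
pose u := b i1 * f.
have pu : ~~ (p%:Z %| u)%Z.
  move: pb1 pf; rewrite !dvdzE /u abszM Euclid_dvdM // negb_or => -> //.
have [|d' [d'ps d'r]] := IHps (V :\: J).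
  move=> p' p'ps; have [|pp' p'W p'V] := hps p'; first by rewrite inE p'ps orbT.
  split => //; move: p'V => /=; rewrite mulnS addnCA => p'V.
  rewrite -(leq_add2l M) (leq_trans p'V) // -JM.
  apply: leq_trans (leq_card_setU _ _); apply: subset_leq_card; apply/subsetP => i.
  by rewrite !inE => /andP[-> ->]; rewrite andbT; case: (i \in J).
have [al [ga dE]] := Bezoutz d' u.
set d := gcdz d' u in dE.
exists d; split.
  move=> p'; rewrite inE => /orP[/eqP->|p'ps].
    by apply: contra pu => /dvdz_trans; apply; rewrite dvdz_gcdr.
  by apply: contra (d'ps p' p'ps) => /dvdz_trans; apply; rewrite dvdz_gcdl.
move=> rho /dvdzP[c cE].
have [y [yp yV yS]] := d'r (c * al * d') (dvdz_mull _ (dvdzz _)).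
(* The number of replacements made in [J]; any residue modulo [M] is possible because [J] has [M]
   elements. *)
pose g := `|((c * ga) %% M)%Z|%N.
have gM : (g <= #|J|)%N.
  rewrite JM /g; have := ltz_pmod (c * ga) (_ : 0 < M%:Z); rewrite ltz_nat M0 => /(_ isT).
  by have := modz_ge0 (c * ga) Mz; move: ((c * ga) %% M)%Z => x; clear; lia.
have [s [us sg sJ]] : exists s, [/\ uniq s, size s = g & {subset s <= J}].
  exists (take g (enum J)); split.
  - by rewrite take_uniq ?enum_uniq.
  - by rewrite size_takel // -cardE.
  - by move=> i /mem_take; rewrite mem_enum.
exists (fun i => if i \in s then q else y i); split.
- by move=> i; case: ifP => // _; exact: yp.
- move=> i iV; case: ifP => [/sJ /JVp[]|_]; first by rewrite (negbTE iV).
  by apply: yV; rewrite inE negb_and iV orbT.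
rewrite (bigID (mem J)) /=.
have -> : \sum_(i in V | i \notin J) b i * (((if i \in s then q else y i) ^ k)%N%:Z - (2 ^ k)%N%:Z) =
   \sum_(i in V :\: J) b i * ((y i ^ k)%N%:Z - (2 ^ k)%N%:Z).
  apply: eq_big => [i|i /andP[_ iJ]]; first by rewrite inE andbC.
  by case: ifP => // /sJ; rewrite (negbTE iJ).
rewrite addrC -modzDml yS modzDml.
have -> : \sum_(i in V | i \in J) b i * (((if i \in s then q else y i) ^ k)%N%:Z - (2 ^ k)%N%:Z) =
   \sum_(i <- s) b i * f.
  rewrite [RHS](big_uniq _ us) /= (bigID (mem s)) /= [X in _ + X]big1 ?addr0; last first.
    move=> i /andP[/andP[_ iJ] iS]; rewrite (negbTE iS) yV ?subrr ?mulr0 //.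
    by rewrite !inE iJ.
  apply: eq_big => [i|i /andP[_ ->] //].
  by apply/idP/idP => [/andP[]//|is_]; rewrite is_ sJ // (_ : i \in V) //; have [] := JVp i (sJ i is_).
have sE : (\sum_(i <- s) b i * f = (c * ga) * u %[mod M])%Z.
  have -> : ((\sum_(i <- s) b i * f) = (\sum_(i <- s) u) %[mod M])%Z.
    rewrite big_seq [in RHS]big_seq; elim/big_ind2: _ => // [x1 x2 y1 y2 e1 e2|i is_].
      by rewrite -modzDm e1 e2 modzDm.
    by have [_ _ bi] := JVp i (sJ i is_); rewrite /u -modzMml bi -b1 modzMml.
  rewrite big_const_seq count_predT sg iter_addr addr0 -mulr_natl natz /g gez0_abs ?modz_ge0 //.
  by rewrite modzMml.
rewrite -modzDmr sE modzDmr; congr (_ %% _)%Z.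
by rewrite cE -dE; ring.
Qed.

Lemma bernoulli_nat c G : (c ^ G * (c + G) <= c * c.+1 ^ G)%N.
Proof.
elim: G => [|G IH]; first by rewrite !expn0 mul1n muln1 addn0.
rewrite !expnS; move: IH; move: (c ^ G)%N (c.+1 ^ G)%N => u v; nia.
Qed.

Lemma take_subset (I : finType) (P : {set I}) n : (n <= #|P|)%N ->
  exists s : seq I, [/\ uniq s, size s = n & {subset s <= P}].
Proof.
move=> nP; exists (take n (enum P)); split.
- by rewrite take_uniq ?enum_uniq.
- by rewrite size_takel // -cardE.
- by move=> i /mem_take; rewrite mem_enum.
Qed.

Lemma coprime_multiple (d : int) (M : nat) rho : (0 < M)%N ->
    (forall p : nat, prime p -> (p %| M)%N -> ~~ (p%:Z %| d)%Z) ->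
  exists rho', (d %| rho')%Z /\ (rho' = rho %[mod M])%Z.
Proof.
move=> M0 dM; have [x [y xy]] := Bezoutz d M%:Z.
have g1 : gcdz d M%:Z = 1.
  apply/eqP; rewrite /gcdz eqz_nat; apply: contraT => gn1.
  set g := gcdn _ _ in gn1.
  have g0 : (0 < g)%N by rewrite gcdn_gt0 M0 orbT.
  have pp : prime (pdiv g) by rewrite pdiv_prime // ltn_neqAle eq_sym gn1.
  have := dM (pdiv g) pp (dvdn_trans (pdiv_dvd g) (dvdn_gcdr _ _)).
  by rewrite dvdzE /= (dvdn_trans (pdiv_dvd g)) // dvdn_gcdl.
exists (rho * x * d); split; first by rewrite dvdz_mull.
apply/eqP; rewrite eqz_mod_dvd.
have -> : rho * x * d - rho = - (rho * y) * M%:Z.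
  by rewrite -[X in _ - X = _]mulr1 -g1 -xy; ring.
by rewrite dvdz_mull.
Qed.

Lemma greedy_signed (I : eqType) k (s : seq I) (b : I -> int) (A h : nat) (r : int) :
    (0 < k)%N -> uniq s -> {in s, forall i, `|b i| <= A%:Z} ->
    {in s, forall i, if 0 <= r then 0 < b i else b i < 0} ->
    (A * 2 ^ (18 * k) <= h)%N ->
    ((16 ^ k - 1) ^ size s * `|r| <= (16 ^ k) ^ size s * h)%N ->
  exists y : I -> nat, (forall i, prime (y i)) /\
    `|\sum_(i <- s) b i * (y i ^ k)%N%:Z - r| <= (h + size s * A * 2 ^ k)%N%:Z.
Proof.
move=> k0 us bA bs hA hr; case: (lerP 0 r) bs => r0 bs.
  apply: greedy_sum => //.
    by move=> i is_; rewrite bs //= (le_trans (ler_norm _)) // bA.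
  by rewrite -[X in _ * X <= _](ger0_norm r0) -abszE -PoszM lez_nat.
have r0' : 0 <= - r by rewrite oppr_ge0 ltW.
have [||y [py yE]] := @greedy_sum I k s (fun i => - b i) A h (- r) k0 us _ r0' hA.
- move=> i is_; rewrite oppr_gt0 bs //= (le_trans (ler_norm _)) // normrN bA //.
- by rewrite -[X in _ * X <= _](ger0_norm r0') normrN -abszE -PoszM lez_nat.
exists y; split => //; move: yE.
have -> : \sum_(i <- s) - b i * (y i ^ k)%N%:Z = - \sum_(i <- s) b i * (y i ^ k)%N%:Z.
  by rewrite -sumrN; apply: eq_bigr => i _; rewrite mulNr.
by rewrite -opprD normrN.
Qed.

(** Net points are defined as values that the outer coefficients complete to 0. For a given cell and
    residue, [G] outer coefficients of suitable sign are spent greedily to reach the cell; the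
    others, with variables at most [W], adjust the residue and move the sum by [O(A)], small against
    [H]. Neither [n0] nor [S] affects [L]: only the threshold on [j] depends on them. *)
Lemma net_reachable (k w K Lc : nat) : (0 < k)%N -> (0 < K)%N ->
  exists L : nat, forall n0 S : nat, exists J1 : nat,
  forall (I : finType) (O : {set I}) (b : I -> int) (A j : nat) (t : int),
    (#|O| <= n0)%N -> (J1 <= j)%N ->
    let U := (2 ^ (k * j))%N in let H := (A * U %/ K)%N in
    (0 < A)%N -> {in O, forall i, `|b i| <= A%:Z} ->
    (L <= #|[set i in O | (0 < b i)%R]|)%N -> (L <= #|[set i in O | (b i < 0)%R]|)%N ->
    (forall p : nat, prime p -> (p <= w)%N -> (L <= #|[set i in O | ~~ (p%:Z %| b i)%Z]|)%N) ->
    `|t| <= (S * A)%N%:Z ->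
  exists cc, net_spec H%:Z (w`!)%:Z Lc cc /\
    forall c, in_net H%:Z (w`!)%:Z Lc cc c ->
      exists y : I -> nat, (forall i, prime (y i)) /\
        c + t + \sum_(i in O) b i * (y i ^ k)%N%:Z = 0.
Proof.
(* [G] greedy steps bring a target of size [Lc.+1 H] down to [H / 8]: by Bernoulli
   [(1 + 1 / c0) ^ G >= 1 + 16 Lc.+1], and [16 (H %/ 8) >= H] when [H >= 8]. *)
move=> k0 K0; set M := w`!; pose c0 := (16 ^ k - 1)%N; pose G := (16 * Lc.+1 * c0)%N.
pose W := (w + 3)%N.
exists (G + (M ^ 2 + M * w.+1))%N => n0 S.
pose kap := (2 ^ (18 * k) + G * 2 ^ k + S + n0 * W ^ k)%N.
exists (8 * kap * K)%N => I O b A j t On J1 U H A0 bA Lp Ln Lr tS.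
have M0 : (0 < M)%N by exact: fact_gt0.
have jU : (j <= U)%N.
  by apply: ltnW; apply: leq_trans (ltn_expl j (ltnSn 1)) _; rewrite leq_exp2l // leq_pmull.
have kapH : (kap * A <= H %/ 8)%N.
  rewrite !leq_divRL // (_ : kap * A * 8 * K = A * (8 * kap * K))%N; last by ring.
  by rewrite leq_mul // (leq_trans J1).
have kap1 : (0 < kap)%N by rewrite /kap !addn_gt0 expn_gt0.
have H8 : (8 <= H)%N.
  have : (0 < H %/ 8)%N by apply: leq_trans kapH; rewrite muln_gt0 kap1.
  by rewrite divn_gt0.
have H0 : 0 < H%:Z by rewrite ltz_nat (leq_trans _ H8).
have hA : (A * 2 ^ (18 * k) <= H %/ 8)%N.
  by apply: leq_trans kapH; rewrite mulnC leq_mul // /kap -!addnA leq_addr.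
have main : forall jr : int * int, exists c : int,
    (`|jr.1| <= Lc)%N -> 0 <= jr.2 < M%:Z ->
    [/\ (c %/ H%:Z)%Z = jr.1, (c %% M%:Z)%Z = jr.2 & exists y : I -> nat, (forall i, prime (y i)) /\
        c + t + \sum_(i in O) b i * (y i ^ k)%N%:Z = 0].
  move=> [l rho] /=.
  case: (pselect ((`|l| <= Lc)%N /\ 0 <= rho < M%:Z)) => [[lL rhoM]|hn]; last first.
    by exists 0 => h1 h2; case: hn.
  (* Aiming at the middle of the cell leaves room for an error of nearly [H / 2]; the errors below
     add up to at most [H / 4]. *)
  set tau := - (l * H%:Z + (H %/ 2)%N%:Z).
  have tauH : (`|tau| <= Lc.+1 * H)%N.
    have : (`|l| * H <= Lc * H)%N by rewrite leq_mul2r lL orbT.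
    have : (`|(l * H%:Z)%R| = `|l| * H)%N by rewrite abszM.
    by rewrite mulSn /tau; move: (l * H%:Z) (Lc * H)%N (`|l| * H)%N => x y z; clear; lia.
  have [s [us sG sO sb]] : exists s : seq I, [/\ uniq s, size s = G, {subset s <= O} &
      {in s, forall i, if 0 <= tau then 0 < b i else b i < 0}].
    have GL : (G <= G + (M ^ 2 + M * w.+1))%N by exact: leq_addr.
    case: (0 <= tau).
      have [s [us sG sS]] := take_subset (leq_trans GL Lp).
      by exists s; split => // i /sS; rewrite inE => /andP[].
    have [s [us sG sS]] := take_subset (leq_trans GL Ln).
    by exists s; split => // i /sS; rewrite inE => /andP[].
  have [||y1 [y1p y1E]] := @greedy_signed I k s b A (H %/ 8) tau k0 us _ sb hA.
  - by move=> i /sO; exact: bA.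
  - rewrite sG.
    have c01 : (16 ^ k = c0.+1)%N by rewrite /c0 subn1 prednK // expn_gt0.
    have c0_gt0 : (0 < c0)%N by rewrite /c0 subn_gt0 -[1%N]/(16 ^ 0)%N ltn_exp2l.
    rewrite -/c0 c01 -(leq_pmul2l c0_gt0).
    apply: leq_trans (_ : c0 ^ G * (c0 + G) * (H %/ 8) <= _)%N; last first.
      by rewrite mulnA leq_mul2r bernoulli_nat orbT.
    rewrite -mulnA mulnCA leq_mul2l; apply/orP; right.
    apply: (@leq_trans (c0 * (Lc.+1 * (16 * (H %/ 8))))).
      rewrite leq_mul2l; apply/orP; right; apply: leq_trans tauH _; rewrite leq_mul2l; apply/orP; right.
      by move: H8; clear; lia.
    rewrite mulnDl; apply: leq_trans (leq_addl _ _); rewrite /G; apply: eq_leq; ring.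
  pose V := O :\: [set i in s].
  pose ps := [seq p <- iota 0 w.+1 | prime p].
  have W3 : (3 <= W)%N by rewrite /W leq_addl.
  have psP : {in ps, forall p, [/\ prime p, (p <= W)%N &
      (M ^ 2 + M * size ps <= #|[set i in V | ~~ (p%:Z %| b i)%Z]|)%N]}.
    move=> p; rewrite mem_filter mem_iota add0n ltnS => /andP[pp pw]; split => //.
      by rewrite /W (leq_trans pw) // leq_addr.
    rewrite -(leq_add2l G); apply: (@leq_trans (G + (M ^ 2 + M * w.+1))).
      rewrite !leq_add2l leq_mul2l; apply/orP; right.
      by rewrite size_filter (leq_trans (count_size _ _)) // size_iota.
    apply: leq_trans (Lr p pp pw) _.
    have cs : #|[set i in s]| = G by rewrite cardsE (card_uniqP us).
    rewrite -[X in (_ <= X + _)%N]cs.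
    apply: leq_trans (leq_card_setU [set i in s] _); apply: subset_leq_card.
    by apply/subsetP => i; rewrite !inE => /andP[-> ->]; rewrite !andbT; case: (i \in s).
  have [d [dps dr]] := residues_reachable k0 M0 W3 psP.
  have dM (p : nat) : prime p -> (p %| M)%N -> ~~ (p%:Z %| d)%Z.
    move=> pp pM; apply: dps; rewrite mem_filter pp mem_iota add0n ltnS /=.
    by rewrite -prime_dvd_fact.
  pose v0 := t + \sum_(i <- s) b i * (y1 i ^ k)%N%:Z + \sum_(i in V) b i * (2 ^ k)%N%:Z.
  have [rho' [drho rhoE]] := coprime_multiple (- (rho + v0)) M0 dM.
  have [y2 [y2W y2V y2E]] := dr rho' drho.
  pose y i := if i \in s then y1 i else y2 i.
  pose c := - (t + \sum_(i in O) b i * (y i ^ k)%N%:Z).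
  have sumO : \sum_(i in O) b i * (y i ^ k)%N%:Z =
      \sum_(i <- s) b i * (y1 i ^ k)%N%:Z + \sum_(i in V) b i * (y2 i ^ k)%N%:Z.
    rewrite (bigID (mem s)) /= (big_uniq _ us) /=; congr (_ + _).
      apply: eq_big => [i|i /andP[_ is_]]; last by rewrite /y is_.
      by apply/andP/idP => [[]//|is_]; split => //; exact: sO.
    apply: eq_big => [i|i /andP[_ /negbTE is_]]; last by rewrite /y is_.
    by rewrite !inE andbC.
  have small : `|t + \sum_(i in V) b i * (y2 i ^ k)%N%:Z| <= ((S + n0 * W ^ k) * A)%N%:Z.
    apply: le_trans (ler_normD _ _) _; rewrite mulnDl PoszD; apply: lerD => //.
    apply: le_trans (ler_norm_sum _ _ _) _.
    apply: (@le_trans _ _ (\sum_(i in V) (W ^ k * A)%N%:Z)).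
      apply: ler_sum => i; rewrite !inE => /andP[_ iO]; rewrite normrM mulrC PoszM.
      apply: ler_pM => //; last exact: bA.
      by rewrite ger0_norm // lez_nat leq_expn2r //; have [] := y2W i.
    rewrite sumr_const -mulr_natl natz -PoszM lez_nat -mulnA leq_mul //.
    by apply: leq_trans On; apply: subset_leq_card; apply: subsetDl.
  have cE : c = l * H%:Z + (H %/ 2)%N%:Z - (t + \sum_(i in V) b i * (y2 i ^ k)%N%:Z)
      - (\sum_(i <- s) b i * (y1 i ^ k)%N%:Z - tau).
    by rewrite /c sumO /tau; ring.
  have kapE : (G * A * 2 ^ k + (S + n0 * W ^ k) * A <= H %/ 8)%N.
    apply: leq_trans kapH; rewrite /kap [X in (_ <= X)%N](_ : _ =
      2 ^ (18 * k) * A + (G * A * 2 ^ k + (S + n0 * W ^ k) * A))%N; last by ring.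
    exact: leq_addl.
  exists c => _ _; split.
  - rewrite cE; move: small y1E kapE; rewrite sG; set e1 := t + _; set e2 := _ - tau.
    move: e1 e2 => e1 e2 h1 h2 h3.
    have : `|e1| + `|e2| <= (H %/ 8)%N%:Z + (H %/ 8)%N%:Z.
      apply: le_trans (lerD h1 h2) _; rewrite -!PoszD lez_nat.
      by rewrite addnCA leq_add2l [X in (X <= _)%N]addnC.
    have Hn0 : H%:Z != 0 by rewrite lt0r_neq0.
    rewrite -addrA -addrA divzMDl // => h4; rewrite divz_small ?addr0 //.
    by move: h4 H8; clear; lia.
  - have -> : c = - (v0 + \sum_(i in V) b i * ((y2 i ^ k)%N%:Z - (2 ^ k)%N%:Z)).
      rewrite /c sumO /v0; congr (- _).
      have -> : \sum_(i in V) b i * ((y2 i ^ k)%N%:Z - (2 ^ k)%N%:Z) =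
          \sum_(i in V) b i * (y2 i ^ k)%N%:Z - \sum_(i in V) b i * (2 ^ k)%N%:Z.
        by rewrite -sumrB; apply: eq_bigr => i _; rewrite mulrBr.
      by ring.
    rewrite -(modz_small rhoM); apply/eqP; rewrite eqz_mod_dvd.
    set SV := \sum_(i in V) _ in y2E *.
    rewrite (_ : - (v0 + SV) - rho = (- (rho + v0)) - SV); last by ring.
    by rewrite -eqz_mod_dvd -rhoE y2E.
  exists y; split; first by move=> i; rewrite /y; case: ifP => // _; have [] := y2W i.
  by rewrite /c; ring.
have [cc ccP] := choice main.
exists (fun l r => cc (l, r)); split.
  by move=> l rho lL rM; have [] := ccP (l, rho) lL rM.
move=> c /andP[cL /eqP cE].
have Mz : M%:Z != 0 :> int by rewrite eqz_nat -lt0n.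
have rM : 0 <= (c %% M%:Z)%Z < M%:Z by rewrite modz_ge0 //= ltz_pmod // ltz_nat.
by have [_ _] := ccP ((c %/ H%:Z)%Z, (c %% M%:Z)%Z) cL rM; rewrite -cE.
Qed.

(** * Superblocks *)

Definition solvable_with (I : finType) k m (b : I -> int) (t : int) A (v : block A m) : Prop :=
  exists (y : I -> nat) (x : 'I_m -> nat * nat),
    [/\ forall i, prime (y i), forall i, prime (x i).1 /\ prime (x i).2 &
      pair_dot (bval v) (fun i => (((x i).1 ^ k)%N%:Z, ((x i).2 ^ k)%N%:Z)) + t +
        \sum_i b i * (y i ^ k)%N%:Z = 0].

Definition rich (I : finType) (L w : nat) (b : I -> int) : bool :=
  [&& (L <= #|[set i | (0 < b i)%R]|)%N, (L <= #|[set i | (b i < 0)%R]|)%N &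
    [forall p : 'I_w.+1, prime p ==> (L <= #|[set i | ~~ ((p : nat)%:Z %| b i)%Z]|)%N]].

(** The scale [j] is given by [2 ^ (4 k j) <= A < 2 ^ (4 k (j + 1))], and the net is adapted to [b]
    and [t]. The order of the quantifiers matters: [S] will grow with the number of superblocks,
    which must not influence [L] and [w]. *)
Lemma block_failure k D : (0 < k)%N -> (0 < D)%N -> let m := (64 * k)%N in
  exists L w : nat, forall n0 S : nat, exists A1 : nat,
  forall (I : finType) (b : I -> int) (A : nat) (t : int),
    (#|I| <= n0)%N -> (A1 <= A)%N -> (forall i, `|b i| <= A%:Z) -> rich L w b ->
    `|t| <= (S * A)%N%:Z ->
  (#|[set v : block A m | `[< ~ solvable_with k b t v >]]| * D <= (2 * A + 1) ^ (2 * m))%N.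
Proof.
move=> k0 D0 m; have [w [K [J0 [K4 hblock]]]] := block_count k0 D0.
have K0 : (0 < K)%N by apply: leq_trans K4.
have [L hnet] := net_reachable w (4 * m * K) k0 K0.
exists L, w => n0 S; have [J1 {}hnet] := hnet n0 S.
exists (2 ^ (4 * k * (J0 + J1)))%N => I b A t In0 A1 bA /and3P[Lp Ln /forallP Lr] tS.
have A0 : (0 < A)%N by apply: leq_trans A1; rewrite expn_gt0.
have p1 : (1 < 2 ^ (4 * k))%N by rewrite -[1%N]/(2 ^ 0)%N ltn_exp2l // muln_gt0.
set j := trunc_log (2 ^ (4 * k)) A.
have jJ : (J0 + J1 <= j)%N by apply: trunc_log_max => //; rewrite -expnM.
have /andP[j1 j2] := trunc_log_bounds p1 A0; rewrite -/j in j1 j2.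
have U4 : ((2 ^ (k * j)) ^ 4 = (2 ^ (4 * k)) ^ j)%N by rewrite -!expnM; congr (_ ^ _)%N; ring.
have h1 : (#|[set: I]| <= n0)%N by rewrite cardsT.
have h2 : (J1 <= j)%N by apply: leq_trans jJ; rewrite leq_addl.
have h3 : {in [set: I], forall i, `|b i| <= A%:Z} by move=> i _; exact: bA.
have h4 : (L <= #|[set i in [set: I] | (0 < b i)%R]|)%N.
  by apply: leq_trans Lp _; apply: subset_leq_card; apply/subsetP => i; rewrite !inE.
have h5 : (L <= #|[set i in [set: I] | (b i < 0)%R]|)%N.
  by apply: leq_trans Ln _; apply: subset_leq_card; apply/subsetP => i; rewrite !inE.
have h6 (p : nat) : prime p -> (p <= w)%N -> (L <= #|[set i in [set: I] | ~~ (p%:Z %| b i)%Z]|)%N.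
  move=> pp pw; have := Lr (Ordinal (pw : (p < w.+1)%N)); rewrite /= pp /= => /leq_trans; apply.
  by apply: subset_leq_card; apply/subsetP => i; rewrite !inE.
have [cc [hcc ccP]] := hnet I [set: I] b A j t h1 h2 A0 h3 h4 h5 h6 tS.
have g1 : (J0 <= j)%N by apply: leq_trans jJ; rewrite leq_addr.
have g2 : ((2 ^ (k * j)) ^ 4 <= A)%N by rewrite U4.
have g3 : (A <= 2 ^ (4 * k) * (2 ^ (k * j)) ^ 4)%N by rewrite U4 -expnS ltnW.
apply: leq_trans (hblock j A cc g1 g2 g3 hcc); rewrite leq_mul2r; apply/orP; right.
apply: subset_leq_card; apply/subsetP => v; rewrite in_set => /asboolP vN.
rewrite inE; apply/negP => /bigcupP[x _]; rewrite in_set => /ccP[y [yp yE]].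
apply: vN; exists y, (fun i => (pval (x i).1, pval (x i).2)); split => //.
  by move=> i; rewrite !pval_prime.
by rewrite -[RHS]yE; congr (_ + _); apply: eq_bigl => i; rewrite inE.
Qed.

(* [lam] outer positions, then [r] superblocks made of [m] pairs and of one spare
   position ([None]). *)
Definition layout (lam r m : nat) : finType :=
  ('I_lam + 'I_r * option ('I_m * bool))%type.

Definition tuple_solvable (I : finType) k (a : I -> int) : Prop :=
  exists x : I -> nat, (forall i, prime (x i)) /\ \sum_i a i * (x i ^ k)%N%:Z = 0.

Lemma sum_layout lam r m (F : layout lam r m -> int) :
  \sum_i F i = \sum_i F (inl i) + \sum_l (F (inr (l, None)) +
     \sum_(i < m) (F (inr (l, Some (i, false))) + F (inr (l, Some (i, true))))).
Proof.
rewrite big_sumType /=; congr (_ + _).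
transitivity (\sum_l \sum_o F (inr (l, o))).
  by rewrite pair_big /=; apply: eq_bigr => -[].
apply: eq_bigr => l _; rewrite (bigD1 None) //=; congr (_ + _).
rewrite (reindex_omap Some id) /=; last by case.
rewrite (eq_bigl predT); last by move=> p; rewrite eqxx.
transitivity (\sum_i \sum_e F (inr (l, Some (i, e)))).
  by rewrite pair_big /=; apply: eq_bigr => -[].
by apply: eq_bigr => i _; rewrite big_bool addrC.
Qed.

Definition lay_out lam r m A (a : {ffun layout lam r m -> 'I_(2 * A + 1)}) : {ffun 'I_lam -> 'I_(2 * A + 1)} :=
  [ffun i => a (inl i)].

Definition lay_block lam r m A (a : {ffun layout lam r m -> 'I_(2 * A + 1)}) (l : 'I_r) : block A m :=
  [ffun i => (a (inr (l, Some (i, false))), a (inr (l, Some (i, true))))].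

Definition lay_spare lam r m A (a : {ffun layout lam r m -> 'I_(2 * A + 1)}) (l : 'I_r) : int :=
  coef (a (inr (l, None))).

Definition block_sum A m (v : block A m) : int := \sum_(i < m) ((bval v i).1 + (bval v i).2).

Definition lay_total k lam r m A (a : {ffun layout lam r m -> 'I_(2 * A + 1)}) : int :=
  (2 ^ k)%N%:Z * \sum_(l < r) (lay_spare a l + block_sum (lay_block a l)).

(** The target of the attempt [l]: the contribution of all superblock coefficients outside the block
    [l], with 3 at the spare variable of [l] and 2 elsewhere. *)
Definition lay_shift k lam r m A (a : {ffun layout lam r m -> 'I_(2 * A + 1)}) (l : 'I_r) : int :=
  lay_total k a - (2 ^ k)%N%:Z * block_sum (lay_block a l) +
    ((3 ^ k)%N%:Z - (2 ^ k)%N%:Z) * lay_spare a l.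

(* All superblocks but one are evaluated at [x = 2], except for the spare
   variable of the remaining one, which is evaluated at [x = 3]. *)
Lemma lay_unsolvable k lam r m A (a : {ffun layout lam r m -> 'I_(2 * A + 1)}) l :
  ~ tuple_solvable k (fun i => coef (a i)) ->
  ~ solvable_with k (fun i => coef (lay_out a i)) (lay_shift k a l) (lay_block a l).
Proof.
move=> aN [y [x [yp xp e]]]; apply: aN.
pose X (i : layout lam r m) : nat := match i with
  | inl i => y i
  | inr (l', o) => if l' == l then
      match o with None => 3%N | Some (i, e) => if e then (x i).2 else (x i).1 end
    else 2%N end.
exists X; split.
  move=> [i|[l' [[i e']|]]]; rewrite /X //; case: eqP => // _.
  by case: e'; have [] := xp i.
rewrite sum_layout /= -[RHS]e addrC; congr (_ + _); last first.
  by apply: eq_bigr => i _; rewrite /lay_out ffunE.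
rewrite (bigD1 l) //= /lay_shift /lay_total (bigD1 (P := predT) l) //= !eqxx.
set R2 := \sum_(l' < r | l' != l) _.
set R1 := \sum_(l' < r | l' != l) (lay_spare a l' + _).
have -> : R2 = (2 ^ k)%N%:Z * R1.
  rewrite mulr_sumr; apply: eq_bigr => l' /negbTE ll; rewrite !ll /lay_spare mulrDr mulrC; congr (_ + _).
  rewrite /block_sum mulr_sumr; apply: eq_bigr => i _.
  by rewrite /bval /lay_block !ffunE /=; ring.
have -> : pair_dot (bval (lay_block a l)) (fun i => (((x i).1 ^ k)%N%:Z, ((x i).2 ^ k)%N%:Z)) =
    \sum_(i < m) (coef (a (inr (l, Some (i, false)))) * ((x i).1 ^ k)%N%:Z +
       coef (a (inr (l, Some (i, true)))) * ((x i).2 ^ k)%N%:Z).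
  by apply: eq_bigr => i _; rewrite /bval /lay_block !ffunE.
rewrite -/(lay_spare a l); move: (lay_spare a l) (block_sum _) => u s.
by move: (\sum_(i < m) _) => d; ring.
Qed.

Lemma block_sum_le A m (v : block A m) : `|block_sum v| <= (2 * m * A)%N%:Z.
Proof.
apply: le_trans (ler_norm_sum _ _ _) _.
apply: (@le_trans _ _ (\sum_(i < m) (2 * A)%N%:Z)).
  apply: ler_sum => i _; apply: le_trans (ler_normD _ _) _.
  by rewrite mul2n -addnn PoszD; apply: lerD; apply: coef_bound.
by rewrite sumr_const card_ord -mulr_natl natz -PoszM lez_nat; apply: eq_leq; ring.
Qed.

Lemma lay_total_le k lam r m A (a : {ffun layout lam r m -> 'I_(2 * A + 1)}) :
  `|lay_total k a| <= (2 ^ k * r * (2 * m + 1) * A)%N%:Z.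
Proof.
rewrite normrM ger0_norm // -!mulnA PoszM; apply: ler_wpM2l => //.
apply: le_trans (ler_norm_sum _ _ _) _.
apply: (@le_trans _ _ (\sum_(l < r) ((2 * m + 1) * A)%N%:Z)); last first.
  by rewrite sumr_const card_ord -mulr_natl natz -PoszM.
apply: ler_sum => l _; apply: le_trans (ler_normD _ _) _.
by rewrite mulnDl mul1n addnC PoszD; apply: lerD; [exact: coef_bound|exact: block_sum_le].
Qed.

(** Let [del l] be the difference of the spare coefficients and [d = 3 ^ k - 2 ^ k]. Equal shifts
    give [d del l = - 2 ^ k sum del]; summing over [l] yields [(d + r 2 ^ k) sum del = 0], whose
    coefficient is positive, and then each [del l] vanishes as [d > 0]. *)
Lemma lay_shift_inj k lam r m A (a b : {ffun layout lam r m -> 'I_(2 * A + 1)}) :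
    (0 < k)%N -> lay_out a = lay_out b -> lay_block a =1 lay_block b ->
    lay_shift k a =1 lay_shift k b -> a = b.
Proof.
move=> k0 ab1 ab2 ab3.
have d0 : 0 < (3 ^ k)%N%:Z - (2 ^ k)%N%:Z by rewrite subr_gt0 ltz_nat ltn_exp2r.
set d := _ - _ in d0.
pose del l := lay_spare a l - lay_spare b l.
have totE : lay_total k a - lay_total k b = (2 ^ k)%N%:Z * \sum_(l < r) del l.
  rewrite /lay_total -mulrBr -sumrB; congr (_ * _); apply: eq_bigr => l _.
  by rewrite ab2 /del; ring.
have delE l : d * del l = - (lay_total k a - lay_total k b).
  have := ab3 l; rewrite /lay_shift ab2 -/d /del.
  move: (lay_total k a) (lay_total k b) (lay_spare a l) (lay_spare b l) => x y u v e.
  have e' : d * u - d * v = y - x.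
    apply/eqP; rewrite -subr_eq0; move/eqP: e; rewrite -subr_eq0 => /eqP e.
    by rewrite -e; apply/eqP; ring.
  by rewrite mulrBr e'; ring.
have sum0 : \sum_(l < r) del l = 0.
  have : d * \sum_(l < r) del l = - (r%:Z * (2 ^ k)%N%:Z) * \sum_(l < r) del l.
    rewrite [LHS]mulr_sumr (eq_bigr _ (fun l _ => delE l)) sumr_const card_ord totE.
    by rewrite -mulr_natl natz; ring.
  move/eqP; rewrite -subr_eq0 -mulrBl mulf_eq0 => /orP[|/eqP //].
  rewrite opprK => /eqP h; have : 0 < d + r%:Z * (2 ^ k)%N%:Z by rewrite ltr_wpDr.
  by rewrite h ltxx.
have tot0 : lay_total k a - lay_total k b = 0 by rewrite totE sum0 mulr0.
have sp l : lay_spare a l = lay_spare b l.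
  apply/eqP; rewrite -subr_eq0 -/(del l); have := delE l; rewrite tot0 oppr0 => /eqP.
  by rewrite mulf_eq0 => /orP[/eqP h|//]; rewrite h ltxx in d0.
apply/ffunP => -[i|[l [[i e]|]]].
- by have /ffunP/(_ i) := ab1; rewrite !ffunE.
- by have /ffunP/(_ i) := ab2 l; rewrite !ffunE => -[]; case: e.
- by apply: coef_inj; exact: sp.
Qed.

Definition spread_const k m := (1 + 2 ^ k * (2 * m) + 3 ^ k)%N.

(** A shift differs from the common total only by terms of its own superblock. So the width of the
    window does not depend on [r]; only its position does. *)
Lemma lay_window k lam r m A (a : {ffun layout lam r m -> 'I_(2 * A + 1)}) l : (0 < A)%N ->
  `|lay_shift k a l - (lay_total k a %/ A%:Z)%Z * A%:Z| <= (spread_const k m * A)%N%:Z.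
Proof.
move=> A0; have An0 : A%:Z != 0 by rewrite eqz_nat -lt0n.
have h1 := modz_ge0 (lay_total k a) An0.
have h2 : (lay_total k a %% A%:Z)%Z < A%:Z by rewrite ltz_pmod.
have -> : lay_shift k a l - (lay_total k a %/ A%:Z)%Z * A%:Z =
   (lay_total k a %% A%:Z)%Z + (((3 ^ k)%N%:Z - (2 ^ k)%N%:Z) * lay_spare a l -
      (2 ^ k)%N%:Z * block_sum (lay_block a l)).
  by rewrite /lay_shift {1}(divz_eq (lay_total k a) A%:Z); ring.
have h3 : `|((3 ^ k)%N%:Z - (2 ^ k)%N%:Z) * lay_spare a l| <= (3 ^ k * A)%N%:Z.
  rewrite normrM PoszM; apply: ler_pM => //; last exact: coef_bound.
  have : (2 ^ k <= 3 ^ k)%N by rewrite leq_expn2r.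
  by move: (2 ^ k)%N (3 ^ k)%N => x y; clear; lia.
have h4 : `|(2 ^ k)%N%:Z * block_sum (lay_block a l)| <= (2 ^ k * (2 * m * A))%N%:Z.
  by rewrite normrM ger0_norm // PoszM; apply: ler_wpM2l => //; exact: block_sum_le.
apply: le_trans (ler_normD _ _) _; rewrite (ger0_norm h1).
apply: le_trans (lerD (ltW h2) (ler_normB _ _)) _.
apply: le_trans (lerD (lexx _) (lerD h3 h4)) _.
by rewrite -!PoszD lez_nat /spread_const; apply: eq_leq; ring.
Qed.

Lemma card_ffun_in (r : nat) (T : finType) (E : {set T}) :
  #|[set h : {ffun 'I_r -> T} | [forall l, h l \in E]]| = (#|E| ^ r)%N.
Proof.
rewrite -[in RHS](card_ord r) -card_ffun_on; apply: eq_card => h.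
by rewrite inE; apply/forallP/ffun_onP.
Qed.

Definition lay_fail (lam r : nat) k m A (ao : {ffun 'I_lam -> 'I_(2 * A + 1)}) :
    {set {ffun layout lam r m -> 'I_(2 * A + 1)}} :=
  [set a | (lay_out a == ao) && `[< ~ tuple_solvable k (fun i => coef (a i)) >]].

(* A tuple with given outer coefficients is determined by its blocks and shifts,
   and all its shifts lie in one of [2 * Q + 1] windows of length [O(A)]; so,
   up to the choice of the window, the superblocks fail independently. *)
Lemma lay_fail_count (lam r k m A : nat) (ao : {ffun 'I_lam -> 'I_(2 * A + 1)}) :
    (0 < k)%N -> (0 < A)%N ->
    let Q := (2 ^ k * r * (2 * m + 1))%N in let c := spread_const k m in
    (forall t : int, `|t| <= ((Q + c) * A)%N%:Z ->
      (#|[set v : block A m | `[< ~ solvable_with k (fun i => coef (ao i)) t v >]]| *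
        (c * 2 ^ (2 * m + 1)) <= (2 * A + 1) ^ (2 * m))%N) ->
  (#|lay_fail r k m ao| * 2 ^ ((2 * m + 1) * r) <= (2 * Q + 1) * (2 * A + 1) ^ ((2 * m + 1) * r))%N.
Proof.
move=> k0 A0 Q c hT.
have An0 : A%:Z != 0 by rewrite eqz_nat -lt0n.
have c0 : (0 < c)%N by rewrite /c /spread_const !addn_gt0.
pose bad t := [set v : block A m | `[< ~ solvable_with k (fun i => coef (ao i)) t v >]].
pose tq (q : 'I_(2 * Q + 1)) (z : 'I_(2 * (c * A) + 1)) : int := coef q * A%:Z + coef z.
pose E (q : 'I_(2 * Q + 1)) : {set block A m * 'I_(2 * (c * A) + 1)} :=
  [set p | p.1 \in bad (tq q p.2)].
have tB (q : 'I_(2 * Q + 1)) (z : 'I_(2 * (c * A) + 1)) : `|coef q * A%:Z + coef z| <= ((Q + c) * A)%N%:Z.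
  apply: le_trans (ler_normD _ _) _; rewrite mulnDl PoszD; apply: lerD; last exact: coef_bound.
  by rewrite normrM PoszM; apply: ler_pM => //; exact: coef_bound.
(* A shift takes [2 c A + 1 <= c (2A + 1)] values in the window, where the spare coefficient it
   replaces takes [2A + 1]: the factor [c] in the hypothesis pays for this. *)
have Ecard q : (#|E q| * 2 ^ (2 * m + 1) <= (2 * A + 1) ^ (2 * m + 1))%N.
  have le1 : (#|E q| <= \sum_(z < 2 * (c * A) + 1) #|bad (tq q z)|)%N.
    apply: (@card_fiber_le _ _ (fun p => p.2)) => z.
    rewrite -(card_imset (bad (tq q z)) (f := fun v => (v, z))); last by move=> v1 v2 [].
    apply: subset_leq_card; apply/subsetP => -[v z']; rewrite !in_set /= => /andP[h /eqP zz].
    by apply/imsetP; exists v; rewrite ?in_set -?zz.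
  rewrite -(leq_pmul2l c0) mulnCA; apply: leq_trans (leq_mul le1 (leqnn _)) _.
  rewrite big_distrl /=; apply: (@leq_trans (\sum_(z < 2 * (c * A) + 1) (2 * A + 1) ^ (2 * m))).
    by apply: leq_sum => z _; apply: hT; exact: tB.
  rewrite sum_nat_const card_ord (expnD _ (2 * m) 1) expn1 [X in (_ <= c * X)%N]mulnC [leqRHS]mulnA.
  by rewrite leq_mul2r; apply/orP; right; move: c0; clear; nia.
pose f (a : {ffun layout lam r m -> 'I_(2 * A + 1)}) :=
  (enc Q (lay_total k a %/ A%:Z)%Z,
   [ffun l => (lay_block a l, enc (c * A) (lay_shift k a l - (lay_total k a %/ A%:Z)%Z * A%:Z))]
   : {ffun 'I_r -> block A m * 'I_(2 * (c * A) + 1)}).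
have qB (a : {ffun layout lam r m -> 'I_(2 * A + 1)}) : `|(lay_total k a %/ A%:Z)%Z| <= Q%:Z :> int.
  rewrite -abszE lez_nat; apply: abs_divz_le; first by rewrite ltz_nat.
  by rewrite -PoszM; exact: lay_total_le.
have fE a l : coef (f a).1 * A%:Z + coef ((f a).2 l).2 = lay_shift k a l.
  by rewrite /= ffunE /= !encK ?qB ?lay_window // addrC subrK.
have f_inj : {in lay_fail r k m ao &, injective f}.
  move=> a b; rewrite !in_set => /andP[/eqP oa _] /andP[/eqP ob _] ab.
  apply: (@lay_shift_inj k) => //; first by rewrite oa ob.
    by move=> l; have := congr1 (fun z : _ * {ffun 'I_r -> block A m * 'I_(2 * (c * A) + 1)} => (z.2 l).1) ab; rewrite /= !ffunE.
  by move=> l; rewrite -!fE ab.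
rewrite -(card_in_imset f_inj).
have le1 : (#|f @: lay_fail r k m ao| <= \sum_(q < 2 * Q + 1) #|E q| ^ r)%N.
  apply: (@card_fiber_le _ _ (fun z => z.1)) => q; rewrite -card_ffun_in.
  rewrite -(card_imset [set h : {ffun 'I_r -> _} | [forall l, h l \in E q]] (f := fun h => (q, h))); last by move=> v1 v2 [].
  apply: subset_leq_card; apply/subsetP => z; rewrite !in_set => /andP[/imsetP[a aF {z}->] /eqP <-].
  apply/imsetP; exists (f a).2; last by case: (f a).
  rewrite in_set; apply/forallP => l; rewrite in_set in_set; apply/asboolP; rewrite /tq fE.
  move: aF; rewrite in_set => /andP[/eqP <- /asboolP aN].
  have -> : ((f a).2 l).1 = lay_block a l by rewrite /= ffunE.
  exact: lay_unsolvable aN.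
apply: leq_trans (leq_mul le1 (leqnn _)) _; rewrite big_distrl /=.
rewrite -[X in (X * (2 * A + 1) ^ _)%N](card_ord (2 * Q + 1)) -sum_nat_const; apply: leq_sum => q _.
by rewrite !expnM -expnMn leq_expn2r.
Qed.

(** * Counting exceptional tuples *)

Lemma layout_failure k : (0 < k)%N -> let m := (64 * k)%N in
  exists L w : nat, forall lam r : nat, exists A1 : nat, forall A, (A1 <= A)%N ->
  (#|[set a : {ffun layout lam r m -> 'I_(2 * A + 1)} |
      rich L w (fun i => coef (lay_out a i)) && `[< ~ tuple_solvable k (fun i => coef (a i)) >]]| *
     2 ^ ((2 * m + 1) * r) <=
   (2 * A + 1) ^ lam * ((2 * (2 ^ k * r * (2 * m + 1)) + 1) * (2 * A + 1) ^ ((2 * m + 1) * r)))%N.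
Proof.
move=> k0 m; have D0 : (0 < spread_const k m * 2 ^ (2 * m + 1))%N.
  by rewrite muln_gt0 expn_gt0 /spread_const !addn_gt0.
have [L [w hLw]] := block_failure k0 D0; exists L, w => lam r.
have [A1 hA1] := hLw lam (2 ^ k * r * (2 * m + 1) + spread_const k m)%N.
exists A1.+1 => A A1A; have A0 : (0 < A)%N by apply: leq_trans A1A.
set S := [set a | _].
pose c (ao : {ffun 'I_lam -> 'I_(2 * A + 1)}) := #|[set a in S | lay_out a == ao]|.
have cle ao : (c ao * 2 ^ ((2 * m + 1) * r) <=
    (2 * (2 ^ k * r * (2 * m + 1)) + 1) * (2 * A + 1) ^ ((2 * m + 1) * r))%N.
  case: (boolP (rich L w (fun i => coef (ao i)))) => ri.
    apply: (@leq_trans (#|lay_fail r k m ao| * 2 ^ ((2 * m + 1) * r))).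
      rewrite leq_mul2r; apply/orP; right; apply: subset_leq_card; apply/subsetP => a.
      by rewrite !in_set => /andP[/andP[_ ->] ->].
    apply: lay_fail_count => // t tB; apply: hA1 => //; first by rewrite card_ord.
    - exact: ltnW.
    - by move=> i; exact: coef_bound.
  suff -> : c ao = 0%N by [].
  apply/eqP; rewrite cards_eq0; apply/eqP/setP => a; rewrite !in_set.
  apply/negP => /andP[/andP[h _] /eqP ao_a]; case/negP: ri.
  by rewrite -ao_a.
have le1 : (#|S| <= \sum_ao c ao)%N by exact: (card_fiber_le (w := @lay_out lam r m A)).
apply: leq_trans (leq_mul le1 (leqnn _)) _; rewrite big_distrl /=.
rewrite -[X in (_ <= X ^ _ * _)%N](card_ord (2 * A + 1)) -[X in (_ <= _ ^ X * _)%N](card_ord lam).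
by rewrite -card_ffun -sum_nat_const; apply: leq_sum.
Qed.

Lemma exists_superset (T : finType) (X : {set T}) n : (#|X| <= n <= #|T|)%N ->
  exists2 J : {set T}, X \subset J & #|J| = n.
Proof.
elim: n => [|n IH] /andP[Xn nT].
  by exists X => //; apply/eqP; rewrite -leqn0.
move: Xn; rewrite leq_eqVlt => /orP[/eqP Xn|Xn]; first by exists X.
have [|J XJ Jn] := IH; first by rewrite -ltnS Xn ltnW.
have /set0Pn[x] : ~: J != set0 by rewrite -card_gt0 cardsCs setCK Jn subn_gt0.
rewrite in_setC => xJ; exists (x |: J); last by rewrite cardsU1 xJ Jn.
by apply: subset_trans XJ _; exact: subsetUr.
Qed.

Lemma card_bigcup_le (I T : finType) (P : pred I) (F : I -> {set T}) :
  (#|\bigcup_(i | P i) F i| <= \sum_(i | P i) #|F i|)%N.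
Proof.
elim/big_rec2: _ => [|i x y _ xy]; first by rewrite cards0.
by apply: leq_trans (leq_card_setU _ _) _; rewrite leq_add2l.
Qed.

Lemma card_subsets_le s L : (#|[pred J : {set 'I_s} | #|J| == L]| <= s ^ L)%N.
Proof.
have -> : #|[pred J : {set 'I_s} | #|J| == L]| = 'C(s, L) by rewrite -[s in RHS]card_ord -card_draws cardsE.
apply: (@leq_trans (s ^_ L)); first by rewrite -bin_ffact leq_pmulr ?fact_gt0.
rewrite ffact_prod -[X in (_ <= _ ^ X)%N]card_ord -prod_nat_const.
by apply: leq_prod => i _; exact: leq_subr.
Qed.

(** The hits lie in some set of [L] positions, chosen in at most [s ^ L] ways; every other position
    is a miss. *)
Lemma card_few_hits (T : finType) (s L N : nat) (E : pred T) :
    (L <= s)%N -> (#|[set x | ~~ E x]| <= N)%N ->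
  (#|[set a : {ffun 'I_s -> T} | (#|[set j | E (a j)]| < L)%N]| <=
     s ^ L * (#|T| ^ L * N ^ (s - L)))%N.
Proof.
move=> Ls EN.
pose S (J : {set 'I_s}) := [set a : {ffun 'I_s -> T} | [forall j, (j \notin J) ==> ~~ E (a j)]].
have Scard (J : {set 'I_s}) : #|J| = L -> (#|S J| <= #|T| ^ L * N ^ (s - L))%N.
  move=> JL; pose F j := [pred x | (j \notin J) ==> ~~ E x].
  have -> : #|S J| = #|family F|.
    by apply: eq_card => a; rewrite !inE; apply: eq_forallb => j; rewrite ?inE.
  rewrite card_family foldrE big_image /= (bigID (mem J)) /=; apply: leq_mul.
    rewrite -JL -prod_nat_const; apply: leq_prod => j jJ; exact: max_card.
  have -> : (s - L)%N = #|[pred j | j \notin J]|.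
    by have := cardC (mem J); rewrite card_ord /= JL => /(canRL (addKn _)) <-; apply: eq_card.
  rewrite -prod_nat_const; apply: leq_prod => j jJ.
  apply: leq_trans EN; apply: subset_leq_card; apply/subsetP => x.
  by rewrite in_set => /implyP; apply.
have sub : [set a : {ffun 'I_s -> T} | (#|[set j | E (a j)]| < L)%N] \subset
    \bigcup_(J : {set 'I_s} | #|J| == L) S J.
  apply/subsetP => a; rewrite in_set => aL.
  have [|J EJ JL] := @exists_superset _ [set j | E (a j)] L.
    by rewrite ltnW //= card_ord.
  apply/bigcupP; exists J; first by rewrite JL.
  rewrite in_set; apply/forallP => j; apply/implyP; apply: contra => Ej.
  by apply: (subsetP EJ); rewrite in_set.
apply: leq_trans (subset_leq_card sub) _.
apply: (@leq_trans (\sum_(J : {set 'I_s} | #|J| == L) #|S J|)).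
  exact: card_bigcup_le.
apply: (@leq_trans (\sum_(J : {set 'I_s} | #|J| == L) #|T| ^ L * N ^ (s - L))).
  by apply: leq_sum => J /eqP; exact: Scard.
rewrite sum_nat_const leq_mul2r; apply/orP; right.
exact: card_subsets_le.
Qed.

(** A nonprime [p] gives the class of all integers, so that the ordinals below [w.+1] can serve as
    indices. *)
Definition in_class w (c : bool + 'I_w.+1) (z : int) : bool :=
  match c with
  | inl true => 0 < z
  | inl false => z < 0
  | inr p => prime p ==> ~~ ((p : nat)%:Z %| z)%Z
  end.

Lemma in_class_rich (I : finType) L w (b : I -> int) :
  (forall c : bool + 'I_w.+1, (L <= #|[set i | in_class c (b i)]|)%N) -> rich L w b.
Proof.
move=> h; apply/and3P; split; [exact: h (inl true)|exact: h (inl false)|].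
apply/forallP => p; apply/implyP => pp; apply: leq_trans (h (inr p)) _.
by apply: subset_leq_card; apply/subsetP => i; rewrite !in_set /= pp.
Qed.

(** For the divisibility classes: two consecutive integers are never both multiples of a prime, so
    halving the index is injective on the multiples. *)
Lemma card_notin_class w (c : bool + 'I_w.+1) A :
  (#|[set x : 'I_(2 * A + 1) | ~~ in_class c (coef x)]| <= A + 1)%N.
Proof.
pose P (x : 'I_(2 * A + 1)) := ~~ in_class c (coef x).
have key (f : 'I_(2 * A + 1) -> nat) : (forall x, P x -> (f x <= A)%N) -> {in P &, injective f} ->
    (#|[set x | P x]| <= A + 1)%N.
  move=> fA f_inj; rewrite [X in (_ <= X)%N]addn1 -[X in (_ <= X)%N](card_ord A.+1).
  apply: (@card_sub_inj _ _ (fun x => inord (f x) : 'I_A.+1)) => x y xP yP /(congr1 val).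
  by rewrite /= !inordK ?ltnS ?fA //; exact: f_inj.
rewrite /P in key *; case: c key {P} => [[]|p] key.
- apply: (key (fun x => x : nat)) => [x|x y _ _]; last exact: val_inj.
  by rewrite /= -leNgt /coef; lia.
- apply: (key (fun x => (x - A)%N)) => [x _|x y].
    by have := ltn_ord x; lia.
  rewrite /in_mem /= -!leNgt /coef => xA yA xy; apply: val_inj => /=.
  by move: xA yA xy; lia.
apply: (key (fun x => (x %/ 2)%N)) => [x _|x y].
  by have := ltn_ord x; lia.
rewrite /in_mem /= !negb_imply => /and3P[pp px _] /and3P[_ py _] xy; apply: val_inj => /=.
have : ((p : nat)%:Z %| (x : nat)%:Z - (y : nat)%:Z)%Z.
  have -> : (x : nat)%:Z - (y : nat)%:Z = coef x - coef y by rewrite /coef; ring.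
  exact: rpredB.
have p1 := prime_gt1 pp.
have d1 : (`|((x : nat)%:Z - (y : nat)%:Z)%R| < 2)%N by lia.
rewrite dvdzE /=; move: d1 p1; move: (p : nat) => q.
by case: (posnP `|((x : nat)%:Z - (y : nat)%:Z)%R|%N) => [|d0 ? ? /(dvdn_leq d0)]; lia.
Qed.

Lemma layout_bij lam r m s (O : {set 'I_s}) : #|O| = lam -> s = (lam + (2 * m + 1) * r)%N ->
  exists g : layout lam r m -> 'I_s,
    bijective g /\ (forall j, j \in O -> exists i, j = g (inl i)).
Proof.
move=> Olam sE; pose Q : finType := ('I_r * option ('I_m * bool))%type.
have cQ : #|Q| = #|~: O|.
  by rewrite cardsCs setCK Olam card_ord card_prod card_option card_prod card_bool !card_ord sE addKn; lia.
pose g (x : layout lam r m) : 'I_s := match x with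
  | inl i => enum_val (cast_ord (esym Olam) i)
  | inr q => enum_val (cast_ord cQ (enum_rank q)) end.
have gO i : g (inl i) \in O by exact: enum_valP.
have gNO q : g (inr q) \notin O by rewrite -in_setC; exact: enum_valP.
exists g; split.
  apply: inj_card_bij; last first.
    by rewrite card_ord card_sum cQ card_ord -Olam cardsC card_ord.
  move=> [i|q] [i'|q'] e.
  - by move/enum_val_inj/cast_ord_inj: e => ->.
  - by have := gNO q'; rewrite -e gO.
  - by have := gNO q; rewrite e gO.
  - by move/enum_val_inj/cast_ord_inj/enum_rank_inj: e => ->.
move=> j jO; exists (cast_ord Olam (enum_rank_in jO j)).
by rewrite /g /= cast_ordK enum_rankK_in.
Qed.

Lemma tuple_solvable_bij (I J : finType) k (g : I -> J) (a : J -> int) : bijective g ->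
  tuple_solvable k (fun i => a (g i)) -> tuple_solvable k a.
Proof.
move=> gb [x [xp e]]; have [h gK hK] := gb; exists (fun j => x (h j)); split => //.
rewrite -[RHS]e (reindex g) /=; last exact: onW_bij.
by apply: eq_bigr => i _; rewrite gK.
Qed.

(** Tuples poor in some class take at most [A + 1] values at all but [L] positions, which produces
    [2A + 2 = 2 (A + 1)]. The others are counted separately for each of at most [s ^ lam] outer sets
    [O], where the choice of the window adds one more factor [O(s)]. *)
Lemma unsolvable_count k : (0 < k)%N -> exists C e s0 : nat, forall s, (s0 <= s)%N ->
  exists A0 : nat, forall A, (A0 <= A)%N ->
  (#|[set a : {ffun 'I_s -> 'I_(2 * A + 1)} | `[< ~ tuple_solvable k (fun i => coef (a i)) >]]| * 2 ^ s
     <= C * s ^ e * (2 * A + 2) ^ s)%N.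
Proof.
move=> k0; have [L [w hLw]] := layout_failure k0.
move: hLw; set m := (64 * k)%N; set n := (2 * m + 1)%N => hLw.
pose lam0 := (L * (w + 3))%N; pose e1 := (lam0 + n)%N.
exists ((w + 3) * 2 ^ L + 2 ^ e1 * (2 * 2 ^ k + 1))%N, (L + e1 + 1)%N, (lam0 + 1)%N => s s_ge.
have s0 : (0 < s)%N by apply: leq_trans s_ge; rewrite addn1.
(* The outer part absorbs the remainder modulo the superblock size [n], so that [lam] stays at most
   [e1] for every [s]. *)
pose lam := (lam0 + (s - lam0) %% n)%N; pose r := ((s - lam0) %/ n)%N.
have n0 : (0 < n)%N by rewrite /n addn1.
have sE : s = (lam + n * r)%N.
  have := divn_eq (s - lam0) n; rewrite -/r => h.
  by rewrite /lam -addnA [(_ %% _ + _)%N]addnC [(n * r)%N]mulnC -h subnKC // (leq_trans _ s_ge) // leq_addr.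
have lam_s : (lam <= s)%N by rewrite [s]sE leq_addr.
have lam0_s : (lam0 <= s)%N by apply: leq_trans lam_s; rewrite leq_addr.
have Ls : (L <= s)%N by apply: leq_trans lam0_s; rewrite leq_pmulr // addn3.
have lam_e : (lam <= e1)%N by rewrite leq_add2l ltnW // ltn_pmod.
have [A1 {}hLw] := hLw lam r; exists A1 => A A1A.
set W := 'I_(2 * A + 1); set S := [set a | _].
pose cls (c : bool + 'I_w.+1) := fun x : W => in_class c (coef x).
pose poor c := [set a : {ffun 'I_s -> W} | (#|[set j | cls c (a j)]| < L)%N].
pose good (O : {set 'I_s}) := [set a : {ffun 'I_s -> W} | (a \in S) &&
  [forall c, (L <= #|[set j in O | cls c (a j)]|)%N]].
(* If no class is poor, [L] members from each of the [w + 3] classes fit into a set [O] of [lam]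
   positions, which is then rich. *)
have sub : S \subset (\bigcup_c poor c) :|: \bigcup_(O : {set 'I_s} | #|O| == lam) good O.
  apply/subsetP => a aS; rewrite in_setU; case: bigcupP => //= noP.
  have aP c : exists J : {set 'I_s}, (J \subset [set j | cls c (a j)]) && (#|J| == L).
    have /take_subset[q [uq sq qs]] : (L <= #|[set j | cls c (a j)]|)%N.
      by rewrite leqNgt; apply/negP => h; apply: noP; exists c; rewrite ?in_set.
    exists [set j in q]; apply/andP; split; first by apply/subsetP => j; rewrite in_set => /qs.
    by rewrite cardsE (card_uniqP uq) sq.
  pose J c := xchoose (aP c).
  have JP c : (J c \subset [set j | cls c (a j)]) && (#|J c| == L) := xchooseP (aP c).
  have Jle : (#|\bigcup_c J c| <= lam0)%N.
    apply: (@leq_trans (\sum_(c : bool + 'I_w.+1) L)%N).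
      apply: leq_trans (card_bigcup_le _ _) _; apply: leq_sum => c _.
      by have /andP[_ /eqP ->] := JP c.
    by rewrite sum_nat_const card_sum card_bool card_ord mulnC /lam0; apply: eq_leq; congr (_ * _)%N; lia.
  have [|O JO Olam] := @exists_superset _ (\bigcup_c J c) lam.
    by rewrite card_ord lam_s andbT (leq_trans Jle) // leq_addr.
  apply/bigcupP; exists O; first by rewrite Olam.
  rewrite in_set aS /=; apply/forallP => c; have /andP[Jc /eqP {1}<-] := JP c.
  apply: subset_leq_card; apply/subsetP => j jJ; rewrite in_set.
  have := subsetP Jc j jJ; rewrite in_set => ->; rewrite andbT.
  by apply: (subsetP JO); apply/bigcupP; exists c.
have poor_le c : (#|poor c| <= s ^ L * ((2 * A + 1) ^ L * (A + 1) ^ (s - L)))%N.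
  rewrite -[X in (_ * (X ^ _ * _))%N](card_ord (2 * A + 1)); apply: card_few_hits => //.
  exact: card_notin_class.
have good_le (O : {set 'I_s}) : #|O| == lam ->
    (#|good O| * 2 ^ (n * r) <= (2 * (2 ^ k * r * n) + 1) * (2 * A + 1) ^ s)%N.
  move=> /eqP Olam; have [g [gb gO]] := layout_bij Olam sE.
  have [h gK hK] := gb.
  pose f (a : {ffun 'I_s -> W}) : {ffun layout lam r m -> W} := [ffun i => a (g i)].
  have f_inj : injective f.
    by move=> a b /ffunP ab; apply/ffunP => j; have := ab (h j); rewrite !ffunE hK.
  rewrite -(card_imset _ f_inj).
  have -> : ((2 * (2 ^ k * r * n) + 1) * (2 * A + 1) ^ s =
     (2 * A + 1) ^ lam * ((2 * (2 ^ k * r * n) + 1) * (2 * A + 1) ^ (n * r)))%N.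
    by rewrite [RHS]mulnCA -expnD -sE.
  apply: leq_trans (hLw A A1A); rewrite leq_mul2r; apply/orP; right.
  apply: subset_leq_card; apply/subsetP => b /imsetP[a + {b}->].
  rewrite !in_set => /andP[/asboolP aN /forallP aO]; apply/andP; split.
    apply: in_class_rich => c; apply: leq_trans (aO c) _.
    rewrite -(card_imset [set i | _] (f := fun i => g (inl i))); last first.
      by move=> i i' /(can_inj gK) [].
    apply: subset_leq_card; apply/subsetP => j; rewrite in_set => /andP[jO jc].
    have [i ji] := gO j jO; apply/imsetP; exists i => //.
    by rewrite in_set !ffunE -ji.
  apply/asboolP; apply: contra_not aN => aN; apply: (tuple_solvable_bij gb).
  by move: aN; congr (tuple_solvable _ _); apply/funext => i; rewrite ffunE.
have S_le : (#|S| <= \sum_c #|poor c| + \sum_(O : {set 'I_s} | #|O| == lam) #|good O|)%N.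
  apply: leq_trans (subset_leq_card sub) _; apply: leq_trans (leq_card_setU _ _) _.
  by apply: leq_add; exact: card_bigcup_le.
apply: leq_trans (leq_mul S_le (leqnn _)) _; rewrite mulnDl -mulnA mulnDl; apply: leq_add.
  apply: (@leq_trans ((w + 3) * (s ^ L * ((2 * A + 1) ^ L * (A + 1) ^ (s - L))) * 2 ^ s)).
    rewrite leq_mul2r; apply/orP; right.
    have -> : (w + 3 = #|{: bool + 'I_w.+1}|)%N by rewrite card_sum card_bool card_ord; lia.
    by rewrite -sum_nat_const; apply: leq_sum.
  have -> : (2 ^ s = 2 ^ L * 2 ^ (s - L))%N by rewrite -expnD subnKC.
  have -> : ((w + 3) * (s ^ L * ((2 * A + 1) ^ L * (A + 1) ^ (s - L))) * (2 ^ L * 2 ^ (s - L)) =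
    (w + 3) * 2 ^ L * (s ^ L * ((2 * A + 1) ^ L * (2 * (A + 1)) ^ (s - L))))%N.
    by rewrite expnMn; ring.
  rewrite leq_mul //; apply: leq_mul; first by rewrite leq_pexp2l // -addnA leq_addr.
  have -> : ((2 * A + 2) ^ s = (2 * A + 2) ^ L * (2 * A + 2) ^ (s - L))%N by rewrite -expnD subnKC.
  by apply: leq_mul; apply: leq_expn2r; lia.
have -> : (2 ^ s = 2 ^ (n * r) * 2 ^ lam)%N by rewrite -expnD addnC -sE.
rewrite mulnA big_distrl /=.
have rs : (r * n <= s)%N by rewrite [s]sE mulnC leq_addl.
apply: (@leq_trans (s ^ lam * ((2 * 2 ^ k + 1) * s * (2 * A + 2) ^ s) * 2 ^ lam)).
  rewrite leq_mul2r; apply/orP; right.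
  apply: (@leq_trans (\sum_(O : {set 'I_s} | #|O| == lam) (2 * 2 ^ k + 1) * s * (2 * A + 2) ^ s)).
    apply: leq_sum => O /good_le h; apply: leq_trans h _; apply: leq_mul; last by apply: leq_expn2r; lia.
    rewrite -mulnA mulnA mulnDl mul1n; apply: leq_add => //.
    by rewrite leq_mul.
  by rewrite sum_nat_const leq_mul2r; apply/orP; right; exact: card_subsets_le.
rewrite (_ : s ^ lam * _ * _ = 2 ^ lam * (2 * 2 ^ k + 1) * (s ^ lam * s * (2 * A + 2) ^ s))%N; last by ring.
apply: leq_mul; first by rewrite leq_mul2r leq_exp2l // lam_e orbT.
rewrite leq_mul2r; apply/orP; right; rewrite -expnSr leq_pexp2l // addn1 ltnS.
by apply: leq_trans lam_e _; rewrite leq_addl.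
Qed.

(** * Lower density *)

(** The two-sided bound makes the infima and their limit exist in [R]. *)
Lemma limn_inf_itv (R : realType) (u : nat -> R) (a b l : R) (N : nat) :
    (forall n, a <= u n <= b) -> (forall n, (N <= n)%N -> l <= u n) ->
  l <= limn_inf u <= b.
Proof.
move=> uab ul; have lb : has_lbound (range u).
  by exists a => _ [n _ <-]; have /andP[] := uab n.
have inf_le n : infs u n <= b.
  apply: le_trans (_ : u n <= b); last by have /andP[] := uab n.
  apply: ge_inf; last by exists n => //=.
  by exists a => _ [m _ <-]; have /andP[] := uab m.
have cv : cvgn (infs u).
  apply: nondecreasing_is_cvgn; first exact: nondecreasing_infs.
  by exists b => _ [n _ <-].
apply/andP; split; last by apply: limr_le => //; exact: nearW.
apply: limr_ge => //; exists N => // n /= Nn.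
apply: lb_le_inf; first by exists (u n), n => /=.
by move=> _ [m /= nm <-]; apply: ul; exact: leq_trans Nn nm.
Qed.

Lemma card_nonzero_tuples s A :
  #|[set a : {ffun 'I_s -> 'I_(2 * A + 1)} | [forall j, coef (a j) != 0]]| = ((2 * A) ^ s)%N.
Proof.
pose E := [pred x : 'I_(2 * A + 1) | coef x != 0].
have cE : #|E| = (2 * A)%N.
  have Alt : (A < 2 * A + 1)%N by lia.
  have -> : #|E| = #|predC1 (Ordinal Alt)|.
    by apply: eq_card => x; rewrite !inE /coef subr_eq0 eqz_nat.
  by rewrite cardC1 card_ord addn1.
transitivity (#|E| ^ #|'I_s|)%N; last by rewrite cE card_ord.
rewrite -card_ffun_on; apply: eq_card => a.
by rewrite inE; apply/forallP/ffun_onP.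
Qed.

(** The unsolvable tuples are counted with zero coefficients allowed, which is harmless since only
    an upper bound for them is at stake. *)
Lemma count_solvable_compl k s A :
  ((2 * A) ^ s <= count_solvable k s A +
    #|[set a : {ffun 'I_s -> 'I_(2 * A + 1)} |
       `[< ~ tuple_solvable k (fun i => coef (a i)) >]]|)%N.
Proof.
rewrite -card_nonzero_tuples /count_solvable; apply: leq_trans (leq_card_setU _ _).
apply: subset_leq_card; apply/subsetP => a; rewrite !in_set => -> /=.
by rewrite asbool_neg orbN.
Qed.

Lemma density_itv (R : realType) k s A : 0 <= density R k s A <= 1.
Proof.
rewrite /density divr_ge0 ?exprn_ge0 //=.
have [|h] := posnP ((2 * A) ^ s); first by rewrite -natrX => ->; rewrite invr0 mulr0.
rewrite ler_pdivrMr -natrX ?ltr0n // mul1r ler_nat -card_nonzero_tuples.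
by apply: subset_leq_card; apply/subsetP => a; rewrite !in_set => /andP[].
Qed.

Lemma density_ge (R : realType) k : (0 < k)%N -> exists C e s0 : nat,
  forall s, (s0 <= s)%N -> exists A0 : nat, forall A, (A0 <= A)%N ->
  1 - C%:R * s%:R ^+ e * (2^-1) ^+ s <= density R k s A.
Proof.
move=> k0; have [C [e [s0 h]]] := unsolvable_count k0.
(* For [A >= 2 ^ s], [(1 + 1 / A) ^ s <= 1 + 2 ^ s / A <= 2]: the factor 2 pays for replacing
   [2A + 2] by [2A]. *)
exists (C * 2)%N, e, s0 => s /h[A0 {}h]; exists (A0 + 2 ^ s)%N => A A0A.
have /h {}h : (A0 <= A)%N by apply: leq_trans A0A; rewrite leq_addr.
have A2 : (2 ^ s <= A)%N by apply: leq_trans A0A; rewrite leq_addl.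
have Agt0 : (0 < A)%N by apply: leq_trans A2; rewrite expn_gt0.
have := count_solvable_compl k s A; move: h; move: #|_| => U hU.
rewrite -(ler_nat R) natrD natrX => hc.
have Ap : 0 < (A%:R : R) by rewrite ltr0n.
have P0 : 0 < ((2 * A)%:R : R) ^+ s by rewrite exprn_gt0 // ltr0n muln_gt0.
rewrite /density ler_pdivlMr // mulrBl mul1r lerBlDr; apply: le_trans hc _.
rewrite lerD2l.
have p2 : 0 < (2 : R) ^+ s by rewrite exprn_gt0.
rewrite -(ler_pM2r p2); move: hU.
rewrite -(ler_nat R) (natrM _ U) (natrM _ (C * s ^ e)) (natrM _ C (s ^ e)) (natrM _ C 2) !natrX => hU.
apply: le_trans hU _.
have -> : C%:R * 2 * s%:R ^+ e * 2^-1 ^+ s * (2 * A)%:R ^+ s * 2 ^+ s =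
  C%:R * s%:R ^+ e * (2 * (2 * A)%:R ^+ s) * (2^-1 * 2) ^+ s :> R by rewrite [in RHS]exprMn; ring.
rewrite mulVf ?pnatr_eq0 // expr1n mulr1 ler_wpM2l ?mulr_ge0 ?exprn_ge0 //.
have -> : (2 * A + 2)%:R = (1 + A%:R^-1) * (2 * A)%:R :> R.
  by rewrite natrD natrM; field; rewrite lt0r_neq0.
rewrite exprMn ler_wpM2r ?(ltW P0) //.
apply: le_trans (exprD1_le _ _) _.
  by rewrite invr_ge0 ltW //= invf_le1 // ler1n.
have : (2 : R) ^+ s * A%:R^-1 <= 1 by rewrite ler_pdivrMr // mul1r -natrX ler_nat.
lra.
Qed.

Theorem theorem1p5 (R : realType) (k : nat) (hk : (2 <= k)%N) :
  exists (lambda C : R), forall s : nat, (0 < s)%N ->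
    `| 1 - limn_inf (fun A : nat => density R k s A) |
      <= C * (s%:R `^ lambda) * (2 ^-1) ^+ s.
Proof.
have [C [e [s0 h]]] := density_ge R (ltnW hk).
(* The summand [2 ^ s0] makes the bound at least 1 for [s < s0], where it is enough that the lower
   limit lies in [[0, 1]]. *)
exists e%:R, (C + 2 ^ s0)%:R => s s_gt0; rewrite powR_mulrn ?ler0n //.
have se : 1 <= (s%:R : R) ^+ e by rewrite exprn_ege1 // ler1n.
have half0 : 0 < (2^-1 : R) ^+ s by rewrite exprn_gt0 // invr_gt0.
have D := density_itv R k s.
rewrite natrD !mulrDl; have [/h[A0 {}h]|ss0] := leqP s0 s.
  have /andP[h1 h2] := limn_inf_itv D h.
  rewrite ger0_norm ?subr_ge0 //.
  have : 0 <= ((2 ^ s0)%:R : R) * s%:R ^+ e * 2^-1 ^+ s.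
    by rewrite !mulr_ge0 ?exprn_ge0 // ltW.
  by move: h1; lra.
have /andP[h1 h2] := @limn_inf_itv _ _ _ _ 0 0 D (fun A _ => proj1 (andP (D A))).
rewrite ger0_norm ?subr_ge0 //; apply: (@le_trans _ _ 1); first by rewrite gerBl.
rewrite ler_wpDl ?mulr_ge0 ?exprn_ge0 //.
rewrite mulrAC -[X in X <= _]mulr1; apply: ler_pM => //.
rewrite natrX exprVn ler_pdivlMr ?exprn_gt0 // mul1r ler_weXn2l ?ler1n //.
exact: ltnW.
Qed.
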